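(* Let $G$ be a non-exact finitely generated discrete group, with a word metric, equipped with an isometric embedding $X\to G$, where $X$ is a coarse union of a sequence $(X_n)$ of finite connected graphs with a uniform bound on vertex degrees, with girth tending to infinity, and that is an expander. Then $\ell^\infty(G)\rtimes_{\mathrm{inj}}G\neq\ell^\infty(G)\rtimes_rG$, i.e. the norms $\|\cdot\|_{\mathrm{inj}}$ and $\|\cdot\|_r$ on $C_c(G,\ell^\infty(G))$ are different.
   Context: A discrete group is exact if it admits a (topologically) amenable action on a non-empty compact Hausdorff space. $G$ acts on $\ell^\infty(G)$ by left translation. Coarse union: $X=\bigsqcup_nX_n$ is the disjoint union of the vertex sets, with a metric restricting to the graph (shortest path) metric on each $X_n$ and such that the distance between $X_n$ and $X_m$ ($n\ne m$) tends to infinity as $n+m\to\infty$. The girth of a graph is the length of its shortest cycle. The sequence is an expander if $|X_n|\to\infty$, the degrees are uniformly bounded, and there is $c>0$ such that for all $n$ the spectrum of the graph Laplacian of $X_n$ (with matrix entries $\Delta_{xx}=\deg(x)$, $\Delta_{xy}=-1$ if $x,y$ are joined by an edge, and $0$ otherwise) lies in $\{0\}\cup[c,\infty)$. For a $G$-$C^*$-algebra $A$ ($G$ acting by automorphisms), $C_c(G,A)$ carries its usual convolution $*$-algebra structure; $A\rtimes_{\max}G$ and $A\rtimes_rG$ are its maximal and reduced $C^*$-completions, the latter with norm $\|\cdot\|_r$. For an equivariant injective $*$-homomorphism $\iota:A\to B$ of $G$-$C^*$-algebras, put $\|a\|_\iota:=\|(\iota\rtimes G)(a)\|_{B\rtimes_{\max}G}$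 for $a\in C_c(G,A)$, where $(\iota\rtimes G)(f)=\iota\circ f$. The injective norm on $C_c(G,A)$ is $\|a\|_{\mathrm{inj}}:=\inf\{\|a\|_\iota : \iota:A\to B\text{ an equivariant injective }*\text{-homomorphism}\}$, and $A\rtimes_{\mathrm{inj}}G$ is the corresponding completion of $C_c(G,A)$. *)

(* Defs.v *)
From HB Require Import structures.
From mathcomp Require Import all_boot all_order all_algebra.
From mathcomp Require Import complex.
From mathcomp Require Import all_classical all_reals all_analysis.

Set Implicit Arguments.
Unset Strict Implicit.
Unset Printing Implicit Defensive.

Import Order.TTheory GRing.Theory Num.Theory.
Import numFieldNormedType.Exports.

Local Open Scope classical_set_scope.
Local Open Scope ring_scope.

(* MathComp's algebras are unital, so the product of a (possibly non-unital)
   C*-algebra is an operation [cmul] on a complex Banach space. *)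
HB.mixin Record isCStarAlgebra (R : realType) A
    & CompleteNormedModule R[i] A := {
  cmul : A -> A -> A;
  cstar : A -> A;
  cmulA : associative cmul;
  cmulDl : left_distributive cmul +%R;
  cmulDr : right_distributive cmul +%R;
  cmulZl : forall (z : R[i]) a b, cmul (z *: a) b = z *: cmul a b;
  cmulZr : forall (z : R[i]) a b, cmul a (z *: b) = z *: cmul a b;
  cstarK : involutive cstar;
  cstarD : {morph cstar : a b / a + b};
  cstarZ : forall (z : R[i]) a, cstar (z *: a) = z^* *: cstar a;
  cstarM : forall a b, cstar (cmul a b) = cmul (cstar b) (cstar a);
  normrM_cmul : forall a b, `|cmul a b| <= `|a| * `|b|;
  normr_cstar_cmul : forall a, `|cmul (cstar a) a| = `|a| ^+ 2
}.

#[short(type="cstarAlgType")]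
HB.structure Definition CStarAlgebra (R : realType) :=
  {A of CompleteNormedModule R[i] A & isCStarAlgebra R A}.

(* The library norm of a module over [R[i]] takes values in [R[i]]. *)
Definition rnorm (R : realType) (V : normedModType R[i]) (x : V) : R :=
  complex.Re `|x|.

Lemma rnormE (R : realType) (V : normedModType R[i]) (x : V) :
  (rnorm x)%:C%C = `|x|.
Proof.
have := normr_ge0 x; rewrite /rnorm; case: `|x| => u v.
by rewrite lecE/= => /andP[/eqP-> _].
Qed.

Lemma Re_normCE (R : realType) (z : R[i]) : (complex.Re `|z|)%:C%C = `|z|.
Proof. by have := @rnormE R (R[i]^o) z. Qed.

Lemma Re_normC_ge0 (R : realType) (z : R[i]) : 0 <= complex.Re `|z|.
Proof. by rewrite -lecR Re_normCE; exact: normr_ge0. Qed.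

Definition is_star_hom (R : realType) (A B : cstarAlgType R) (f : A -> B) :=
  [/\ linear f, {morph f : a b / cmul a b} & {morph f : a / cstar a}].

Section Linf.
Variables (R : realType) (T : Type).
Local Notation C := R[i].

Definition bounded_fct : {pred (T -> C)} :=
  fun f => `[< exists M : R, forall x, `|f x| <= M%:C%C >].

Lemma bounded_fct_submod : submod_closed bounded_fct.
Proof.
split=> [|z f g /asboolP[M fM] /asboolP[N gN]]; apply/asboolP.
  by exists 0 => x; rewrite normr0.
exists (complex.Re `|z| * M + N) => x.
rewrite rmorphD rmorphM/= (le_trans (ler_normD _ _))// lerD//.
by rewrite Re_normCE normrM ler_wpM2l.
Qed.

HB.instance Definition _ := GRing.isSubmodClosed.Build C (T -> C) bounded_fct
  bounded_fct_submod.

Record linf := Linf { linf_fun :> T -> C; _ : linf_fun \in bounded_fct }.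

HB.instance Definition _ := [isSub for linf_fun].
HB.instance Definition _ := [Choice of linf by <:].
HB.instance Definition _ := [SubChoice_isSubLmodule of linf by <:].

Implicit Types f g : linf.

Lemma linfP f g : f =1 g -> f = g.
Proof. by move=> fg; apply/val_inj/funext. Qed.

Lemma linfD f g x : (f + g) x = f x + g x. Proof. by []. Qed.
Lemma linfB f g x : (f - g) x = f x - g x. Proof. by []. Qed.
Lemma linfZ z f x : (z *: f) x = z * f x. Proof. by []. Qed.
Lemma linf0 x : (0 : linf) x = 0. Proof. by []. Qed.

Definition sup_norm f : R := sup [set complex.Re `|f x| | x in [set: T]].

Lemma linf_bounded f : exists M : R, forall x, complex.Re `|f x| <= M.
Proof.
case: f => f /= /asboolP[M fM]; exists M => x.
by rewrite -lecR Re_normCE.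
Qed.

Lemma le_sup_norm f x : complex.Re `|f x| <= sup_norm f.
Proof.
apply: sup_ubound; last by exists x.
by have [M fM] := linf_bounded f; exists M => _ [y _ <-].
Qed.

Lemma sup_norm_le f (M : R) : 0 <= M ->
  (forall x, complex.Re `|f x| <= M) -> sup_norm f <= M.
Proof.
move=> M0 fM; rewrite /sup_norm; have [->|/set0P ne] :=
  eqVneq [set complex.Re `|f x| | x in [set: T]] set0.
  by rewrite sup0.
by apply: ge_sup => // _ [x _ <-].
Qed.

Lemma sup_norm_ge0 f : 0 <= sup_norm f.
Proof.
have [E|/set0P[_ [x _ _]]] :=
  eqVneq [set complex.Re `|f x| | x in [set: T]] set0.
  by rewrite /sup_norm E sup0.
exact: le_trans (Re_normC_ge0 _) (le_sup_norm f x).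
Qed.

Lemma norm_le_sup f x : `|f x| <= (sup_norm f)%:C%C.
Proof. by rewrite -Re_normCE lecR le_sup_norm. Qed.

Lemma sup_norm_leC f (M : R) : 0 <= M ->
  (forall x, `|f x| <= M%:C%C) -> sup_norm f <= M.
Proof.
move=> M0 fM; apply: sup_norm_le => // x.
by rewrite -lecR Re_normCE.
Qed.

Lemma sup_normD f g :
  (sup_norm (f + g))%:C%C <= (sup_norm f)%:C%C + (sup_norm g)%:C%C.
Proof.
rewrite -rmorphD lecR; apply: sup_norm_leC => [|x].
  by rewrite addr_ge0 ?sup_norm_ge0.
by rewrite rmorphD (le_trans (ler_normD _ _))// lerD ?norm_le_sup.
Qed.

Lemma sup_normZ (z : C) f :
  (sup_norm (z *: f))%:C%C = `|z| * (sup_norm f)%:C%C.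
Proof.
rewrite -Re_normCE; set r := complex.Re `|z|.
have r0 : 0 <= r by exact: Re_normC_ge0.
rewrite -rmorphM; congr (_%:C%C); apply/eqP; rewrite eq_le; apply/andP; split.
  apply: sup_norm_leC => [|x]; first by rewrite mulr_ge0 ?sup_norm_ge0.
  by rewrite linfZ normrM rmorphM/= Re_normCE ler_wpM2l ?norm_le_sup.
have [r0'|rn0] := eqVneq r 0; first by rewrite r0' mul0r sup_norm_ge0.
have rp : 0 < r by rewrite lt_def rn0.
rewrite -ler_pdivlMl//; apply: sup_norm_leC => [|x].
  by rewrite mulr_ge0 ?sup_norm_ge0 ?invr_ge0.
rewrite rmorphM/= fmorphV/= ler_pdivlMl ?ltcR// Re_normCE -normrM.
by rewrite -linfZ norm_le_sup.
Qed.

Lemma sup_norm0_eq0 f : (sup_norm f)%:C%C = 0 -> f = 0.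
Proof.
move=> f0; apply: linfP => x; apply/eqP; rewrite linf0 -normr_le0 -f0.
exact: norm_le_sup.
Qed.

HB.instance Definition _ := @Lmodule_isNormed.Build C linf
  (fun f => (sup_norm f)%:C%C) sup_normD sup_normZ sup_norm0_eq0.

Lemma linf_normE f : `|f| = (sup_norm f)%:C%C. Proof. by []. Qed.

Lemma linf_complete (F : set_system linf) :
  ProperFilter F -> cauchy F -> cvg F.
Proof.
move=> FF Fc.
have Fball (e : R) : 0 < e ->
    exists2 f0 : linf, F (ball f0 e%:C%C) & forall f, ball f0 e%:C%C f ->
      forall x, `|f0 x - f x| < e%:C%C.
  move=> e0; have eC0 : 0 < e%:C%C :> C by rewrite ltcR.
  have /cauchyP/(_ _ eC0)[f0 Ff0] : cauchy F by [].
  exists f0 => // f; rewrite -ball_normE/= => ff0 x.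
  by rewrite -linfB (le_lt_trans (norm_le_sup _ _)).
have Re_le (z : C) : `|complex.Re z| <= complex.Re `|z|.
  by case: z => a b /=; rewrite -sqrtr_sqr ler_sqrt ?addr_ge0 ?sqr_ge0// lerDl
    sqr_ge0.
have Im_le (z : C) : `|complex.Im z| <= complex.Re `|z|.
  by case: z => a b /=; rewrite -sqrtr_sqr ler_sqrt ?addr_ge0 ?sqr_ge0// lerDr
    sqr_ge0.
have norm_le (a b : R) : `|Complex a b| <= (`|a| + `|b|)%:C%C.
  rewrite -Re_normCE lecR /= -ler_sqr ?nnegrE ?sqrtr_ge0 ?addr_ge0//.
  rewrite sqr_sqrtr ?addr_ge0 ?sqr_ge0// sqrrD !real_normK ?num_real//.
  by rewrite addrAC lerDl mulrn_wge0// mulr_ge0.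
have pt (p : C -> R) : {morph p : u v / u - v} ->
    (forall z, `|p z| <= complex.Re `|z|) -> forall x,
    exists l : R, forall (e : R) (f0 : linf), 0 < e -> F (ball f0 e%:C%C) ->
      (forall f, ball f0 e%:C%C f -> forall x, `|f0 x - f x| < e%:C%C) ->
      `|p (f0 x) - l| <= e.
  move=> pB ple x.
  pose G := ((fun f : linf => p (f x)) @ F).
  have GF : ProperFilter G by exact: fmap_proper_filter.
  have Gc : cvg G.
    apply: R_complete; apply/cauchyP => e e0; have [f0 Ff0 f0P] := Fball _ e0.
    exists (p (f0 x)); apply: (@filterS _ F _ _ _ _ Ff0) => f /f0P/(_ x) ltfx.
    change (`|p (f0 x) - p (f x)| < e); rewrite -pB (le_lt_trans (ple _))//.
    by rewrite -ltcR Re_normCE.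
  exists (lim G) => e f0 e0 Ff0 f0P; apply/ler_addgt0Pr => d d0.
  have /cvgrPdist_lt/(_ _ d0) Gd : G --> lim G by [].
  have [f [/= fd /f0P/(_ x) fe]] := filter_ex (filterI Gd Ff0).
  rewrite -(subrK (p (f x)) (p (f0 x))) -addrA (le_trans (ler_normD _ _))//.
  rewrite lerD//; last by rewrite distrC ltW.
  by rewrite -pB (le_trans (ple _))// -lecR Re_normCE ltW.
have ReB : {morph @complex.Re R : u v / u - v} by case=> a b [c d].
have /choice[lr lrP] := pt _ ReB Re_le.
have ImB : {morph @complex.Im R : u v / u - v} by case=> a b [c d].
have /choice[li liP] := pt _ ImB Im_le.
pose l x := Complex (lr x) (li x).
have lP (e : R) (f0 : linf) : 0 < e -> F (ball f0 e%:C%C) ->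
    (forall f, ball f0 e%:C%C f -> forall x, `|f0 x - f x| < e%:C%C) ->
    forall x, `|l x - f0 x| <= (e + e)%:C%C.
  move=> e0 Ff0 f0P x; rewrite distrC.
  have := lrP x _ _ e0 Ff0 f0P; have := liP x _ _ e0 Ff0 f0P.
  rewrite /l; case: (f0 x) => a b /= bl al.
  by rewrite (le_trans (norm_le _ _))// lecR lerD.
have lb : l \in bounded_fct.
  have [f0 Ff0 f0P] := Fball _ (@ltr01 R).
  apply/asboolP; exists (1 + 1 + sup_norm f0) => x.
  rewrite -(subrK (f0 x) (l x)) (le_trans (ler_normD _ _))// rmorphD/=.
  by rewrite lerD ?norm_le_sup// lP.
apply/cvg_ex; exists (Linf lb); apply/cvgrPdist_le => -[e e'].
rewrite ltcE/= => /andP[/eqP-> e0].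
have e30 : 0 < e / 3 by rewrite divr_gt0.
have [f0 Ff0 f0P] := Fball _ e30; apply: filterS (Ff0) => f ff0.
rewrite linf_normE (_ : Complex e 0 = e%:C%C)// lecR.
apply: sup_norm_leC; first exact: ltW.
move=> x; rewrite linfB /= -(subrK (f0 x) (l x)) -addrA.
rewrite (le_trans (ler_normD _ _))//.
rewrite [leRHS](_ : _ = (e / 3 + e / 3)%:C%C + (e / 3)%:C%C).
  by rewrite lerD ?lP// ltW// f0P.
rewrite -rmorphD/=; congr (_%:C%C).
by rewrite -mulr2n -mulrSr -[_ / 3 *+ 3]mulr_natr divfK.
Qed.

HB.instance Definition _ := Uniform_isComplete.Build linf linf_complete.

Lemma linf_mul_bounded f g : (fun x => f x * g x) \in bounded_fct.
Proof.
apply/asboolP; exists (sup_norm f * sup_norm g) => x.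
by rewrite normrM rmorphM/= ler_pM// norm_le_sup.
Qed.

Definition linf_mul f g : linf := Linf (linf_mul_bounded f g).

Lemma linf_conj_bounded f : (fun x => (f x)^*) \in bounded_fct.
Proof.
by apply/asboolP; exists (sup_norm f) => x; rewrite norm_conjC norm_le_sup.
Qed.

Definition linf_conj f : linf := Linf (linf_conj_bounded f).

Lemma linf_mulA : associative linf_mul.
Proof. by move=> f g h; apply: linfP => x /=; rewrite mulrA. Qed.

Lemma linf_mulDl : left_distributive linf_mul +%R.
Proof. by move=> f g h; apply: linfP => x /=; rewrite mulrDl. Qed.

Lemma linf_mulDr : right_distributive linf_mul +%R.
Proof. by move=> f g h; apply: linfP => x /=; rewrite mulrDr. Qed.

Lemma linf_mulZl (z : C) f g : linf_mul (z *: f) g = z *: linf_mul f g.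
Proof. by apply: linfP => x; exact/esym/mulrA. Qed.

Lemma linf_mulZr (z : C) f g : linf_mul f (z *: g) = z *: linf_mul f g.
Proof. by apply: linfP => x; exact: mulrCA. Qed.

Lemma linf_conjK : involutive linf_conj.
Proof. by move=> f; apply: linfP => x /=; rewrite conjCK. Qed.

Lemma linf_conjD : {morph linf_conj : f g / f + g}.
Proof. by move=> f g; apply: linfP => x /=; rewrite rmorphD. Qed.

Lemma linf_conjZ (z : C) f : linf_conj (z *: f) = z^* *: linf_conj f.
Proof. by apply: linfP => x; exact: rmorphM. Qed.

Lemma linf_conjM f g :
  linf_conj (linf_mul f g) = linf_mul (linf_conj g) (linf_conj f).
Proof. by apply: linfP => x /=; rewrite rmorphM mulrC. Qed.

Lemma linf_normM f g : `|linf_mul f g| <= `|f| * `|g|.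
Proof.
rewrite !linf_normE -rmorphM lecR; apply: sup_norm_leC => [|x].
  by rewrite mulr_ge0 ?sup_norm_ge0.
by rewrite /= normrM rmorphM/= ler_pM// norm_le_sup.
Qed.

Lemma linf_norm_conj_mul f : `|linf_mul (linf_conj f) f| = `|f| ^+ 2.
Proof.
apply/eqP; rewrite eq_le; apply/andP; split.
  rewrite (le_trans (linf_normM _ _))// expr2 ler_pM// !linf_normE lecR.
  apply: sup_norm_leC; first exact: sup_norm_ge0.
  by move=> x; rewrite norm_conjC norm_le_sup.
rewrite !linf_normE -rmorphXn lecR; set s := sup_norm (linf_mul _ _).
have s0 : 0 <= s by exact: sup_norm_ge0.
rewrite -(sqr_sqrtr s0) ler_sqr ?nnegrE ?sqrtr_ge0 ?sup_norm_ge0//.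
apply: sup_norm_le => [|x]; first exact: sqrtr_ge0.
rewrite -ler_sqr ?nnegrE ?sqrtr_ge0 ?Re_normC_ge0// sqr_sqrtr//.
rewrite -lecR rmorphXn/= Re_normCE.
apply: le_trans (norm_le_sup (linf_mul (linf_conj f) f) x).
by rewrite /= normrM norm_conjC.
Qed.

HB.instance Definition _ := @isCStarAlgebra.Build R linf linf_mul linf_conj
  linf_mulA linf_mulDl linf_mulDr linf_mulZl linf_mulZr linf_conjK linf_conjD
  linf_conjZ linf_conjM linf_normM linf_norm_conj_mul.

End Linf.

Section CrossedProducts.
Variables (R : realType) (G : groupType).
Implicit Types A B : cstarAlgType R.

Definition is_cstar_action A (alpha : G -> A -> A) :=
  [/\ forall g, is_star_hom (alpha g),
      forall a, alpha 1%g a = a &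
      forall g h a, alpha (g * h)%g a = alpha g (alpha h a)].

(* [C_c(G, A)] for the discrete group [G]; its vector space structure is the
   pointwise one of [G -> A]. *)
Definition Cc A : set (G -> A) := [set f | finite_set (f @^-1` [set~ 0])].

Definition convolution A (alpha : G -> A -> A) (f1 f2 : G -> A) : G -> A :=
  fun s => \sum_(t \in [set: G]) cmul (f1 t) (alpha t (f2 (t^-1 * s)%g)).

Definition conv_star A (alpha : G -> A -> A) (f : G -> A) : G -> A :=
  fun s => alpha s (cstar (f s^-1%g)).

Definition is_cstar_seminorm A (alpha : G -> A -> A) (p : (G -> A) -> R) :=
  [/\ forall f1 f2, Cc f1 -> Cc f2 -> p (f1 + f2) <= p f1 + p f2,
      forall (z : R[i]) f, Cc f -> p (z *: f) = complex.Re `|z| * p f,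
      forall f1 f2, Cc f1 -> Cc f2 -> p (convolution alpha f1 f2) <= p f1 * p f2 &
      forall f, Cc f -> p (convolution alpha (conv_star alpha f) f) = p f ^+ 2].

(* The norm of the maximal C*-completion of [C_c(G, A)], i.e. its largest
   C*-seminorm. This supremum is finite (it is at most the l^1-norm); it is
   taken in [\bar R] so that the definition does not presuppose it. *)
Definition max_norm A (alpha : G -> A -> A) (f : G -> A) : \bar R :=
  ereal_sup [set (p f)%:E | p in is_cstar_seminorm alpha].

Definition equivariant A B (alpha : G -> A -> A) (beta : G -> B -> B)
    (iota : A -> B) :=
  forall g a, iota (alpha g a) = beta g (iota a).

Definition inj_norm A (alpha : G -> A -> A) (f : G -> A) : \bar R :=
  ereal_inf [set r | exists B (beta : G -> B -> B) (iota : A -> B),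
    [/\ is_cstar_action beta, is_star_hom iota, injective iota,
        equivariant alpha beta iota & r = max_norm beta (iota \o f)]].

(* The norm of the Hilbert [A]-module l^2(G, A), on its dense submodule
   [C_c(G, A)]: the A-valued inner product is <xi, eta> = sum_g xi(g)^* eta(g). *)
Definition l2_norm A (xi : G -> A) : R :=
  Num.sqrt (rnorm (\sum_(g \in [set: G]) cmul (cstar (xi g)) (xi g))).

(* The (integrated) regular representation of [C_c(G, A)] on l^2(G, A). *)
Definition regular_rep A (alpha : G -> A -> A) (f xi : G -> A) : G -> A :=
  fun g => \sum_(h \in [set: G]) cmul (alpha g^-1%g (f h)) (xi (h^-1 * g)%g).

(* The operator norm of the regular representation, computed on the dense
   submodule [C_c(G, A)]; as for [max_norm], the supremum is finite. *)
Definition red_norm A (alpha : G -> A -> A) (f : G -> A) : \bar R :=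
  ereal_sup [set (l2_norm (regular_rep alpha f xi))%:E |
    xi in [set xi | Cc xi /\ l2_norm xi <= 1]].

Lemma inj_norm_le_max A (alpha : G -> A -> A) (f : G -> A) :
  is_cstar_action alpha -> (inj_norm alpha f <= max_norm alpha f)%E.
Proof.
by move=> alphaP; apply: ereal_inf_lbound; exists A, alpha, id; split.
Qed.

Lemma ltrans_bounded (g : G) (f : linf R G) :
  (fun x => f (g^-1 * x)%g) \in @bounded_fct R G.
Proof. by apply/asboolP; exists (sup_norm f) => x; exact: norm_le_sup. Qed.

Definition ltrans (g : G) (f : linf R G) : linf R G :=
  Linf (ltrans_bounded g f).

Lemma ltrans_action : is_cstar_action ltrans.
Proof.
split=> [g|f|g h f].
- by split=> [z f1 f2|f1 f2|f]; apply: linfP.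
- by apply: linfP => x; rewrite /= invg1 mul1g.
- by apply: linfP => x; rewrite /= invgM mulgA.
Qed.

(* Topological amenability. For discrete [G] the compact subsets of [G] are the
   finite ones, and on Prob(G) the weak-* topology is that of pointwise
   convergence on [G]; a net of approximately equivariant continuous maps
   [m : Z -> Prob(G)] is presented by one such map for each finite [F] and
   [eps > 0]. *)
Definition is_prob (m : G -> R) :=
  (forall g, 0 <= m g) /\ (\esum_(g in [set: G]) (m g)%:E = 1)%E.

Definition is_top_action (Z : topologicalType) (act : G -> Z -> Z) :=
  [/\ forall g, continuous (act g), forall z, act 1%g z = z &
      forall g h z, act (g * h)%g z = act g (act h z)].

Definition amenable_action (Z : topologicalType) (act : G -> Z -> Z) :=
  forall (F : seq G) (eps : R), 0 < eps ->
  exists m : Z -> G -> R,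
  [/\ forall z, is_prob (m z),
      forall h, continuous (fun z => m z h : R) &
      forall g z, g \in F ->
        (\esum_(h in [set: G]) `|m (act g z) h - m z (g^-1 * h)%g|%:E
           <= eps%:E)%E].

Definition exact_group :=
  exists (Z : topologicalType) (act : G -> Z -> Z),
  [/\ [set: Z] !=set0, compact [set: Z], hausdorff_space Z,
      is_top_action act & amenable_action act].

Definition is_word (S w : seq G) :=
  {in w, forall s, (s \in S) || (s^-1%g \in S)}.

Definition generates (S : seq G) :=
  forall g, exists2 w, is_word S w & g = (\big[*%g/1]_(s <- w) s)%g.

(* The left-invariant word metric of the generating set [S]. *)
Definition word_metric (S : seq G) (g h : G) : R :=
  inf [set (size w)%:R | w in
         [set w | is_word S w /\ h = (g * \big[*%g/1]_(s <- w) s)%g]].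

End CrossedProducts.

Section Graphs.
Variable R : realType.

Definition graph_metric (T : finType) (e : rel T) (x y : T) : R :=
  inf [set (size p)%:R | p in [set p | path e x p /\ last x p = y]].

Definition is_graph_cycle (T : finType) (e : rel T) (c : seq T) : bool :=
  [&& (2 < size c)%N, uniq c & cycle e c].

(* The girth of a graph without cycles is [+oo]. *)
Definition girth (T : finType) (e : rel T) : \bar R :=
  ereal_inf [set (size c)%:R%:E | c in is_graph_cycle e].

Definition degree (T : finType) (e : rel T) (x : T) : nat :=
  #|[set y | e x y]|%SET.

Definition laplacian (T : finType) (e : rel T) : 'M[R[i]]_#|T| :=
  \matrix_(i, j) (if i == j then (degree e (enum_val i))%:R
                  else - (e (enum_val i) (enum_val j))%:R).

Definition bounded_degree (X : nat -> finType) (e : forall n, rel (X n)) :=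
  exists D : nat, forall n x, (degree (e n) x <= D)%N.

Definition is_expander (X : nat -> finType) (e : forall n, rel (X n)) :=
  [/\ #|X n| @[n --> \oo] --> \oo, bounded_degree e &
      exists2 c : R, 0 < c & forall n z,
        eigenvalue (laplacian (e n)) z -> z = 0 \/ c%:C%C <= z].

Definition is_metric (T : Type) (d : T -> T -> R) :=
  [/\ forall x y, 0 <= d x y, forall x y, d x y = 0 <-> x = y,
      forall x y, d x y = d y x & forall x y z, d x z <= d x y + d y z].

Definition is_coarse_union (X : nat -> finType) (e : forall n, rel (X n))
    (d : {n & X n} -> {n & X n} -> R) :=
  [/\ is_metric d,
      forall n (x y : X n),
        d (Tagged X x) (Tagged X y) = graph_metric (e n) x y &
      forall M : R, exists N, forall n m, n != m -> (N <= n + m)%N ->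
        forall (x : X n) (y : X m), M <= d (Tagged X x) (Tagged X y)].

End Graphs.

(* Main.v *)
Require Import Defs.
From HB Require Import structures.
From mathcomp Require Import all_boot all_order all_algebra.
From mathcomp Require Import complex.
From mathcomp Require Import all_classical all_reals all_analysis.
From mathcomp Require Import spectral.
From mathcomp Require Import ring lra zify.

Set Implicit Arguments.
Unset Strict Implicit.
Unset Printing Implicit Defensive.

Import Order.TTheory GRing.Theory Num.Theory.
Import numFieldNormedType.Exports.

Local Open Scope classical_set_scope.
Local Open Scope ring_scope.

Local Notation "a ** b" := (cmul a b) (at level 40, left associativity).
Local Notation "a ^#" := (cstar a) (at level 2, format "a ^#").
Local Notation "t .* x" := (t%:C%C *: x) (at level 40).

(** The algebra [l^oo(G)] is injective among [G]-algebras: an equivariant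
    embedding of it into [B] is split by an equivariant positive map from [B].
    Hence [B] can never lower the maximal norm, and it suffices to find an element
    whose maximal norm exceeds its reduced norm. The expander supplies one. In the
    regular representation the Laplacians have a spectral gap, by which
    the projection onto the functions that are constant on each [X n] is a norm
    limit of polynomials in the lazy random walk. But large girth provides
    representations with a vector that is almost invariant under a step of the
    walk and nevertheless almost orthogonal to the limit of its powers, which a
    spectral gap would forbid.

    The proof is quantitative, and uses only one functional on each [B]. Let
    [iota] be an equivariant embedding of [l^oo(G)] into [B]. The image [q] of
    the indicator of the unit of [G] is a projection with
    [q iota(h) q = h(1) q], so a state of the corner [q B q] gives a state [sigma]
    of [B] with [sigma (beta_g (iota h)) = Re h(g^-1)] ([equivariant_state]).
    For [0 <= r <= 1] put, for [f] in [C_c(G, B)],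
      [Psi f = lim_n 1/|X n| sum_(x, y) r^(d(x, y)) sigma (beta_x f(x^-1 y))],
    where [x], [y] run through the image of [X n] in [G] and the limit is along a
    free ultrafilter. On a set of small diameter a graph of large girth is a tree, and
    on a tree [r^d] is a Gram matrix ([tree_gram]); as [f] has finite support, this
    makes [Psi] positive ([local_fct_pos]). Its GNS representation is a
    C*-seminorm, so [Psi f] is a lower bound for the maximal norm of [f]
    ([gns_seminorm], [inj_norm_ge]); on the image of [iota] it does not depend on
    [B].

    Let [K] bound the Laplacians, let [c] be the spectral gap, and let
    [M = 1 - Laplacian / K] on each [X n], which is the step of a lazy random
    walk. Since the values of [x^-1 y] for [x], [y] at distance at most [k + 1] form
    a finite set, the matrices [(K / c) M + 1 - M^k] are those of one element of
    [C_c(G, l^oo(G))] ([kernel_elt]). By the gap, its reduced norm is at most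
    [K / c] ([gap_kernel_norm], [kernel_red_norm]). But [Psi] takes on it a value
    of at least [K / c + 1 / 4] ([gap_kernel_average]): for [r] near [1] the term
    [(K / c) M] contributes nearly [K / c] and the term [1] contributes [1],
    while [M^k] is close to the projection onto the constants, with entries near
    [1 / |X n|], so that almost all of its mass lies at distances where [r^d] is
    small.

    The facts about C*-algebras behind this, the positivity of [a^* a] and the
    contractivity of *-homomorphisms, are derived without spectral theory from
    square roots of [1 - w], which an iteration provides ([one_minus_sqrt]), and
    from Kaplansky's argument that [c^* c] is never the negative of a nonzero
    square of a self-adjoint element ([cstar_cmul_neg_sqr]). *)

(** * Norms and the Hahn-Banach theorem *)

Section RealNorm.
Variables (R : realType) (V : normedModType R[i]).
Implicit Types x y : V.

Lemma rnorm_ge0 x : 0 <= rnorm x.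
Proof. by rewrite -lecR rnormE; exact: normr_ge0. Qed.

Lemma rnorm0 : rnorm (0 : V) = 0.
Proof. by rewrite /rnorm normr0. Qed.

Lemma rnorm_eq0 x : rnorm x = 0 -> x = 0.
Proof. by move=> x0; apply/normr0_eq0; rewrite -rnormE x0. Qed.

Lemma rnormN x : rnorm (- x) = rnorm x.
Proof. by rewrite /rnorm normrN. Qed.

Lemma rnormD x y : rnorm (x + y) <= rnorm x + rnorm y.
Proof. by have := ler_normD x y; rewrite -!rnormE -rmorphD lecR. Qed.

Lemma rnormB x y : rnorm (x - y) <= rnorm x + rnorm y.
Proof. by rewrite -(rnormN y) rnormD. Qed.

Lemma rnormZ (z : R[i]) x : rnorm (z *: x) = complex.Re `|z| * rnorm x.
Proof.
have : (rnorm (z *: x))%:C%C = (complex.Re `|z| * rnorm x)%:C%C.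
  by rewrite rmorphM/= !rnormE Re_normCE normrZ.
by move/complexI.
Qed.

Lemma Re_normC_real (t : R) : complex.Re `|t%:C%C : R[i]| = `|t|.
Proof. by rewrite normc_def /= expr0n /= addr0 sqrtr_sqr. Qed.

Lemma rnormZr (t : R) x : rnorm (t%:C%C *: x) = `|t| * rnorm x.
Proof. by rewrite rnormZ Re_normC_real. Qed.

Lemma Re_normC_i : complex.Re `|'i%C : R[i]| = 1.
Proof. by rewrite normc_def /= expr0n /= add0r expr1n sqrtr1. Qed.

Lemma rnorm_sum (I : Type) (s : seq I) (P : pred I) (F : I -> V) :
  rnorm (\sum_(j <- s | P j) F j) <= \sum_(j <- s | P j) rnorm (F j).
Proof.
elim/big_rec2: _ => [|j y x _ le]; first by rewrite rnorm0.
by rewrite (le_trans (rnormD _ _))// lerD2l.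
Qed.

End RealNorm.

Section HahnBanach.
Variables (R : realType) (V : normedModType R[i]).
Implicit Types (p : V -> R) (x y : V).

Definition sublinear p :=
  (forall x y, p (x + y) <= p x + p y) /\
  (forall (t : R) x, 0 <= t -> p (t .* x) = t * p x).

Definition real_linear (W : lmodType R[i]) (p : W -> R) :=
  (forall x y : W, p (x + y) = p x + p y) /\
  (forall (t : R) (x : W), p (t%:C%C *: x) = t * p x).

Lemma rnorm_sublinear : sublinear (@rnorm R V).
Proof.
split=> [x y|t x t0]; first exact: rnormD.
by rewrite rnormZr ger0_norm.
Qed.

Lemma sublinear0 p : sublinear p -> p 0 = 0.
Proof. by case=> _ /(_ 0 0 (lexx _)); rewrite scaler0 mul0r. Qed.

Lemma sublinearN p x : sublinear p -> - p (- x) <= p x.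
Proof.
move=> ps; have := ps.1 x (- x).
by rewrite subrr sublinear0// -lerBlDr sub0r.
Qed.

(** Lowering a sublinear functional in the direction [y] until it becomes
    additive along [y]; a minimal sublinear functional is thus linear. *)
Definition lower p y x := inf [set p (x + t .* y) - t * p y | t in [set t | 0 <= t]].

Section Lower.
Variables (p : V -> R) (y : V).
Hypothesis ps : sublinear p.

Let lower_lb x : lbound [set p (x + t .* y) - t * p y | t in [set t | 0 <= t]] (- p (- x)).
Proof.
move=> _ [t t0 <-]; rewrite lerBrDr -(ps.2 _ _ t0).
rewrite addrC lerBlDr addrC.
have := ps.1 (- x) (x + t .* y); rewrite addKr; lra.
Qed.

Let lower_has_inf x : has_inf [set p (x + t .* y) - t * p y | t in [set t | 0 <= t]].
Proof.
split; first by exists (p (x + 0 .* y) - 0 * p y), 0 => //=.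
by exists (- p (- x)); exact: lower_lb.
Qed.

Lemma lower_le x t : 0 <= t -> lower p y x <= p (x + t .* y) - t * p y.
Proof.
by move=> t0; apply: ge_inf; [exact: (lower_has_inf x).2|exists t].
Qed.

Lemma lower_le_id x : lower p y x <= p x.
Proof.
by have := lower_le x (lexx 0); rewrite scale0r addr0 mul0r subr0.
Qed.

Lemma lower_sublinear : sublinear (lower p y).
Proof.
split=> [x x'|t x].
  apply/ler_addgt0Pr => e e0.
  have e2 : 0 < e / 2 by rewrite divr_gt0.
  have [_ [t t0 <-] ht] := inf_adherent e2 (lower_has_inf x).
  have [_ [t' t'0 <-] ht'] := inf_adherent e2 (lower_has_inf x').
  have := lower_le (x + x') (addr_ge0 t0 t'0).
  have := ps.1 (x + t .* y) (x' + t' .* y).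
  rewrite addrACA -scalerDl -rmorphD /=.
  rewrite -/(lower p y x) in ht; rewrite -/(lower p y x') in ht'; lra.
rewrite le_eqVlt => /orP[/eqP <-|t0].
  rewrite scale0r mul0r; apply/eqP; rewrite eq_le; apply/andP; split.
    by rewrite -(sublinear0 ps) lower_le_id.
  have := lb_le_inf (lower_has_inf 0).1 (@lower_lb 0).
  by rewrite oppr0 (sublinear0 ps) oppr0.
have le1 (s : R) (z : V) : 0 < s -> lower p y (s .* z) <= s * lower p y z.
  move=> s0; rewrite -ler_pdivrMl//; apply: lb_le_inf => [|_ [u u0 <-]].
    exact: (lower_has_inf z).1.
  rewrite ler_pdivrMl// mulrBr -(ps.2 _ _ (ltW s0)) scalerDr mulrA.
  rewrite scalerA -rmorphM; apply: lower_le.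
  by rewrite mulr_ge0// ltW.
apply/eqP; rewrite eq_le le1//=.
have t1 : 0 < t^-1 by rewrite invr_gt0.
have := le1 _ (t .* x) t1; rewrite scalerA -rmorphM mulVf ?gt_eqF// scale1r.
by rewrite -ler_pdivlMl ?invrK// invr_gt0.
Qed.

Lemma lowerN : lower p y (- y) <= - p y.
Proof.
have := lower_le (- y) (ler01).
by rewrite scale1r addNr (sublinear0 ps) mul1r sub0r.
Qed.

End Lower.

(** A minimal sublinear functional below [p] exists by Zorn's lemma, and it is
    linear because lowering it in any direction leaves it unchanged. *)
Lemma sublinear_minimal p : sublinear p ->
  exists2 f, real_linear f & forall x, f x <= p x.
Proof.
move=> ps.
pose T := {f : V -> R | sublinear f /\ forall x, f x <= p x}.
pose le (f g : T) := `[< forall x, sval g x <= sval f x >].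
suff [[f [fs fp]] fmin] : exists t : T, forall s, le t s -> s = t; last first.
  apply: Zorn => [f|f g h|f g|A tot].
  - by apply/asboolP => x.
  - move=> /asboolP fg /asboolP gh; apply/asboolP => x.
    exact: le_trans (gh x) (fg x).
  - move: f g => [f fP] [g gP] /asboolP/= fg /asboolP/= gf; apply: eq_exist.
    by apply/funext => x; apply/eqP; rewrite eq_le fg gf.
  have [A0|/set0P[f0 Af0]] := eqVneq A set0.
    exists (exist _ p (conj ps (fun x => lexx _))) => f.
    by rewrite A0.
  pose S x := [set sval f x | f in A].
  have Slb x : lbound (S x) (- p (- x)).
    move=> _ [[f [fs fp]] /= _ <-].
    apply: le_trans (sublinearN x fs).
    by rewrite lerN2 fp.
  have Sinf x : has_inf (S x).
    by split; [exists (sval f0 x), f0|exists (- p (- x)); exact: Slb].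
  pose m x := inf (S x).
  have mle f x : A f -> m x <= sval f x.
    by move=> Af; apply: ge_inf; [exact: (Sinf x).2|exists f].
  have ms : sublinear m.
    split=> [x y|t x t0].
      apply/ler_addgt0Pr => e e0.
      have e2 : 0 < e / 2 by rewrite divr_gt0.
      have [_ [f Af <-] hf] := inf_adherent e2 (Sinf x).
      have [_ [g Ag <-] hg] := inf_adherent e2 (Sinf y).
      have [h [Ah hf' hg']] : exists h, [/\ A h,
          forall z, sval h z <= sval f z & forall z, sval h z <= sval g z].
        by case: (tot f g Af Ag) => /asboolP le1; [exists g|exists f].
      rewrite (le_trans (mle h _ Ah))// (le_trans ((svalP h).1.1 _ _))//.
      rewrite -/(m x) in hf; rewrite -/(m y) in hg.
      have := hf' x; have := hg' y; lra.
    rewrite /m; have -> : S (t .* x) = [set t * u | u in S x].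
      apply/seteqP; split => [_ [f Af <-]|_ [_ [f Af <-] <-]].
        by rewrite (svalP f).1.2//; exists (sval f x) => //; exists f.
      by exists f => //; rewrite (svalP f).1.2.
    move: t0; rewrite le_eqVlt => /orP[/eqP <-|t0].
      rewrite mul0r (_ : [set _ | _ in _] = [set 0]) ?inf1//.
      apply/seteqP; split => [_ [u _ <-]|_ ->]; first by rewrite mul0r.
      by exists (sval f0 x); [exists f0|rewrite mul0r].
    apply/eqP; rewrite eq_le; apply/andP; split.
      rewrite -ler_pdivrMl//; apply: lb_le_inf => [|u Su]; first exact: (Sinf x).1.
      rewrite ler_pdivrMl//; apply: ge_inf; last by exists u.
      exists (t * - p (- x)) => _ [v Sv <-]; rewrite ler_pM2l//.
      exact: Slb.
    apply: lb_le_inf => [|_ [u Su <-]].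
      by exists (t * sval f0 x), (sval f0 x) => //; exists f0.
    by rewrite ler_pM2l//; apply: ge_inf => //; exact: (Sinf x).2.
  have mp x : m x <= p x.
    exact: le_trans (mle _ _ Af0) ((svalP f0).2 x).
  exists (exist _ m (conj ms mp)) => f Af.
  by apply/asboolP => x; exact: mle.
exists f => //.
have fE y x : f x <= lower f y x.
  have lp z : lower f y z <= p z by exact: le_trans (lower_le_id y fs z) (fp z).
  have /fmin : le (exist _ f (conj fs fp))
      (exist _ (lower f y) (conj (lower_sublinear y fs) lp)).
    by apply/asboolP => z; exact: lower_le_id.
  by case=> {1}<-.
have fD x y : f (x + y) = f x + f y.
  apply/eqP; rewrite eq_le fs.1/=.
  have := le_trans (fE y x) (lower_le y fs x ler01).
  by rewrite scale1r mul1r lerBrDr.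
split=> // t x.
have [t0|/ltW t0] := leP 0 t; first exact: fs.2.
have := fD (t .* x) (- t .* x); rewrite -scalerDl -rmorphD subrr scale0r.
rewrite (sublinear0 fs) (fs.2 (- t)) ?oppr_ge0//; lra.
Qed.

(** Lowering the norm in the direction [v] first forces the functional to take at
    [- v] a value of at most [- rnorm v]. *)
Lemma norming_functional (v : V) :
  exists f, [/\ real_linear f, forall x, f x <= rnorm x & f v = rnorm v].
Proof.
have ns := rnorm_sublinear.
have [f fl fle] := sublinear_minimal (lower_sublinear v ns).
have fle' x : f x <= rnorm x by exact: le_trans (fle x) (lower_le_id v ns x).
exists f; split=> //; apply/eqP; rewrite eq_le fle'/=.
have := le_trans (fle (- v)) (lowerN v ns).
have := fl.2 (-1) v; rewrite rmorphN scaleN1r mulN1r => ->.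
by rewrite lerN2.
Qed.

End HahnBanach.

(** * A tactic for linear combinations *)

Section LinearCombinations.
Variables (K : comPzRingType) (V : lmodType K).

Inductive lexp :=
  LVar of nat | LZero | LAdd of lexp & lexp | LOpp of lexp | LScale of K & lexp.

Fixpoint leval (env : seq V) e : V :=
  match e with
  | LVar n => nth 0 env n
  | LZero => 0
  | LAdd e1 e2 => leval env e1 + leval env e2
  | LOpp e1 => - leval env e1
  | LScale z e1 => z *: leval env e1
  end.

Fixpoint lcoef e (n : nat) : K :=
  match e with
  | LVar m => if Nat.eqb m n then 1 else 0
  | LZero => 0
  | LAdd e1 e2 => lcoef e1 n + lcoef e2 n
  | LOpp e1 => - lcoef e1 n
  | LScale z e1 => z * lcoef e1 n
  end.

Lemma levalE env e : leval env e = \sum_(n < size env) lcoef e n *: nth 0 env n.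
Proof.
elim: e => [m||e1 IH1 e2 IH2|e1 IH1|z e1 IH1] /=; rewrite ?IH1 ?IH2.
- have eqbE n : Nat.eqb m n = (m == n) by apply/(sameP (PeanoNat.Nat.eqb_spec m n))/eqP.
  have [lt_m|le_m] := ltnP m (size env); last first.
    rewrite nth_default// big1// => n _.
    rewrite eqbE gtn_eqF ?scale0r//; exact: leq_trans (ltn_ord n) le_m.
  rewrite (bigD1 (Ordinal lt_m))//= eqbE eqxx scale1r big1 ?addr0// => n nm.
  by move: nm; rewrite -val_eqE /= eqbE eq_sym => /negbTE->; rewrite scale0r.
- by rewrite big1// => n _; rewrite scale0r.
- by rewrite -big_split; apply: eq_bigr => n _; rewrite scalerDl.
- by rewrite -sumrN; apply: eq_bigr => n _; rewrite scaleNr.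
- by rewrite scaler_sumr; apply: eq_bigr => n _; rewrite scalerA.
Qed.

(** Defined by recursion in order to unfold, for a concrete environment, to the
    list of equations between coefficients. *)
Fixpoint lcoef_eq e1 e2 n : Prop :=
  if n is m.+1 then lcoef e1 m = lcoef e2 m /\ lcoef_eq e1 e2 m else True.

Lemma leval_eq env e1 e2 : lcoef_eq e1 e2 (size env) -> leval env e1 = leval env e2.
Proof.
rewrite !levalE => h; apply: eq_bigr => -[n lt_n] _ /=; congr (_ *: _).
elim: (size env) h lt_n => //= m IH [hm /IH hn].
by rewrite ltnS leq_eqVlt => /orP[/eqP->|].
Qed.

End LinearCombinations.

(** [lmod] proves equalities between linear combinations in a module by
    comparing the coefficients of each vector. *)
Ltac lmod_index x env :=
  lazymatch env with
  | x :: _ => constr:(0%N)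
  | _ :: ?env' => let n := lmod_index x env' in constr:(n.+1)
  end.

Ltac lmod_env t env :=
  lazymatch t with
  | (?a + ?b)%R => let env' := lmod_env a env in lmod_env b env'
  | (- ?a)%R => lmod_env a env
  | (_ *: ?a)%R => lmod_env a env
  | 0%R => env
  | _ => match env with
         | _ => let n := lmod_index t env in env
         | _ => constr:(t :: env)
         end
  end.

Ltac lmod_reify K t env :=
  lazymatch t with
  | (?a + ?b)%R => let a' := lmod_reify K a env in let b' := lmod_reify K b env in
      constr:(LAdd a' b')
  | (- ?a)%R => let a' := lmod_reify K a env in constr:(LOpp a')
  | (?z *: ?a)%R => let a' := lmod_reify K a env in constr:(@LScale K z a')
  | 0%R => constr:(@LZero K)
  | _ => let n := lmod_index t env in constr:(@LVar K n)
  end.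

Ltac lmod K V :=
  match goal with |- @eq ?T ?a ?b =>
    let e0 := constr:(@nil T) in
    let env := lmod_env a e0 in let env := lmod_env b env in
    let a' := lmod_reify K a env in let b' := lmod_reify K b env in
    change (@leval K V env a' = @leval K V env b');
    apply: leval_eq; cbn [size lcoef_eq lcoef Nat.eqb];
    repeat split; rewrite ?rmorphD ?rmorphN ?rmorphM ?fmorphV ?rmorph_nat ?rmorph1 ?rmorph0 /=; try field; try done
  end.

(** * C*-algebras without spectral theory *)

Section CStarBasics.
Variables (R : realType) (B : cstarAlgType R).
Implicit Types a b c x y : B.

Lemma cmul0l a : 0 ** a = 0.
Proof. by have := cmulZl 0 0 a; rewrite !scale0r. Qed.
Lemma cmul0r a : a ** 0 = 0.
Proof. by have := cmulZr 0 a 0; rewrite !scale0r. Qed.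
Lemma cmulNl a b : (- a) ** b = - (a ** b).
Proof. by rewrite -scaleN1r cmulZl scaleN1r. Qed.
Lemma cmulNr a b : a ** (- b) = - (a ** b).
Proof. by rewrite -scaleN1r cmulZr scaleN1r. Qed.
Lemma cmulBl a b c : (a - b) ** c = a ** c - b ** c.
Proof. by rewrite cmulDl cmulNl. Qed.
Lemma cmulBr a b c : a ** (b - c) = a ** b - a ** c.
Proof. by rewrite cmulDr cmulNr. Qed.
Lemma cmulA4 a b c d : a ** b ** (c ** d) = a ** (b ** c) ** d.
Proof. by rewrite !cmulA. Qed.

Lemma conjC_real (t : R) : (t%:C%C : R[i])^* = t%:C%C.
Proof. by apply/conj_Creal; apply/complex_realP; exists t. Qed.
Lemma conjC_i : ('i%C : R[i])^* = - 'i%C.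
Proof. by rewrite /Num.conj /=; apply/eqP; rewrite eq_complex /= oppr0 !eqxx. Qed.

Lemma cstarZr (t : R) a : (t .* a)^# = t .* a^#.
Proof. by rewrite cstarZ conjC_real. Qed.
Lemma cstarN a : (- a)^# = - a^#.
Proof. by rewrite -scaleN1r cstarZ rmorphN rmorph1 scaleN1r. Qed.
Lemma cstarB a b : (a - b)^# = a^# - b^#.
Proof. by rewrite cstarD cstarN. Qed.
Lemma cstar0 : (0 : B)^# = 0.
Proof. by have := cstarZ 0 (0 : B); rewrite rmorph0 !scale0r. Qed.

Lemma rnorm_cmul a b : rnorm (a ** b) <= rnorm a * rnorm b.
Proof. by rewrite -lecR rmorphM/= !rnormE normrM_cmul. Qed.

Lemma rnorm_cstar_cmul a : rnorm (a^# ** a) = rnorm a ^+ 2.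
Proof.
by apply/complexI; rewrite rmorphXn/= !rnormE normr_cstar_cmul.
Qed.

Lemma rnorm_cstar a : rnorm a^# = rnorm a.
Proof.
have le b : rnorm b <= rnorm b^#.
  have [b0|b0] := eqVneq (rnorm b) 0; first by rewrite b0 rnorm_ge0.
  have bp : 0 < rnorm b by rewrite lt_def b0 rnorm_ge0.
  by rewrite -(ler_pM2r bp) -expr2 -rnorm_cstar_cmul rnorm_cmul.
by apply/eqP; rewrite eq_le le -{2}(cstarK a) le.
Qed.

Lemma rnorm_sa a : a^# = a -> rnorm (a ** a) = rnorm a ^+ 2.
Proof. by move=> aE; rewrite -rnorm_cstar_cmul aE. Qed.

Lemma cstar_cmul_eq0 a : a^# ** a = 0 -> a = 0.
Proof.
move=> a0; apply: rnorm_eq0; apply/eqP.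
by rewrite -sqrf_eq0 -rnorm_cstar_cmul a0 rnorm0.
Qed.

Lemma rnorm_le_eq0 (V : normedModType R[i]) (x : V) (C : R) :
  (forall e, 0 < e -> rnorm x <= C * e) -> x = 0.
Proof.
move=> xC; apply: rnorm_eq0; apply/eqP; rewrite eq_le rnorm_ge0 andbT.
apply/ler_addgt0Pr => e e0; rewrite add0r.
have C1 : 0 < 1 + `|C| by rewrite ltr_pwDl.
have := xC _ (divr_gt0 e0 C1); move/le_trans; apply.
rewrite mulrCA -[leRHS]mulr1 ler_pM2l// ler_pdivrMr// mul1r.
by rewrite (le_trans (ler_norm C))// lerDr.
Qed.

Definition rcvg (u : nat -> B) (l : B) :=
  forall e : R, 0 < e -> exists N, forall n, (N <= n)%N -> rnorm (u n - l) <= e.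

Lemma rcauchy_cvg (u : nat -> B) :
  (forall e : R, 0 < e -> exists N, forall n, (N <= n)%N -> rnorm (u n - u N) <= e) ->
  exists l, rcvg u l.
Proof.
move=> uc.
have eC (e : R[i]) : 0 < e -> e = (complex.Re e)%:C%C /\ 0 < complex.Re e.
  by case: e => a b; rewrite ltcE/= => /andP[/eqP -> ?].
have : cvg (u @ \oo).
  apply/cauchy_cvgP/cauchyP => e /eC[-> e0].
  have e2 : 0 < complex.Re e / 2 by rewrite divr_gt0.
  have [N uN] := uc _ e2; exists (u N); exists N => // n /= Nn.
  rewrite -ball_normE/= -rnormE ltcR -opprB rnormN.
  by rewrite (le_lt_trans (uN _ Nn))// ltr_pdivrMr// mulr2n mulrDr mulr1 ltrDl.
move=> /cvg_ex[l ul]; exists l => e e0.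
have e0C : 0 < e%:C%C :> R[i] by rewrite ltcR.
have [N _ uN] := (@cvgrPdist_le _ _ _ _ _ _ _).1 ul _ e0C.
exists N => n Nn; have := uN n Nn.
by rewrite -rnormE lecR -opprB rnormN.
Qed.

(** The iteration [u |-> (w + u ^ 2) / 2] converges to [1 - sqrt (1 - w)]: its
    increments are dominated by those of the scalar iteration for [w = 1], which
    increases and stays below [1]. Hence the limit exists although [B] need not
    have a unit. *)
Section Visser.
Variable w : B.
Hypotheses (wsa : w^# = w) (w1 : rnorm w <= 1).

Let u := fix u n : B := if n is m.+1 then 2^-1 .* (w + u m ** u m) else 0.
Let t := fix t n : R := if n is m.+1 then 2^-1 * (1 + t m ^+ 2) else 0.

Let uS n : u n.+1 = 2^-1 .* (w + u n ** u n). Proof. by []. Qed.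
Let tS n : t n.+1 = 2^-1 * (1 + t n ^+ 2). Proof. by []. Qed.

Let t01 n : 0 <= t n <= 1.
Proof.
elim: n => [|n /andP[t0 t1]]; first by rewrite /= lexx ler01.
rewrite tS; have := exprn_ile1 2 t0 t1; have := exprn_ge0 2 t0; lra.
Qed.

Let u_comm c : c ** w = w ** c -> forall n, c ** u n = u n ** c.
Proof.
move=> cw; elim=> [|n IH]; first by rewrite /= cmul0l cmul0r.
by rewrite uS cmulZr cmulZl cmulDr cmulDl cw cmulA IH -cmulA IH cmulA.
Qed.

Let u_norm n : rnorm (u n) <= t n.
Proof.
elim: n => [|n IH]; first by rewrite /= rnorm0.
rewrite uS tS rnormZr ger0_norm ?invr_ge0// ler_pM2l ?invr_gt0//.
rewrite (le_trans (rnormD _ _))// lerD// (le_trans (rnorm_cmul _ _))// expr2.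
by rewrite ler_pM// rnorm_ge0.
Qed.

Let u_step n : rnorm (u n.+1 - u n) <= t n.+1 - t n.
Proof.
elim: n => [|n IH]; first by rewrite !subr0 u_norm.
have -> : u n.+2 - u n.+1 = 2^-1 .* ((u n.+1 - u n) ** (u n.+1 + u n)).
  rewrite (uS n.+1) {2}(uS n) -scalerBr; congr (_ *: _).
  rewrite opprD addrACA subrr add0r cmulBl !cmulDr.
  have -> : u n ** u n.+1 = u n.+1 ** u n.
    apply: u_comm; apply/esym; exact: (u_comm (erefl _)).
  by rewrite opprD addrA addrK.
rewrite rnormZr ger0_norm ?invr_ge0//.
have -> : t n.+2 - t n.+1 = 2^-1 * ((t n.+1 - t n) * (t n.+1 + t n)).
  by rewrite (tS n.+1) {2}(tS n); ring.
rewrite ler_pM2l ?invr_gt0// (le_trans (rnorm_cmul _ _))//.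
rewrite ler_pM ?rnorm_ge0//.
by rewrite (le_trans (rnormD _ _))// lerD// u_norm.
Qed.

Let u_diff n k : rnorm (u (n + k) - u n) <= t (n + k) - t n.
Proof.
elim: k => [|k IH]; first by rewrite addn0 !subrr rnorm0.
rewrite addnS -(subrK (u (n + k)) (u _.+1)) -addrA.
by rewrite (le_trans (rnormD _ _))//; have := u_step (n + k); lra.
Qed.

(** The limit is in the closed span of the powers of [w], whence the last two
    properties. *)
Lemma one_minus_sqrt : exists s : B, [/\ s^# = s, s + s - s ** s = w,
  rnorm s <= 1, forall c, c ** w = w ** c -> c ** s = s ** c &
  forall q, q ** w = w -> q ** s = s].
Proof.
have [s us] : exists l, rcvg u l.
  apply: rcauchy_cvg => e e0.
  have tsup : has_sup (range t).
    by split; [exists (t 0%N), 0%N|exists 1 => _ [n _ <-]; case/andP: (t01 n)].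
  have [_ [N _ <-] tN] := sup_adherent e0 tsup.
  exists N => n Nn; rewrite -(subnKC Nn) (le_trans (u_diff _ _))//.
  have : t (N + (n - N))%N <= sup (range t) by apply: sup_upper_bound => //; exists (N + (n - N))%N.
  lra.
have approx (x : B) (C : R) :
    (forall n, rnorm x <= C * (rnorm (u n - s) + rnorm (u n.+1 - s))) -> x = 0.
  move=> xC; have [C0|C0] := leP 0 C; last first.
    apply: rnorm_eq0; apply/eqP; rewrite eq_le rnorm_ge0 andbT.
    by rewrite (le_trans (xC 0%N))// nmulr_rle0// addr_ge0// rnorm_ge0.
  apply: (@rnorm_le_eq0 _ x (C * 2)) => e /us[N uN].
  rewrite (le_trans (xC N))// -mulrA ler_wpM2l// mulr2n mulrDl mul1r.
  by rewrite lerD ?uN.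
have s1 : rnorm s <= 1.
  apply/ler_addgt0Pr => e /us[N /(_ _ (leqnn N)) uN].
  rewrite -[s](subKr (u N)) (le_trans (rnormB _ _))// lerD//.
  by rewrite (le_trans (u_norm N))//; case/andP: (t01 N).
exists s; split=> //.
- apply/subr0_eq/(approx _ 2) => n.
  have usa : (u n)^# = u n.
    by elim: n => [|n IH]; [rewrite /= cstar0|rewrite uS cstarZr cstarD cstarM wsa IH].
  have -> : s^# - s = (u n - s) - (u n - s)^#.
    by rewrite cstarB usa opprB [RHS]addrC addrA subrK.
  rewrite (le_trans (rnormB _ _))// rnorm_cstar.
  by have := rnorm_ge0 (u n.+1 - s); lra.
- apply/subr0_eq/(approx _ 2) => n.
  have -> : s + s - s ** s - w =
      (u n ** (u n - s) + (u n - s) ** s) - 2 .* (u n.+1 - s).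
    rewrite uS scalerBr scalerA -rmorphM mulfV// scale1r cmulBr cmulBl.
    by lmod (R[i]) B.
  rewrite (le_trans (rnormB _ _))// mulrDr lerD//; last first.
    by rewrite rnormZr ger0_norm.
  rewrite (le_trans (rnormD _ _))// mulr2n mulrDl mul1r.
  rewrite lerD// (le_trans (rnorm_cmul _ _))// ?ler_piMl ?ler_piMr ?rnorm_ge0//.
  by rewrite (le_trans (u_norm n))//; case/andP: (t01 n).
- move=> c cw; apply/subr0_eq/(approx _ (2 * rnorm c)) => n.
  have -> : c ** s - s ** c = (u n - s) ** c - c ** (u n - s).
    by rewrite cmulBl cmulBr (u_comm cw) opprB [RHS]addrC addrA subrK.
  rewrite (le_trans (rnormB _ _))// mulrDr ler_wpDr ?mulr_ge0 ?rnorm_ge0//.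
  have := rnorm_cmul c (u n - s); have := rnorm_cmul (u n - s) c; lra.
- move=> q qw; apply/subr0_eq/(approx _ (1 + rnorm q)) => n.
  have qu : q ** u n = u n.
    elim: n => [|n IH]; first by rewrite /= cmul0r.
    by rewrite uS cmulZr cmulDr qw cmulA IH.
  have -> : q ** s - s = (u n - s) - q ** (u n - s).
    by rewrite cmulBr qu opprB [RHS]addrC addrA subrK.
  rewrite (le_trans (rnormB _ _))// mulrDr ler_wpDr ?mulr_ge0 ?addr_ge0 ?rnorm_ge0//.
  by rewrite mulrDl mul1r lerD2l rnorm_cmul.
Qed.

End Visser.

End CStarBasics.

(** * Positivity and states *)

Section CStarPositivity.
Variables (R : realType) (B : cstarAlgType R).
Implicit Types a b c h x y : B.

Lemma rnorm_i (x : B) : rnorm ('i%C *: x) = rnorm x.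
Proof. by rewrite rnormZ Re_normC_i mul1r. Qed.

Lemma cstar_i (x : B) : ('i%C *: x)^# = - ('i%C *: x^#).
Proof. by rewrite cstarZ conjC_i scaleNr. Qed.

Lemma rnorm_half x y (r : R) :
  rnorm (x + y) <= r -> rnorm (x - y) <= r -> rnorm x <= r.
Proof.
move=> h1 h2; have -> : x = 2^-1 .* ((x + y) + (x - y)) by lmod (R[i]) B.
rewrite rnormZr ger0_norm ?invr_ge0//.
by have := rnormD (x + y) (x - y); lra.
Qed.

Lemma iN1 : ('i%C : R[i]) * 'i%C = - 1.
Proof. by rewrite -expr2 sqr_i. Qed.

(** When [x^* y] is self-adjoint, [x + iy] and [x - iy] have the same absolute
    value, namely the square root of [x^* x + y^* y]. *)
Lemma rnorm_pythagoras x y : x^# ** y = y^# ** x ->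
  rnorm x ^+ 2 <= rnorm (x^# ** x + y^# ** y) /\
  rnorm y ^+ 2 <= rnorm (x^# ** x + y^# ** y).
Proof.
move=> xy; set m := rnorm (_ + _).
have m0 : 0 <= m by exact: rnorm_ge0.
have e1 : rnorm (x + 'i%C *: y) ^+ 2 = m.
  rewrite -rnorm_cstar_cmul cstarD cstar_i cmulDl !cmulDr cmulNl !(cmulZr, cmulZl).
  rewrite xy cmulNl cmulZl scalerN scalerA iN1.
  by congr (rnorm _); lmod (R[i]) B.
have e2 : rnorm (x - 'i%C *: y) ^+ 2 = m.
  rewrite -rnorm_cstar_cmul cstarB cstar_i cmulDl !cmulDr !opprK !cmulNr !(cmulZr, cmulZl).
  rewrite xy !scalerA iN1.
  by congr (rnorm _); lmod (R[i]) B.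
have sq (z : B) : rnorm z ^+ 2 = m -> rnorm z <= Num.sqrt m.
  by move=> <-; rewrite sqrtr_sqr ler_norm.
have sq' (r : R) : 0 <= r -> r <= Num.sqrt m -> r ^+ 2 <= m.
  by move=> r0 rm; rewrite -(sqr_sqrtr m0) ler_sqr ?nnegrE ?sqrtr_ge0.
split; apply: sq'; rewrite ?rnorm_ge0//.
  by apply: (rnorm_half (sq _ e1) (sq _ e2)).
rewrite -(rnorm_i y); apply: (@rnorm_half _ x); first by rewrite addrC sq.
by rewrite -opprB rnormN sq.
Qed.

Section Isometric.
Variables h s : B.
Hypotheses (hsa : h^# = h) (ssa : s^# = s) (hs : h ** s = s ** h).
Hypothesis hsE : s + s - s ** s = h ** h.

(** [h + i (1 - s)] is unitary, as [h ^ 2 + (1 - s) ^ 2 = 1]. *)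
Lemma unitary_dilation b : rnorm (h ** b) <= rnorm b /\ rnorm (b - s ** b) <= rnorm b.
Proof.
have [] := @rnorm_pythagoras (h ** b) (b - s ** b).
  rewrite cstarB !cstarM hsa ssa cmulBr cmulBl !cmulA; congr (_ - _).
  by rewrite -(cmulA _ h) hs !cmulA.
have -> : (h ** b)^# ** (h ** b) + (b - s ** b)^# ** (b - s ** b) = b^# ** b.
  rewrite cstarB !cstarM hsa ssa cmulA4 -hsE.
  rewrite !(cmulBr, cmulBl, cmulDr, cmulDl) !cmulA.
  by lmod (R[i]) B.
rewrite rnorm_cstar_cmul => h1 h2.
by move: h1 h2; rewrite !ler_sqr ?nnegrE ?rnorm_ge0.
Qed.

End Isometric.

Lemma sa_sqrt_compl h : h^# = h -> rnorm h <= 1 ->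
  exists s, [/\ s^# = s, h ** s = s ** h & s + s - s ** s = h ** h].
Proof.
move=> hsa h1.
have [||s [ssa sE _ sc _]] := @one_minus_sqrt _ B (h ** h).
- by rewrite cstarM hsa.
- by rewrite rnorm_sa// exprn_ile1// rnorm_ge0.
by exists s; split=> //; apply: sc; rewrite cmulA.
Qed.

(** [1 - h ^ 2] is the square of the contraction [1 - s]. *)
Lemma sa_sqr_contraction h b : h^# = h -> rnorm h <= 1 ->
  rnorm (b - h ** h ** b) <= rnorm b.
Proof.
move=> hsa h1; have [s [ssa hs sE]] := sa_sqrt_compl hsa h1.
have -> : b - h ** h ** b = (b - s ** b) - s ** (b - s ** b).
  by rewrite -sE cmulBr !(cmulBl, cmulDl) !cmulA; lmod (R[i]) B.
have [_ le1] := unitary_dilation hsa ssa hs sE (b - s ** b).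
have [_ le2] := unitary_dilation hsa ssa hs sE b.
exact: le_trans le2.
Qed.

(** A self-adjoint [H] such that [1 + H] and [1 - H] are contractive vanishes,
    since [H] and [- H] are both positive. The bound obtained here excludes that
    the norm of [H] is [1 / 5], to which the general case can be scaled. *)
Section BothSignsPositive.
Variable H : B.
Hypothesis Hsa : H^# = H.
Hypotheses (Hp : forall b, rnorm (b + H ** b) <= rnorm b)
           (Hm : forall b, rnorm (b - H ** b) <= rnorm b).

Let P (z : R[i]) b := b + z *: (H ** b).

(** The mean of [(1 + H) ^ 2] and [(1 - H) ^ 2] is [1 + H ^ 2], the square of the
    absolute value of both [1 + i H] and [1 - i H]. *)
Let Hi b : rnorm (P 'i%C b) <= rnorm b /\ rnorm (P (- 'i%C) b) <= rnorm b.
Proof.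
have le1 : rnorm (b + H ** (H ** b)) <= rnorm b.
  have -> : b + H ** (H ** b) = 2^-1 .* ((b + H ** b + H ** (b + H ** b)) +
      (b - H ** b - H ** (b - H ** b))).
    by rewrite !(cmulDr, cmulNr); lmod (R[i]) B.
  rewrite rnormZr ger0_norm ?invr_ge0//.
  have := rnormD (b + H ** b + H ** (b + H ** b)) (b - H ** b - H ** (b - H ** b)).
  have := Hp (b + H ** b); have := Hm (b - H ** b); have := Hp b; have := Hm b.
  lra.
have sq (z : B) : z^# ** z = b^# ** (b + H ** (H ** b)) -> rnorm z <= rnorm b.
  move=> zE; rewrite -ler_sqr ?nnegrE ?rnorm_ge0// -rnorm_cstar_cmul zE.
  rewrite (le_trans (rnorm_cmul _ _))// rnorm_cstar expr2.
  by rewrite ler_wpM2l ?rnorm_ge0.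
split; apply: sq; rewrite /P ?scaleNr ?cstarB ?cstarD cstar_i cstarM Hsa.
  rewrite !(cmulDr, cmulDl, cmulNl, cmulZl, cmulZr) !scalerA iN1 !cmulA.
  by lmod (R[i]) B.
rewrite !(cmulDr, cmulDl, cmulNl, cmulNr, cmulZl, cmulZr) !opprK !scalerA iN1 !cmulA.
by lmod (R[i]) B.
Qed.

Let P6 z e b : z * z = e ->
  P z (P z (P z (P z (P z (P z b))))) =
  b + (6%:R * z) *: (H ** b) + (15%:R * e) *: (H ** (H ** b)) +
  (20%:R * e * z) *: (H ** (H ** (H ** b))) +
  (15%:R * e * e) *: (H ** (H ** (H ** (H ** b)))) +
  (6%:R * e * e * z) *: (H ** (H ** (H ** (H ** (H ** b))))) +
  (e * e * e) *: (H ** (H ** (H ** (H ** (H ** (H ** b)))))).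
Proof. by move=> <-; rewrite /P !(cmulDr, cmulZr); lmod (R[i]) B. Qed.

(** Averaging [(1 + w H) ^ 6 / w] over the fourth roots of unity [w] leaves
    [6 H + 6 H ^ 5]. *)
Lemma contraction_average b :
  6 * rnorm (H ** b + H ** (H ** (H ** (H ** (H ** b))))) <= rnorm b.
Proof.
pose Q z := P z (P z (P z (P z (P z (P z b))))).
have Q1 z : (forall b, rnorm (P z b) <= rnorm b) -> rnorm (Q z) <= rnorm b.
  by move=> Pz; do 5! apply: le_trans (Pz _) _; exact: Pz.
have q1 : rnorm (Q 1) <= rnorm b by apply: Q1 => x; rewrite /P scale1r.
have q2 : rnorm (Q (- 1)) <= rnorm b by apply: Q1 => x; rewrite /P scaleN1r.
have q3 : rnorm (Q 'i%C) <= rnorm b by apply: Q1 => x; case: (Hi x).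
have q4 : rnorm (Q (- 'i%C)) <= rnorm b by apply: Q1 => x; case: (Hi x).
set h1 := H ** b; set h5 := H ** (H ** _).
pose h3 := H ** (H ** (H ** b)).
have e1 : Q 1 - Q (- 1) = 12%:R *: h1 + 40%:R *: h3 + 12%:R *: h5.
  rewrite /Q (@P6 1 1) ?mulr1// (@P6 (-1) 1) ?mulrNN ?mulr1// -/h1 -/h5 -/h3.
  by lmod (R[i]) B.
have e2 : Q 'i%C - Q (- 'i%C) = 'i%C *: (12%:R *: h1 - 40%:R *: h3 + 12%:R *: h5).
  rewrite /Q (@P6 'i%C (-1)) ?iN1// (@P6 (-'i%C) (-1)) ?mulrNN ?iN1// -/h1 -/h5 -/h3.
  by lmod (R[i]) B.
have := rnormB (Q 1) (Q (-1)); have := rnormB (Q 'i%C) (Q (-'i%C)).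
rewrite e1 e2 rnorm_i => le2 le1.
have : rnorm (24%:R .* (h1 + h5)) <= 4 * rnorm b.
  have -> : 24%:R .* (h1 + h5) = (12%:R *: h1 + 40%:R *: h3 + 12%:R *: h5) +
      (12%:R *: h1 - 40%:R *: h3 + 12%:R *: h5) by lmod (R[i]) B.
  by rewrite (le_trans (rnormD _ _))//; lra.
by rewrite rnormZr ger0_norm//; lra.
Qed.

End BothSignsPositive.

(** Kaplansky's argument. Let [d = c g] and [T = c c^*], so that [d d^* = - T ^ 2]
    and [d^* d = - g ^ 4]. Since [d^* d + d d^*] is twice the sum of the squares of
    the real part [u] and the imaginary part [v] of [d],
    [T ^ 2 + g ^ 4 + 2 u ^ 2 + 2 v ^ 2 = 0], and a sum of squares of self-adjoint
    elements vanishes only if all of them do. *)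
Lemma cstar_cmul_neg_sqr c g : g^# = g -> c^# ** c = - (g ** g) -> c = 0.
Proof.
wlog c1 : c g / rnorm c = 1.
  move=> wl gsa cE; apply/eqP/negPn/negP => /eqP c0.
  have cn : rnorm c != 0 by apply/eqP => /rnorm_eq0.
  have k1 : rnorm ((rnorm c)^-1 .* c) = 1.
    by rewrite rnormZr ger0_norm ?invr_ge0 ?rnorm_ge0// mulVf.
  have := wl ((rnorm c)^-1 .* c) ((rnorm c)^-1 .* g) k1.
  rewrite !cstarZr gsa cmulZl cmulZr cmulZl cmulZr cE !scalerN => /(_ erefl erefl).
  by move=> k0; move: k1; rewrite k0 rnorm0 => /eqP; rewrite eq_sym oner_eq0.
move=> gsa cE; exfalso.
have g1 : rnorm g = 1.
  apply/eqP; rewrite -(@eqrXn2 _ 2) ?rnorm_ge0// -rnorm_sa// -rnormN -cE.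
  by rewrite rnorm_cstar_cmul c1.
pose T := c ** c^#; pose d := c ** g.
have Tsa : T^# = T by rewrite /T cstarM cstarK.
have T1 : rnorm T = 1 by rewrite /T -{1}(cstarK c) rnorm_cstar_cmul rnorm_cstar c1 expr1n.
have TT : T ** T = - (d ** d^#).
  by rewrite /T /d cstarM gsa cmulA4 cE cmulNr cmulNl !cmulA.
have dd : d^# ** d = - (g ** g ** (g ** g)).
  by rewrite /d cstarM gsa cmulA4 cE cmulNr cmulNl !cmulA.
have d1 : rnorm d = 1.
  apply/eqP; rewrite -(@eqrXn2 _ 2) ?rnorm_ge0// -rnorm_cstar_cmul dd rnormN.
  by rewrite rnorm_sa ?cstarM ?gsa// rnorm_sa// g1 !expr1n.
pose u := 2^-1 .* (d + d^#); pose v := 2^-1 .* ('i%C *: (d - d^#)).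
have usa : u^# = u by rewrite /u cstarZr cstarD cstarK addrC.
have vsa : v^# = v.
  by rewrite /v cstarZr cstar_i cstarB cstarK -scalerN opprB.
have u1 : rnorm u <= 1.
  rewrite /u rnormZr ger0_norm ?invr_ge0//; have := rnormD d d^#.
  rewrite rnorm_cstar d1; lra.
have v1 : rnorm v <= 1.
  rewrite /v rnormZr rnorm_i ger0_norm ?invr_ge0//; have := rnormB d d^#.
  rewrite rnorm_cstar d1; lra.
have uv : d^# ** d + d ** d^# = 2 .* (u ** u + v ** v).
  have -> : v ** v = - (4^-1 .* ((d - d^#) ** (d - d^#))).
    rewrite /v !(cmulZl, cmulZr) !scalerA -scaleNr; congr (_ *: _).
    have -> : 2^-1%:C%C * 'i%C * 2^-1%:C%C * 'i%C =
        2^-1%:C%C * 2^-1%:C%C * ('i%C * 'i%C) :> R[i] by ring.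
    by rewrite iN1 mulrN1 -rmorphM -invfM -natrM.
  rewrite /u !(cmulZl, cmulZr) !(cmulDr, cmulBr, cmulDl, cmulBl).
  by lmod (R[i]) B.
(* The coefficients [1 + 2 + 2] make [1 + H] a convex combination of contractions
   [1 - h ^ 2]. *)
pose H := 5^-1 .* (T ** T).
have Hsa : H^# = H by rewrite /H cstarZr cstarM Tsa.
have five (x : B) : rnorm (5^-1 .* x) = 5^-1 * rnorm x.
  by rewrite rnormZr ger0_norm ?invr_ge0.
have Hp b : rnorm (b + H ** b) <= rnorm b.
  have -> : b + H ** b = 5^-1 .* ((b - (g ** g) ** (g ** g) ** b) +
     (2 .* (b - u ** u ** b) + 2 .* (b - v ** v ** b))).
    have -> : H = 5^-1 .* (- (g ** g ** (g ** g)) - 2 .* (u ** u + v ** v)).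
      by rewrite -uv /H TT dd; lmod (R[i]) B.
    by rewrite !(cmulZl, cmulBl, cmulNl, cmulDl); lmod (R[i]) B.
  have p1 := @sa_sqr_contraction (g ** g) b.
  rewrite cstarM gsa rnorm_sa// g1 expr1n in p1.
  have := p1 erefl (lexx _).
  have := sa_sqr_contraction b usa u1; have := sa_sqr_contraction b vsa v1.
  rewrite five; set x1 := b - _; set x2 := b - _; set x3 := b - _.
  have := rnormD x3 (2 .* x2 + 2 .* x1); have := rnormD (2 .* x2) (2 .* x1).
  rewrite !rnormZr !ger0_norm//; lra.
have Hm b : rnorm (b - H ** b) <= rnorm b.
  have -> : b - H ** b = 5^-1 .* (4 .* b + (b - T ** T ** b)).
    by rewrite /H cmulZl; lmod (R[i]) B.
  have t1 : rnorm T <= 1 by rewrite T1.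
  have := sa_sqr_contraction b Tsa t1; rewrite five; set x1 := b - _.
  have := rnormD (4 .* b) x1; rewrite rnormZr ger0_norm//; lra.
have tt : rnorm (T ** T) = 1 by rewrite rnorm_sa// T1 expr1n.
have := contraction_average Hsa Hp Hm (T ** T).
set h5 := H ** (H ** _).
have h1 : rnorm (H ** (T ** T)) = 5^-1.
  by rewrite /H cmulZl five rnorm_sa ?tt ?expr1n ?mulr1// cstarM Tsa.
have hn : rnorm H = 5^-1 by rewrite five tt mulr1.
have h5le : rnorm h5 <= 5^-1 ^+ 5.
  have hle x : rnorm (H ** x) <= 5^-1 * rnorm x by rewrite -hn rnorm_cmul.
  have := hle (T ** T); rewrite tt.
  have := hle (H ** (T ** T)); have := hle (H ** (H ** (T ** T))).
  have := hle (H ** (H ** (H ** (T ** T)))).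
  have := hle (H ** (H ** (H ** (H ** (T ** T))))); rewrite -/h5 !exprS expr0; lra.
have := rnormB (H ** (T ** T) + h5) h5.
rewrite addrK h1 tt; move: h5le; rewrite !exprS expr0; lra.
Qed.

Section Corner.
Variable q : B.
Hypotheses (qsa : q^# = q) (qq : q ** q = q) (q0 : q != 0).

Lemma rnorm_proj : rnorm q = 1.
Proof.
have qn : rnorm q != 0 by apply: contra q0 => /eqP/rnorm_eq0 ->.
by apply: (mulfI qn); rewrite -expr2 -rnorm_sa// qq mulr1.
Qed.

(** With [y] the absolute value and [n = y - x] twice the negative part of
    [x = a^* a], the element [c = a n] satisfies [c^* c = - y n ^ 2], minus the
    square of a self-adjoint element; so [c = 0], whence [n = 0] and [x = y]. Now
    [y = q - s], where [s] is a contraction. *)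
Lemma corner_positive a : a ** q = a -> rnorm a <= 1 -> rnorm (q - a^# ** a) <= 1.
Proof.
move=> aq a1; pose x := a^# ** a.
have xsa : x^# = x by rewrite /x cstarM cstarK.
have x1 : rnorm x <= 1 by rewrite rnorm_cstar_cmul exprn_ile1// rnorm_ge0.
have xq : x ** q = x by rewrite /x -cmulA aq.
have qx : q ** x = x by rewrite -xsa -{1}qsa -cstarM xq.
pose w := q - x ** x.
have [||s [ssa sE s1 sc sq]] := @one_minus_sqrt _ B w.
- by rewrite /w cstarB cstarM xsa qsa.
- by rewrite -rnorm_proj /w -{2}xq cmulA sa_sqr_contraction.
have {}sq : q ** s = s by apply: sq; rewrite cmulBr qq cmulA qx.
have sq' : s ** q = s by rewrite -ssa -{1}qsa -cstarM sq.
have xs : x ** s = s ** x by apply: sc; rewrite cmulBr cmulBl xq qx cmulA.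
pose y := q - s.
have yy : y ** y = x ** x.
  rewrite /y cmulBr !cmulBl qq sq sq'.
  rewrite (_ : _ - _ = q - (s + s - s ** s)); last by lmod (R[i]) B.
  by rewrite sE /w subKr.
have xy : x ** y = y ** x by rewrite /y cmulBr cmulBl xs xq qx.
have [s2 [s2sa s2E _ s2c s2q]] := one_minus_sqrt ssa s1.
have {}s2q : q ** s2 = s2 by exact: s2q.
have s2q' : s2 ** q = s2 by rewrite -s2sa -{1}qsa -cstarM s2q.
pose v := q - s2.
have vsa : v^# = v by rewrite /v cstarB qsa s2sa.
have vv : v ** v = y.
  rewrite /v cmulBr !cmulBl qq s2q s2q'.
  rewrite (_ : _ - _ = q - (s2 + s2 - s2 ** s2)); last by lmod (R[i]) B.
  by rewrite s2E.
pose n := y - x.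
have nsa : n^# = n by rewrite /n /y !cstarB qsa ssa xsa.
have nq : n ** q = n by rewrite /n /y !cmulBl qq sq' xq.
have qn : q ** n = n by rewrite /n /y !cmulBr qq sq qx.
have ny : n ** y = y ** n by rewrite /n cmulBr cmulBl xy.
have nx : n ** x = - (n ** y).
  by rewrite /n !(cmulBl y x) yy xy opprB.
have nv : n ** v = v ** n.
  rewrite /v cmulBr cmulBl nq qn; congr (_ - _); apply: s2c.
  have -> : s = q - y by rewrite /y subKr.
  by rewrite cmulBr cmulBl nq qn ny.
have gsa : (v ** n)^# = v ** n by rewrite cstarM vsa nsa nv.
have gg : v ** n ** (v ** n) = n ** y ** n.
  by rewrite -{1}nv cmulA4 vv.
have c0 : a ** n = 0.
  apply: (cstar_cmul_neg_sqr gsa).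
  by rewrite gg cstarM nsa cmulA4 nx cmulNl.
have nyn : n ** y ** n = 0.
  have : (a ** n)^# ** (a ** n) = - (n ** y ** n).
    by rewrite cstarM nsa cmulA4 nx cmulNl.
  by rewrite c0 cmul0r => /esym/eqP; rewrite oppr_eq0 => /eqP.
have n3 : n ** n ** n = 0.
  rewrite {2}/n cmulBr cmulBl nyn sub0r nx cmulNl opprK.
  exact: nyn.
have n0 : n = 0.
  apply: cstar_cmul_eq0; rewrite nsa; apply: cstar_cmul_eq0.
  by rewrite cstarM nsa cmulA n3 cmul0l.
have xE : x = y by apply/esym/subr0_eq.
by rewrite -/x xE /y subKr.
Qed.

(** A functional of norm one attaining its norm at the unit [q] of the corner is
    nonnegative at positive contractions [x], as [q - x] is a contraction too. It
    is extended to [B] by compression to the corner. *)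
Lemma corner_state : exists f : B -> R,
  [/\ real_linear f, forall b, f b^# = f b, forall b, `|f b| <= rnorm b,
      forall b, 0 <= f (b^# ** b) & forall b (z : R[i]), q ** b ** q = z *: q ->
      f b = complex.Re z].
Proof.
have [f [[fD fZ] fle fq]] := norming_functional q.
rewrite rnorm_proj in fq.
have fN x : f (- x) = - f x.
  by have := fZ (-1) x; rewrite rmorphN rmorph1 scaleN1r mulN1r.
pose r b := 2^-1 .* (q ** b ** q + (q ** b ** q)^#).
have rle b : rnorm (r b) <= rnorm b.
  have qbq : rnorm (q ** b ** q) <= rnorm b.
    rewrite (le_trans (rnorm_cmul _ _))// rnorm_proj mulr1.
    by rewrite (le_trans (rnorm_cmul _ _))// rnorm_proj mul1r.
  rewrite rnormZr ger0_norm ?invr_ge0//.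
  have := rnormD (q ** b ** q) (q ** b ** q)^#; rewrite rnorm_cstar; lra.
exists (f \o r); split=> /=.
- split=> [x y|t x]; rewrite -?fD -?fZ; congr f; rewrite /r.
    by rewrite !(cmulDr, cmulDl) cstarD; lmod (R[i]) B.
  by rewrite !(cmulZr, cmulZl) cstarZr; lmod (R[i]) B.
- move=> b; congr f; rewrite /r addrC; congr (_ *: (_ + _)).
    by rewrite !cstarM qsa cstarK cmulA.
  by rewrite !cstarM qsa cmulA.
- move=> b; rewrite ler_norml; apply/andP; split; last exact: le_trans (fle _) _.
  by rewrite lerNl -fN (le_trans (fle _))// rnormN.
- move=> b; pose a := b ** q.
  have rE : r (b^# ** b) = a^# ** a.
    rewrite /r /a !cstarM qsa cstarK !cmulA.
    by lmod (R[i]) B.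
  rewrite rE; pose k := rnorm a + 1.
  have k0 : 0 < k by rewrite ltr_wpDl ?rnorm_ge0.
  have := @corner_positive (k^-1 .* a).
  rewrite cmulZl {1}/a -cmulA qq -/a rnormZr ger0_norm ?invr_ge0 ?(ltW k0)//.
  rewrite mulrC ler_pdivrMr// mul1r lerDl ler01 => /(_ erefl isT) le1.
  have := le_trans (fle _) le1; rewrite fD fN fq cstarZr cmulZl cmulZr !fZ.
  rewrite gerBl !pmulr_rge0 ?invr_gt0//.
- move=> b z qbq; rewrite /r qbq cstarZ qsa -scalerDl scalerA.
  have -> : 2^-1%:C%C * (z + z^*) = (complex.Re z)%:C%C.
    by case: z {qbq} => x y; apply/eqP; rewrite eq_complex/= ; apply/andP; split; apply/eqP; field.
  by rewrite fZ fq mulr1.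
Qed.

End Corner.

End CStarPositivity.

(** * Homomorphisms of C*-algebras *)

Section StarHom.
Variables (R : realType) (A B : cstarAlgType R) (f : A -> B).
Hypothesis fP : is_star_hom f.

Lemma star_homD : {morph f : x y / x + y}.
Proof. by move=> x y; have [/(_ 1 x y)] := fP; rewrite !scale1r. Qed.

Lemma star_hom0 : f 0 = 0.
Proof. by apply: (@addrI _ (f 0)); rewrite -star_homD !addr0. Qed.

Lemma star_homZ (z : R[i]) x : f (z *: x) = z *: f x.
Proof. by have [/(_ z x 0)] := fP; rewrite star_hom0 !addr0. Qed.

Lemma star_homB : {morph f : x y / x - y}.
Proof. by move=> x y; rewrite star_homD -(scaleN1r y) star_homZ scaleN1r. Qed.

Lemma star_homM : {morph f : x y / x ** y}.
Proof. by case: fP. Qed.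

Lemma star_homS : {morph f : x / x^#}.
Proof. by case: fP. Qed.

(** For [h = y^* y] of norm at most one, [1 - f s] is a square root of
    [1 - (f h) ^ 2], so left multiplication by [f h] is contractive, and the
    square of the norm of [f h] is at most this norm. *)
Lemma star_hom_contractive x : rnorm (f x) <= rnorm x.
Proof.
have le1 (y : A) : rnorm y <= 1 -> rnorm (f y) <= 1.
  move=> y1; pose h := y^# ** y.
  have hsa : h^# = h by rewrite cstarM cstarK.
  have h1 : rnorm h <= 1 by rewrite rnorm_cstar_cmul exprn_ile1// rnorm_ge0.
  have [s [ssa hs sE]] := sa_sqrt_compl hsa h1.
  have fhsa : (f h)^# = f h by rewrite -star_homS hsa.
  have fssa : (f s)^# = f s by rewrite -star_homS ssa.
  have fhs : f h ** f s = f s ** f h by rewrite -!star_homM hs.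
  have fsE : f s + f s - f s ** f s = f h ** f h.
    by rewrite -star_homD -!star_homM -star_homB sE.
  have [hh _] := unitary_dilation fhsa fssa fhs fsE (f h).
  rewrite rnorm_sa// in hh.
  have : rnorm (f h) <= 1.
    have [->//|h0] := eqVneq (rnorm (f h)) 0.
    have hp : 0 < rnorm (f h) by rewrite lt_def h0 rnorm_ge0.
    by rewrite -(ler_pM2r hp) mul1r -expr2.
  by rewrite /h star_homM star_homS rnorm_cstar_cmul expr_le1// rnorm_ge0.
apply/ler_addgt0Pr => e e0.
have k0 : 0 < rnorm x + e by rewrite ltr_wpDl ?rnorm_ge0.
have := le1 ((rnorm x + e)^-1 .* x).
rewrite star_homZ !rnormZr ger0_norm ?invr_ge0 ?(ltW k0)//.
by rewrite !ler_pdivrMl// !mulr1 => ->//; rewrite lerDl ltW.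
Qed.

End StarHom.

(** * The *-algebra of finitely supported functions *)

Section FiniteSupport.
Variables (T : choiceType) (V : zmodType).
Implicit Types F : T -> V.

(** The condition of [Cc], for summands with values in any group. *)
Definition fsupp F := finite_set (F @^-1` [set~ 0]).

Lemma fsuppP F : fsupp F -> exists2 r : seq T, uniq r & forall t, F t != 0 -> t \in r.
Proof.
move=> /finite_seqP[r rE]; exists (undup r); first exact: undup_uniq.
move=> t Ft; rewrite mem_undup; have : (F @^-1` [set~ 0]) t by apply/eqP.
by rewrite rE.
Qed.

Lemma seq_fsupp (r : seq T) F : (forall t, F t != 0 -> t \in r) -> fsupp F.
Proof.
move=> h; apply: (@sub_finite_set _ _ [set` r]); last exact: finite_seq.
by move=> t /= /eqP /h.
Qed.

Lemma fsum_seq F (r : seq T) : uniq r -> (forall t, F t != 0 -> t \in r) ->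
  \sum_(t \in [set: T]) F t = \sum_(t <- r) F t.
Proof.
move=> ur h; rewrite (fsbigE r)//.
  by apply: eq_bigl => t; rewrite in_setT.
by move=> t _ tr; apply/eqP/negPn/negP => /h; rewrite (negbTE tr).
Qed.

End FiniteSupport.

Section CompactSupport.
Variables (R : realType) (G : groupType) (B : cstarAlgType R).
Variable beta : G -> B -> B.
Hypothesis betaP : is_cstar_action beta.
Implicit Types f g h : G -> B.

Let bh s : is_star_hom (beta s). Proof. by case: betaP. Qed.

Lemma act1 b : beta 1%g b = b. Proof. by case: betaP. Qed.
Lemma actM s t b : beta (s * t)%g b = beta s (beta t b). Proof. by case: betaP. Qed.
Lemma act0 s : beta s 0 = 0. Proof. exact: (star_hom0 (bh s)). Qed.
Lemma actD s : {morph beta s : a b / a + b}. Proof. exact: star_homD. Qed.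
Lemma actZ s z b : beta s (z *: b) = z *: beta s b. Proof. exact: star_homZ. Qed.
Lemma act_mul s : {morph beta s : a b / a ** b}. Proof. exact: star_homM. Qed.
Lemma act_star s : {morph beta s : a / a^#}. Proof. exact: star_homS. Qed.
Lemma act_norm s b : rnorm (beta s b) <= rnorm b. Proof. exact: star_hom_contractive. Qed.
Lemma act_sum s (I : Type) (r : seq I) (F : I -> B) :
  beta s (\sum_(j <- r) F j) = \sum_(j <- r) beta s (F j).
Proof. by rewrite (big_morph (beta s) (actD s) (act0 s)). Qed.
Lemma cmul_suml a (I : Type) (r : seq I) (F : I -> B) :
  (\sum_(j <- r) F j) ** a = \sum_(j <- r) F j ** a.
Proof. by apply: (big_morph (fun x => x ** a)) => [x y|]; rewrite ?cmulDl ?cmul0l. Qed.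
Lemma cmul_sumr a (I : Type) (r : seq I) (F : I -> B) :
  a ** (\sum_(j <- r) F j) = \sum_(j <- r) a ** F j.
Proof. by apply: (big_morph (cmul a)) => [x y|]; rewrite ?cmulDr ?cmul0r. Qed.
Lemma cstar_sum (I : Type) (r : seq I) (F : I -> B) :
  (\sum_(j <- r) F j)^# = \sum_(j <- r) (F j)^#.
Proof. by apply: (big_morph (@cstar R B)) => [x y|]; rewrite ?cstarD ?cstar0. Qed.

Local Notation conv := (convolution beta).
Local Notation star := (conv_star beta).

Lemma cmul_neq0l (a b : B) : a ** b != 0 -> a != 0.
Proof. by apply: contraNneq => ->; rewrite cmul0l. Qed.
Lemma cmul_neq0r (a b : B) : a ** b != 0 -> b != 0.
Proof. by apply: contraNneq => ->; rewrite cmul0r. Qed.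
Lemma act_neq0 s b : beta s b != 0 -> b != 0.
Proof. by apply: contraNneq => ->; rewrite act0. Qed.

Lemma convE f g (r : seq G) : uniq r -> (forall t, f t != 0 -> t \in r) ->
  forall s, conv f g s = \sum_(t <- r) f t ** beta t (g (t^-1 * s)%g).
Proof. by move=> ur fr s; rewrite /convolution (fsum_seq ur)// => t /cmul_neq0l /fr. Qed.

Lemma conv_supp f g (r r' : seq G) : uniq r ->
  (forall t, f t != 0 -> t \in r) -> (forall t, g t != 0 -> t \in r') ->
  forall s, conv f g s != 0 -> s \in [seq (t * u)%g | t <- r, u <- r'].
Proof.
move=> ur fr gr s; rewrite (convE g ur fr).
apply: contraNT => /allpairsP sn; rewrite big1_seq// => t /andP[_ tr].
apply/eqP/negPn/negP => /cmul_neq0r/act_neq0/gr tsr.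
by apply: sn; exists (t, (t^-1 * s)%g); split=> //=; rewrite mulVKg.
Qed.

Lemma Cc_conv f g : Cc f -> Cc g -> Cc (conv f g).
Proof.
move=> /fsuppP[r ur fr] /fsuppP[r' _ gr].
exact: (seq_fsupp (conv_supp ur fr gr)).
Qed.

Lemma CcD f g : Cc f -> Cc g -> Cc (f + g).
Proof.
move=> /fsuppP[r ur fr] /fsuppP[r' _ gr].
apply: (@seq_fsupp _ _ (r ++ r')) => t; rewrite mem_cat; apply: contraNT.
rewrite negb_or => /andP[tr tr'].
rewrite (_ : (f + g) t = f t + g t)//.
have -> : f t = 0 by apply/eqP/negPn/negP => /fr; rewrite (negbTE tr).
have -> : g t = 0 by apply/eqP/negPn/negP => /gr; rewrite (negbTE tr').
by rewrite addr0.
Qed.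

Lemma CcZ (z : R[i]) f : Cc f -> Cc (z *: f).
Proof.
move=> /fsuppP[r ur fr]; apply: (@seq_fsupp _ _ r) => t tn; apply: fr.
by apply: contraNneq tn => f0; rewrite (_ : (z *: f) t = z *: f t)// f0 scaler0.
Qed.

Lemma Cc_star f : Cc f -> Cc (star f).
Proof.
move=> /fsuppP[r ur fr]; apply: (@seq_fsupp _ _ [seq t^-1%g | t <- r]) => t tn.
apply/mapP; exists t^-1%g; last by rewrite invgK.
apply: fr; apply: contraNneq tn => f0.
by rewrite /conv_star f0 cstar0 act0.
Qed.

Lemma star_invol f : star (star f) = f.
Proof.
apply/funext => s; rewrite /conv_star -act_star -actM mulgV act1 cstarK.
by rewrite invgK.
Qed.

Lemma convDl f1 f2 g : Cc f1 -> Cc f2 -> conv (f1 + f2) g = conv f1 g + conv f2 g.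
Proof.
move=> /fsuppP[r1 ur1 fr1] /fsuppP[r2 ur2 fr2]; apply/funext => s.
pose r := undup (r1 ++ r2); have ur : uniq r by exact: undup_uniq.
have fr1' t : f1 t != 0 -> t \in r by rewrite mem_undup mem_cat => /fr1 ->.
have fr2' t : f2 t != 0 -> t \in r by rewrite mem_undup mem_cat => /fr2 ->; rewrite orbT.
rewrite (convE g ur); last first.
  move=> t; apply: contraNT => tr.
  rewrite (_ : (f1 + f2) t = f1 t + f2 t)//.
  have -> : f1 t = 0 by apply/eqP/negPn/negP => /fr1'; rewrite (negbTE tr).
  have -> : f2 t = 0 by apply/eqP/negPn/negP => /fr2'; rewrite (negbTE tr).
  by rewrite addr0.
rewrite (_ : (_ + _) s = conv f1 g s + conv f2 g s)// (convE g ur fr1') (convE g ur fr2').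
by rewrite -big_split; apply: eq_bigr => t _; exact: cmulDl.
Qed.

Lemma convZl z f g : Cc f -> conv (z *: f) g = z *: conv f g.
Proof.
move=> cf; have /fsuppP[r ur fr] := cf; apply/funext => s.
rewrite (_ : (_ *: _) s = z *: conv f g s)// (convE g ur fr) (convE g ur).
  by rewrite scaler_sumr; apply: eq_bigr => t _; rewrite -cmulZl.
move=> t tn; apply: fr; apply: contraNneq tn => f0.
by rewrite (_ : (z *: f) t = z *: f t)// f0 scaler0.
Qed.

Lemma convZr z f g : Cc f -> conv f (z *: g) = z *: conv f g.
Proof.
move=> /fsuppP[r ur fr]; apply/funext => s.
rewrite (_ : (_ *: _) s = z *: conv f g s)// !(convE _ ur fr).
by rewrite scaler_sumr; apply: eq_bigr => t _; rewrite -cmulZr -actZ.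
Qed.

Lemma convA f g h : Cc f -> Cc g -> conv (conv f g) h = conv f (conv g h).
Proof.
move=> /fsuppP[rf uf fr] /fsuppP[rg ug gr]; apply/funext => s.
pose r := undup [seq (t * u)%g | t <- rf, u <- rg].
have ur : uniq r by exact: undup_uniq.
rewrite (convE h ur); last first.
  by move=> t /(conv_supp uf fr gr); rewrite mem_undup.
rewrite (convE _ uf fr).
under eq_bigr => t _ do rewrite (convE g uf fr) cmul_suml.
rewrite exchange_big /=; apply: eq_big_seq => u urf.
rewrite (convE h ug gr) act_sum cmul_sumr.
pose F t := f u ** beta u (g (u^-1 * t)%g) ** beta t (h (t^-1 * s)%g).
rewrite -(@fsum_seq _ _ F r ur); last first.
  move=> t /cmul_neq0l/cmul_neq0r/act_neq0/gr ut.
  by rewrite mem_undup; apply/allpairsP; exists (u, (u^-1 * t)%g); rewrite /= mulVKg.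
rewrite (@reindex_fsbigT _ _ _ _ _ (fun t => u * t)%g); last first.
  by exists (fun t => u^-1 * t)%g => t; rewrite ?mulKg ?mulVKg.
rewrite /F (fsum_seq ug); last first.
  by move=> t /cmul_neq0l/cmul_neq0r/act_neq0; rewrite mulKg => /gr.
by apply: eq_bigr => t _; rewrite mulKg act_mul cmulA actM invgM mulgA.
Qed.

Lemma star_conv f g : Cc f -> Cc g -> star (conv f g) = conv (star g) (star f).
Proof.
move=> cf cg; have /fsuppP[r ur fr] := cf; apply/funext => s.
rewrite /conv_star /convolution.
rewrite [RHS](@reindex_fsbigT _ _ _ _ _ (fun t => s * t)%g); last first.
  by exists (fun t => s^-1 * t)%g => t; rewrite ?mulKg ?mulVKg.
rewrite (fsum_seq ur); last by move=> t /cmul_neq0l /fr.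
have tE t : ((s * t)^-1 * s)^-1%g = t by rewrite invgM invgK mulKg.
rewrite cstar_sum act_sum (fsum_seq ur); last first.
  move=> t /cmul_neq0r/act_neq0/act_neq0 tn; apply: fr; apply: contraNneq tn.
  by rewrite tE => ->; rewrite cstar0.
apply: eq_bigr => t _.
rewrite cstarM act_mul tE -act_star -!actM; congr (_ ** _).
  by rewrite invgM.
by rewrite mulgA mulgV mul1g.
Qed.

Definition l1 f : R := \sum_(t \in [set: G]) rnorm (f t).

Lemma l1_seq f (r : seq G) : uniq r -> (forall t, f t != 0 -> t \in r) ->
  l1 f = \sum_(t <- r) rnorm (f t).
Proof.
move=> ur fr; rewrite /l1 (fsum_seq ur)// => t tn; apply: fr.
by apply: contraNneq tn => ->; rewrite rnorm0.
Qed.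

Lemma l1_ge0 f : 0 <= l1 f.
Proof. by apply: fsumr_ge0 => t _; exact: rnorm_ge0. Qed.

Lemma l1_conv f g : Cc f -> Cc g -> l1 (conv f g) <= l1 f * l1 g.
Proof.
move=> cf cg; have /fsuppP[rf uf fr] := cf; have /fsuppP[rg ug gr] := cg.
have /fsuppP[r ur cr] := Cc_conv cf cg.
rewrite (l1_seq ur cr) (l1_seq uf fr) mulr_suml.
under eq_bigr do rewrite (convE g uf fr).
have : \sum_(t <- r) rnorm (\sum_(u <- rf) f u ** beta u (g (u^-1 * t)%g)) <=
    \sum_(t <- r) \sum_(u <- rf) rnorm (f u) * rnorm (g (u^-1 * t)%g).
  apply: ler_sum => t _; rewrite (le_trans (rnorm_sum _ _ _))//.
  apply: ler_sum => u _; rewrite (le_trans (rnorm_cmul _ _))//.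
  by rewrite ler_wpM2l ?rnorm_ge0// act_norm.
move=> /le_trans; apply; rewrite exchange_big; apply: ler_sum => u _.
rewrite -mulr_sumr ler_wpM2l ?rnorm_ge0//.
rewrite -(big_map (fun t => u^-1 * t)%g xpredT (fun t => rnorm (g t))).
pose r' := [seq (u^-1 * t)%g | t <- r].
have ur' : uniq r' by rewrite map_inj_uniq// => x y; exact: mulgI.
pose r2 := undup (r' ++ rg).
rewrite (@l1_seq g r2) ?undup_uniq//; last first.
  by move=> t /gr tg; rewrite mem_undup mem_cat tg orbT.
rewrite [leRHS](bigID (fun t => t \in r'))/= ler_wpDr//.
  by apply: sumr_ge0 => t _; exact: rnorm_ge0.
rewrite -[leRHS]big_filter (perm_big [seq t <- r2 | t \in r'])//.
apply: uniq_perm; rewrite ?filter_uniq ?undup_uniq// => t.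
by rewrite mem_filter mem_undup mem_cat; case: (t \in r').
Qed.

Lemma l1_star f : Cc f -> l1 (star f) <= l1 f.
Proof.
move=> cf; have /fsuppP[r ur fr] := cf.
rewrite (l1_seq ur fr) (@l1_seq (star f) [seq t^-1%g | t <- r]); last 2 first.
- by rewrite map_inj_uniq//; exact: invg_inj.
- move=> t tn; apply/mapP; exists t^-1%g; last by rewrite invgK.
  apply: fr; apply: contraNneq tn => f0.
  by rewrite /conv_star f0 cstar0 act0.
rewrite big_map; apply: ler_sum => t _; rewrite /conv_star invgK.
by rewrite (le_trans (act_norm _ _))// rnorm_cstar.
Qed.

End CompactSupport.

(** * Positive functionals and their GNS seminorms *)

Section LocalFunctional.
Variables (R : realType) (G : groupType) (B : cstarAlgType R).
Variables (beta : G -> B -> B) (sigma : B -> R).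
Hypothesis betaP : is_cstar_action beta.
Hypothesis slin : real_linear sigma.
Hypothesis sstar : forall b, sigma b^# = sigma b.
Hypothesis snorm : forall b, `|sigma b| <= rnorm b.
Hypothesis spos : forall b, 0 <= sigma (b^# ** b).
Variables (T : finType) (j : T -> G) (k : T -> T -> R).
Hypothesis jinj : injective j.
Hypothesis ksym : forall x y, k x y = k y x.
Hypothesis k1 : forall x y, `|k x y| <= 1.
Implicit Types f g : G -> B.

(** For [k = 1] this is the vector functional of the normalised sum of the
    [Omega] at [(j x)^-1] in the regular representation on [l^2(G, H)] induced
    from the GNS space [H] of [sigma] with cyclic vector [Omega]; [k] acts on
    it as a Schur multiplier. *)
Definition local_fct f : R := (#|T|%:R)^-1 *
  \sum_(x : T) \sum_(y : T) k x y * sigma (beta (j x) (f ((j x)^-1 * j y)%g)).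

Lemma local_fctD f g : local_fct (f + g) = local_fct f + local_fct g.
Proof.
rewrite /local_fct -mulrDr -big_split; congr (_ * _); apply: eq_bigr => x _ /=.
rewrite -big_split; apply: eq_bigr => y _ /=.
by rewrite -mulrDr -slin.1 -(actD betaP).
Qed.

Lemma local_fctZ t f : local_fct (t .* f) = t * local_fct f.
Proof.
rewrite /local_fct mulrCA; congr (_ * _); rewrite mulr_sumr.
apply: eq_bigr => x _ /=; rewrite mulr_sumr; apply: eq_bigr => y _ /=.
by rewrite [RHS]mulrCA -[in RHS]slin.2 -(actZ betaP).
Qed.

Lemma local_fct_star f : local_fct (conv_star beta f) = local_fct f.
Proof.
rewrite /local_fct exchange_big; congr (_ * _); apply: eq_bigr => y _ /=.
apply: eq_bigr => x _; rewrite ksym; congr (_ * _).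
rewrite /conv_star -(actM betaP) mulVKg (act_star betaP) sstar.
by rewrite invgM invgK.
Qed.

Lemma sum_inj_le_l1 f (h : T -> G) : Cc f -> injective h ->
  \sum_(y : T) rnorm (f (h y)) <= l1 f.
Proof.
move=> /fsuppP[r ur fr] hinj.
pose s := [seq h y | y <- index_enum T].
have us : uniq s by rewrite map_inj_uniq// index_enum_uniq.
pose r2 := undup (s ++ r).
rewrite (@l1_seq _ _ _ f r2) ?undup_uniq//; last first.
  by move=> t /fr tr; rewrite mem_undup mem_cat tr orbT.
rewrite [leRHS](bigID (fun t => t \in s))/= ler_wpDr//.
  by apply: sumr_ge0 => t _; exact: rnorm_ge0.
rewrite -(big_map h xpredT (fun t => rnorm (f t))) -/s.
rewrite -[leRHS]big_filter (perm_big [seq t <- r2 | t \in s])//.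
apply: uniq_perm; rewrite ?filter_uniq ?undup_uniq// => t.
by rewrite mem_filter mem_undup mem_cat; case: (t \in s).
Qed.

Lemma local_fct_bound f : Cc f -> `|local_fct f| <= l1 f.
Proof.
move=> cf; rewrite /local_fct normrM ger0_norm ?invr_ge0//.
have [T0|T0] := posnP #|T|; first by rewrite T0 invr0 mul0r l1_ge0.
rewrite ler_pdivrMl ?ltr0n// mulr_natl -sumr_const.
rewrite (le_trans (ler_norm_sum _ _ _))//; apply: ler_sum => x _.
rewrite (le_trans (ler_norm_sum _ _ _))//.
have hinj : injective (fun y => (j x)^-1 * j y)%g by move=> y y' /mulgI/jinj.
apply: le_trans (sum_inj_le_l1 cf hinj); apply: ler_sum => y _.
rewrite normrM -[leRHS]mul1r ler_pM//.
by rewrite (le_trans (snorm _))// (act_norm betaP).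
Qed.

(** Positivity on [f^* f] only involves, for each [z], the values of [k] on the
    set of [x] with [z^-1 (j x)] in the support of [f]. *)
Lemma local_fct_pos f : Cc f ->
  (forall z, exists (I : finType) (xi : I -> T -> R), forall x y,
    f (z^-1 * j x)%g != 0 -> f (z^-1 * j y)%g != 0 ->
    k x y = \sum_(i : I) xi i x * xi i y) ->
  0 <= local_fct (convolution beta (conv_star beta f) f).
Proof.
move=> cf kP; have /fsuppP[r ur fr] := cf.
pose s := undup [seq (j x * u^-1)%g | x <- index_enum T, u <- r].
have us : uniq s by exact: undup_uniq.
pose F z x := beta z (f (z^-1 * j x)%g).
have sz x z : f (z^-1 * j x)%g != 0 -> z \in s.
  move=> /fr zr; rewrite mem_undup; apply/allpairsP.
  by exists (x, (z^-1 * j x)%g); rewrite /= mem_index_enum invgM invgK mulVKg.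
have convF x y : beta (j x) (convolution beta (conv_star beta f) f ((j x)^-1 * j y)%g) =
    \sum_(z <- s) (F z x)^# ** F z y.
  rewrite /convolution (@reindex_fsbigT _ _ _ _ _ (fun z => (j x)^-1 * z)%g); last first.
    by exists (fun z => j x * z)%g => z; rewrite ?mulKg ?mulVKg.
  rewrite (fsum_seq us); last first.
    move=> z /cmul_neq0l/(act_neq0 betaP) zn; apply: (sz x).
    by apply: contraNneq zn; rewrite invgM invgK => ->; rewrite cstar0.
  rewrite (act_sum betaP); apply: eq_bigr => z _.
  rewrite (act_mul betaP) /conv_star -!(actM betaP) mulVKg -(act_star betaP).
  have -> : ((j x)^-1 * z)^-1%g = (z^-1 * j x)%g by rewrite invgM invgK.
  by rewrite -mulgA mulVKg.
have ssum (I : Type) (q : seq I) (H : I -> B) : sigma (\sum_(i <- q) H i) = \sum_(i <- q) sigma (H i).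
  apply: (big_morph sigma) => [a b|]; first exact: slin.1.
  by have := slin.2 0 0; rewrite scaler0 mul0r.
rewrite /local_fct mulr_ge0 ?invr_ge0//.
under eq_bigr => x _ do under eq_bigr => y _ do rewrite convF ssum mulr_sumr.
under eq_bigr => x _ do rewrite exchange_big.
rewrite exchange_big /=; apply: sumr_ge0 => z _.
have [I [xi xiP]] := kP z.
pose C i := \sum_(x : T) (xi i x) .* F z x.
suff -> : \sum_(x : T) \sum_(y : T) k x y * sigma ((F z x)^# ** F z y) =
    \sum_(i : I) sigma ((C i)^# ** C i) by apply: sumr_ge0 => i _; exact: spos.
have CE i : sigma ((C i)^# ** C i) =
    \sum_(x : T) \sum_(y : T) xi i x * xi i y * sigma ((F z x)^# ** F z y).
  rewrite /C cstar_sum cmul_suml ssum; apply: eq_bigr => x _.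
  rewrite cmul_sumr ssum; apply: eq_bigr => y _.
  by rewrite cstarZr cmulZl cmulZr !slin.2 mulrA.
under [RHS]eq_bigr => i _ do rewrite CE.
rewrite [RHS]exchange_big; apply: eq_bigr => x _ /=.
rewrite [RHS]exchange_big; apply: eq_bigr => y _ /=.
rewrite -mulr_suml.
have F0 x' : f (z^-1 * j x')%g = 0 -> F z x' = 0.
  by rewrite /F => ->; rewrite (act0 betaP).
have s0 : sigma 0 = 0 by have := slin.2 0 0; rewrite scaler0 mul0r.
have [/F0 ->|fx] := eqVneq (f (z^-1 * j x)%g) 0; first by rewrite cstar0 cmul0l s0 !mulr0.
have [/F0 ->|fy] := eqVneq (f (z^-1 * j y)%g) 0; first by rewrite cmul0r s0 !mulr0.
by rewrite -xiP.
Qed.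

End LocalFunctional.

Section UltraLimit.
Variable R : realType.
Implicit Types u v : nat -> R.

Definition rbounded u := exists M, forall n, `|u n| <= M.

Lemma ultralimit : exists L : (nat -> R) -> R,
  [/\ forall u v, rbounded u -> rbounded v -> L (u \+ v) = L u + L v,
      forall t u, rbounded u -> L (fun n => t * u n) = t * L u &
      forall u c, rbounded u -> (exists N, forall n, (N <= n)%N -> u n <= c) -> L u <= c].
Proof.
have [U [UU ooU]] := @ultraFilterLemma nat \oo _.
have ucvg u : rbounded u -> cvg (u @ U).
  move=> [M uM].
  have uUM : (u @ U) [set` `[- M, M]].
    apply: (@filterS _ U _ setT); last exact: filterT.
    by move=> n _; rewrite /= in_itv/= -ler_norml uM.
  have [l [_ ul]] := @segment_compact R (- M) M (u @ U) _ uUM.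
  apply/cvg_ex; exists l => N lN.
  have [//|UN] := in_ultra_setVsetC (u @^-1` N) UU.
  by have [x [/= nN xN]] := ul (~` N) N UN lN.
exists (fun u => lim (u @ U)); split.
- by move=> u v /ucvg uc /ucvg vc; apply/cvg_lim => //; exact: cvgD.
- by move=> t u /ucvg uc; apply/cvg_lim => //; exact: cvgMr.
- move=> u c /ucvg uc [N uN]; apply: limr_le => //; apply: ooU.
  by exists N => // n /= /uN.
Qed.

End UltraLimit.

(** The GNS construction on a *-algebra [D] of bounded elements, where the form
    [S x y] is the real part of the inner product. *)
Section GNS.
Variables (R : realType) (W : lmodType R[i]) (D : set W).
Variables (mul : W -> W -> W) (star : W -> W) (S : W -> W -> R).
Hypothesis DD : forall x y, D x -> D y -> D (x + y).
Hypothesis DZ : forall z x, D x -> D (z *: x).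
Hypothesis DM : forall x y, D x -> D y -> D (mul x y).
Hypothesis DS : forall x, D x -> D (star x).
Hypothesis D0 : D 0.
Hypothesis mulDl : forall x y w, D x -> D y -> D w -> mul (x + y) w = mul x w + mul y w.
Hypothesis mulZl : forall z x w, D x -> D w -> mul (z *: x) w = z *: mul x w.
Hypothesis mulA : forall x y w, D x -> D y -> D w -> mul (mul x y) w = mul x (mul y w).
Hypothesis starK : forall x, D x -> star (star x) = x.
Hypothesis Ssym : forall x y, D x -> D y -> S x y = S y x.
Hypothesis SDl : forall x y w, D x -> D y -> D w -> S (x + y) w = S x w + S y w.
Hypothesis SZl : forall (t : R) x w, D x -> D w -> S (t .* x) w = t * S x w.
Hypothesis SZ : forall (z : R[i]) x, D x -> S (z *: x) (z *: x) = complex.Re `|z| ^+ 2 * S x x.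
Hypothesis S0 : forall x, D x -> 0 <= S x x.
Hypothesis Sadj : forall x y w, D x -> D y -> D w -> S (mul x y) w = S y (mul (star x) w).
Hypothesis Sbdd : forall x, D x -> exists2 C, 0 <= C &
  forall y, D y -> S (mul x y) (mul x y) <= C * S y y.

Lemma cauchy_schwarz x y : D x -> D y -> S x y ^+ 2 <= S x x * S y y.
Proof.
move=> Dx Dy.
have q (t : R) : 0 <= t ^+ 2 * S x x + 2 * t * S x y + S y y.
  have tx := DZ (t%:C%C) Dx; have txy := DD tx Dy.
  have := S0 txy; rewrite SDl// SZl// (Ssym Dx txy) (Ssym Dy txy) !SDl// !SZl//.
  by rewrite (Ssym Dy Dx); lra.
have a0 := S0 Dx; have b0 := S0 Dy.
have [ax|ax] := eqVneq (S x x) 0.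
  have [->|s0] := eqVneq (S x y) 0; first by rewrite expr0n /= mulr_ge0.
  have := q (- (S y y + 1) / (2 * S x y)); rewrite ax mulr0 add0r.
  have -> : 2 * (- (S y y + 1) / (2 * S x y)) * S x y = - (S y y + 1) by field.
  lra.
have ap : 0 < S x x by rewrite lt_def ax.
have := q (- S x y / S x x).
have -> : (- S x y / S x x) ^+ 2 * S x x + 2 * (- S x y / S x x) * S x y + S y y =
  (S x x * S y y - S x y ^+ 2) / S x x by field.
by rewrite pmulr_lge0 ?invr_gt0// subr_ge0.
Qed.

Let nrm x := Num.sqrt (S x x).

Let nrmE x : D x -> nrm x ^+ 2 = S x x.
Proof. by move=> Dx; rewrite sqr_sqrtr ?S0. Qed.

Let nrm0 x : 0 <= nrm x. Proof. exact: sqrtr_ge0. Qed.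

Lemma cauchy_schwarz_sqrt x y : D x -> D y -> S x y <= nrm x * nrm y.
Proof.
move=> Dx Dy; rewrite (le_trans (ler_norm _))// -ler_sqr ?nnegrE ?mulr_ge0//.
by rewrite real_normK ?num_real// exprMn !nrmE// cauchy_schwarz.
Qed.

Let nrmD x y : D x -> D y -> nrm (x + y) <= nrm x + nrm y.
Proof.
move=> Dx Dy; have Dxy := DD Dx Dy.
rewrite -ler_sqr ?nnegrE ?addr_ge0// nrmE// SDl// !(@Ssym _ (x + y))// !SDl//.
rewrite (Ssym Dy Dx) sqrrD !nrmE// mulr2n.
by have := cauchy_schwarz_sqrt Dx Dy; lra.
Qed.

Let Sset x := [set nrm (mul x y) | y in [set y | D y /\ nrm y <= 1]].

(** The operator norm of left multiplication for the seminorm of [S]. *)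
Definition gns_norm x := sup (Sset x).

Let Ssup x : D x -> has_sup (Sset x).
Proof.
move=> Dx; split.
  exists (nrm (mul x 0)), 0 => //; split=> //.
  have := @SZl 0 0 0 D0 D0; rewrite scaler0 mul0r /nrm => ->.
  by rewrite sqrtr0.
have [C C0 xC] := Sbdd Dx; exists (Num.sqrt C) => _ [y [Dy y1] <-].
rewrite ler_sqrt// (le_trans (xC _ Dy))// -nrmE// -[leRHS]mulr1 ler_wpM2l//.
by rewrite expr_le1.
Qed.

Let gns0 x : D x -> 0 <= gns_norm x.
Proof.
move=> Dx; have [[s Ss] _] := Ssup Dx.
have s0 : 0 <= s by case: Ss => y _ <-.
by apply: le_trans s0 _; apply: sup_upper_bound => //; exact: Ssup.
Qed.

Let mulZr x (t : R) y : D x -> D y -> S (mul x (t .* y)) (mul x (t .* y)) =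
  t ^+ 2 * S (mul x y) (mul x y).
Proof.
move=> Dx Dy; have Dt := DZ t%:C%C Dy; have Dxy := DM Dx Dy; have Dxt := DM Dx Dt.
have Dsx := DS Dx.
rewrite Sadj ?SZl//; last exact: DM.
by rewrite -Sadj// Ssym// Sadj// SZl// -?Sadj//; [ring|exact: DM].
Qed.

Lemma gns_norm_ge x y : D x -> D y -> nrm (mul x y) <= gns_norm x * nrm y.
Proof.
move=> Dx Dy; have [y0|yn] := eqVneq (nrm y) 0.
  rewrite y0 mulr0; have [C C0 /(_ _ Dy)] := Sbdd Dx.
  by rewrite -(nrmE Dy) y0 expr0n /= mulr0 /nrm => /ler0_sqrtr ->.
have yp : 0 < nrm y by rewrite lt_def yn nrm0.
rewrite -ler_pdivrMr//; apply: sup_upper_bound; first exact: Ssup.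
exists ((nrm y)^-1 .* y); last first.
  rewrite /nrm mulZr// sqrtrM ?sqr_ge0// sqrtr_sqr ger0_norm ?invr_ge0 ?nrm0//.
  by rewrite mulrC.
split; first exact: DZ.
have Dt := DZ (nrm y)^-1%:C%C Dy.
rewrite {1}/nrm SZl// (Ssym Dy Dt) SZl// -nrmE// expr2 mulKf// mulVf// sqrtr1//.
Qed.

Lemma gns_norm_le x M : D x -> 0 <= M ->
  (forall y, D y -> nrm (mul x y) <= M * nrm y) -> gns_norm x <= M.
Proof.
move=> Dx M0 xM; apply: ge_sup; first exact: (Ssup Dx).1.
move=> _ [y [Dy y1] <-]; rewrite (le_trans (xM _ Dy))//.
by rewrite -[leRHS]mulr1 ler_wpM2l.
Qed.

Lemma gns_normD x y : D x -> D y -> gns_norm (x + y) <= gns_norm x + gns_norm y.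
Proof.
move=> Dx Dy; apply: gns_norm_le; rewrite ?addr_ge0 ?gns0//; first exact: DD.
move=> w Dw; rewrite mulDl// (le_trans (nrmD _ _))//; try exact: DM.
by rewrite mulrDl lerD// gns_norm_ge.
Qed.

Lemma gns_normZ z x : D x -> gns_norm (z *: x) = complex.Re `|z| * gns_norm x.
Proof.
move=> Dx; have Dzx := DZ z Dx.
have r0 := Re_normC_ge0 z.
have E w : D w -> nrm (mul (z *: x) w) = complex.Re `|z| * nrm (mul x w).
  move=> Dw; rewrite mulZl// /nrm SZ; last exact: DM.
  by rewrite sqrtrM ?sqr_ge0// sqrtr_sqr ger0_norm.
apply/eqP; rewrite eq_le; apply/andP; split.
  apply: gns_norm_le; rewrite ?mulr_ge0 ?gns0// => w Dw.
  by rewrite E// -mulrA ler_wpM2l// gns_norm_ge.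
have [->|rn] := eqVneq (complex.Re `|z|) 0; first by rewrite mul0r gns0.
have rp : 0 < complex.Re `|z| by rewrite lt_def rn.
rewrite -ler_pdivlMl//; apply: gns_norm_le; rewrite ?mulr_ge0 ?invr_ge0 ?gns0// => w Dw.
by rewrite -mulrA ler_pdivlMl// -E// gns_norm_ge.
Qed.

Lemma gns_normM x y : D x -> D y -> gns_norm (mul x y) <= gns_norm x * gns_norm y.
Proof.
move=> Dx Dy; apply: gns_norm_le; rewrite ?mulr_ge0 ?gns0//; first exact: DM.
move=> w Dw; rewrite mulA// (le_trans (gns_norm_ge _ _))//; first exact: DM.
by rewrite -mulrA ler_wpM2l ?gns0// gns_norm_ge.
Qed.

(** As for operators: the norm of [x y] is the form at [y] and [x^* x y]. *)
Lemma gns_norm_star_mul x : D x -> gns_norm (mul (star x) x) = gns_norm x ^+ 2.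
Proof.
have le y : D y -> gns_norm y ^+ 2 <= gns_norm (mul (star y) y).
  move=> Dy; have Dsy := DM (DS Dy) Dy.
  rewrite -(sqr_sqrtr (gns0 Dsy)) ler_sqr ?nnegrE ?sqrtr_ge0 ?gns0//.
  apply: gns_norm_le; rewrite ?sqrtr_ge0// => w Dw; have Dyw := DM Dy Dw.
  rewrite -ler_sqr ?nnegrE ?mulr_ge0 ?sqrtr_ge0// exprMn.
  rewrite (sqr_sqrtr (gns0 Dsy)) (nrmE Dyw) Sadj// -mulA//; last exact: DS.
  rewrite (le_trans (cauchy_schwarz_sqrt _ _))//; first exact: DM.
  by rewrite expr2 mulrA [leLHS]mulrC ler_wpM2r// gns_norm_ge.
have le' y : D y -> gns_norm y <= gns_norm (star y).
  move=> Dy; have [->|y0] := eqVneq (gns_norm y) 0; first by rewrite gns0//; exact: DS.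
  have yp : 0 < gns_norm y by rewrite lt_def y0 gns0.
  rewrite -(ler_pM2r yp) -expr2 (le_trans (le _ Dy))// gns_normM//; exact: DS.
move=> Dx; apply/eqP; rewrite eq_le le// andbT.
rewrite (le_trans (gns_normM _ _))//; first exact: DS.
rewrite expr2 ler_wpM2r ?gns0// -{2}(starK Dx) le'//; exact: DS.
Qed.

Lemma gns_norm_vector x y : D x -> D y -> S y (mul x y) <= gns_norm x * S y y.
Proof.
move=> Dx Dy; rewrite (le_trans (cauchy_schwarz_sqrt Dy (DM Dx Dy)))//.
by rewrite -nrmE// expr2 mulrA mulrC ler_wpM2r// gns_norm_ge.
Qed.

Lemma gns_norm_cstar : [/\ forall x y, D x -> D y -> gns_norm (x + y) <= gns_norm x + gns_norm y,
    forall z x, D x -> gns_norm (z *: x) = complex.Re `|z| * gns_norm x,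
    forall x y, D x -> D y -> gns_norm (mul x y) <= gns_norm x * gns_norm y,
    forall x, D x -> gns_norm (mul (star x) x) = gns_norm x ^+ 2 &
    forall x, D x -> 0 <= gns_norm x /\
      forall y, D y -> S y (mul x y) <= gns_norm x * S y y].
Proof.
split=> [x y|z x|x y|x|x Dx]; [exact: gns_normD|exact: gns_normZ|
  exact: gns_normM|exact: gns_norm_star_mul|].
by split=> [|y]; [exact: gns0|exact: gns_norm_vector].
Qed.

End GNS.

(** By Bernoulli's inequality, the powers of [rho / L] are unbounded if
    [L < rho]. *)
Lemma ler_of_pow2 (R : realType) (rho L K : R) : 0 <= L ->
  (forall k, rho ^+ (2 ^ k) <= K * L ^+ (2 ^ k)) -> rho <= L.
Proof.
move=> L0 h; rewrite leNgt; apply/negP => Lrho.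
have rho0 : 0 < rho by exact: le_lt_trans Lrho.
have [L00|Ln] := eqVneq L 0.
  have := h 0%N; rewrite L00 expn0 !expr1 mulr0; lra.
have Lp : 0 < L by rewrite lt_def Ln.
pose d := rho / L - 1; have d0 : 0 < d by rewrite subr_gt0 ltr_pdivlMr// mul1r.
have bern (m : nat) : 1 + m%:R * d <= (rho / L) ^+ m.
  rewrite (_ : rho / L = 1 + d); last by rewrite /d addrC subrK.
  elim: m => [|m IH]; first by rewrite mul0r addr0 expr0.
  have d1 : 0 <= 1 + d by rewrite addr_ge0// ltW.
  have := ler_wpM2l d1 IH; rewrite exprS -natr1.
  have : 0 <= m%:R * d * d by rewrite !mulr_ge0// ltW.
  by lra.
pose m := Num.bound (`|K| / d).
have : (rho / L) ^+ (2 ^ m) <= K.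
  by rewrite expr_div_n ler_pdivrMr ?exprn_gt0.
have : (m%:R : R) <= (2 ^ m)%:R by rewrite ler_nat ltnW// ltn_expl.
have : `|K| / d < m%:R by apply: archi_boundP; rewrite divr_ge0// ltW.
rewrite ltr_pdivrMr//; have := bern (2 ^ m)%N; have := ler_norm K; nra.
Qed.

Section PositiveFunctional.
Variables (R : realType) (G : groupType) (B : cstarAlgType R).
Variables (beta : G -> B -> B) (Psi : (G -> B) -> R).
Hypothesis betaP : is_cstar_action beta.
Local Notation conv := (convolution beta).
Local Notation star := (conv_star beta).
Hypothesis PsiD : forall f g, Cc f -> Cc g -> Psi (f + g) = Psi f + Psi g.
Hypothesis PsiZ : forall (t : R) f, Cc f -> Psi (t .* f) = t * Psi f.
Hypothesis Psi_star : forall f, Cc f -> Psi (star f) = Psi f.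
Hypothesis Psi_bound : forall f, Cc f -> `|Psi f| <= l1 f.
Hypothesis Psi_pos : forall f, Cc f -> 0 <= Psi (conv (star f) f).

Let S (x y : G -> B) := Psi (conv (star x) y).

Let cM f g : Cc f -> Cc g -> Cc (conv f g). Proof. exact: Cc_conv. Qed.
Let cS f : Cc f -> Cc (star f). Proof. exact: Cc_star. Qed.
Let c0 : Cc (0 : G -> B).
Proof. by apply: (@seq_fsupp _ _ [::]) => t; rewrite eqxx. Qed.

Let starD f g : star (f + g) = star f + star g.
Proof. by apply/funext => s; rewrite /conv_star /= cstarD (actD betaP). Qed.

Let starZ (z : R[i]) f : star (z *: f) = z^* *: star f.
Proof. by apply/funext => s; rewrite /conv_star /= cstarZ (actZ betaP). Qed.

Let Ssym x y : Cc x -> Cc y -> S x y = S y x.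
Proof.
move=> cx cy; rewrite /S -Psi_star; last exact: cM (cS cx) cy.
rewrite star_conv//; last exact: cS.
by rewrite star_invol.
Qed.

Let SDl x y w : Cc x -> Cc y -> Cc w -> S (x + y) w = S x w + S y w.
Proof.
move=> cx cy cw; rewrite /S starD convDl//; try exact: cS.
by rewrite PsiD//; apply: cM => //; exact: cS.
Qed.

Let SZl (t : R) x w : Cc x -> Cc w -> S (t .* x) w = t * S x w.
Proof.
move=> cx cw; rewrite /S starZ conjC_real convZl//; last exact: cS.
by rewrite PsiZ//; apply: cM => //; exact: cS.
Qed.

Let SZ (z : R[i]) x : Cc x -> S (z *: x) (z *: x) = complex.Re `|z| ^+ 2 * S x x.
Proof.
move=> cx; rewrite /S starZ convZl; last exact: cS.
rewrite convZr//; last exact: cS.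
rewrite scalerA [_^* * _]mulrC -normCK -Re_normCE -rmorphXn PsiZ//.
by apply: cM => //; exact: cS.
Qed.

Let Sadj x y w : Cc x -> Cc y -> Cc w -> S (conv x y) w = S y (conv (star x) w).
Proof. by move=> cx cy cw; rewrite /S star_conv// convA//; exact: cS. Qed.

Let Sl1 x y : Cc x -> Cc y -> S x y <= l1 x * l1 y.
Proof.
move=> cx cy; rewrite (le_trans (ler_norm _))// (le_trans (Psi_bound _))//.
  by apply: cM => //; exact: cS.
rewrite (le_trans (l1_conv betaP (cS cx) cy))// ler_wpM2r ?l1_ge0//.
exact: l1_star.
Qed.

Let CS x y : Cc x -> Cc y -> S x y ^+ 2 <= S x x * S y y.
Proof.
apply: (@cauchy_schwarz R _ (@Cc R G B)) => //.
- exact: CcD.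
- exact: CcZ.
Qed.

(** Iterated Cauchy-Schwarz: [S (y, w y) ^ (2 ^ k)] is at most
    [S (y, y) ^ (2 ^ k - 1)] times [S (y, w ^ (2 ^ k) y)], and the latter grows
    at most like the powers of the l^1-norm of [w = x^* x]. *)
Let Sbdd x : Cc x -> exists2 C, 0 <= C &
  forall y, Cc y -> S (conv x y) (conv x y) <= C * S y y.
Proof.
move=> cx; pose w := conv (star x) x.
have cw : Cc w by apply: cM => //; exact: cS.
have wsa : star w = w by rewrite /w star_conv// ?star_invol//; exact: cS.
exists (l1 w); first exact: l1_ge0.
move=> y cy; rewrite Sadj//; last exact: cM.
rewrite -convA//; last exact: cS.
rewrite -/w; pose z n := iter n (conv w) y.
have cz n : Cc (z n) by elim: n => //= n; exact: cM.
pose b n := S y (z n).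
have shift m n : S (z m) (z n) = b (m + n)%N.
  elim: m n => [//|m IH] n; rewrite addSnnS -IH /= Sadj// ?wsa//.
have b2 n : b n ^+ 2 <= S y y * b (2 * n)%N.
  by rewrite mul2n -addnn -shift CS.
have bK n : b n <= l1 y * l1 y * l1 w ^+ n.
  rewrite (le_trans (Sl1 _ _))// -mulrA ler_wpM2l ?l1_ge0// mulrC.
  elim: n => [|n IH]; first by rewrite expr0 mul1r.
  rewrite exprS -mulrA (le_trans (l1_conv betaP cw (cz n)))//.
  by rewrite ler_wpM2l ?l1_ge0.
have Sy0 : 0 <= S y y by exact: Psi_pos.
change (b 1%N <= l1 w * S y y).
have [Sy|Sy] := eqVneq (S y y) 0.
  have := b2 1%N; rewrite Sy mul0r mulr0 => b10.
  have : b 1%N ^+ 2 == 0 by rewrite eq_le b10 sqr_ge0.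
  by rewrite sqrf_eq0 => /eqP ->.
have Syp : 0 < S y y by rewrite lt_def Sy.
have pw k : (b 1%N / S y y) ^+ (2 ^ k) <= b (2 ^ k)%N / S y y.
  elim: k => [|k IH]; first by rewrite expn0 expr1.
  have b0 : 0 <= b 1%N / S y y.
    rewrite divr_ge0// /b /= /w convA//; last exact: cS.
    by rewrite -Sadj//; [apply: Psi_pos|]; exact: cM.
  rewrite expnSr exprM.
  have := b2 (2 ^ k)%N; rewrite mulnC => b2k.
  rewrite (le_trans (lerXn2r _ _ _ IH)) ?nnegrE ?exprn_ge0//.
    exact: le_trans (exprn_ge0 _ b0) IH.
  rewrite expr_div_n ler_pdivrMr ?exprn_gt0// (le_trans b2k)//.
  by rewrite expr2 mulrA divfK// mulrC.
rewrite -ler_pdivrMr//; apply: (@ler_of_pow2 _ _ _ (l1 y * l1 y / S y y)); first exact: l1_ge0.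
move=> k; apply: le_trans (pw k) _.
by rewrite mulrAC ler_pM2r ?invr_gt0.
Qed.

(** With [e] as a unit for [f], [Psi f] is the value at [e] of the form of the
    operator [f]. *)
Lemma gns_seminorm : exists p : (G -> B) -> R,
  [/\ is_cstar_seminorm beta p, forall f, Cc f -> 0 <= p f &
      forall f e, Cc f -> Cc e -> conv f e = f -> conv (star e) f = f ->
        conv (star e) e = e -> Psi e <= 1 -> Psi f <= p f].
Proof.
have mDl x y w : Cc x -> Cc y -> Cc w -> conv (x + y) w = conv x w + conv y w.
  by move=> cx cy _; exact: convDl.
have mZl z x w : Cc x -> Cc w -> conv (z *: x) w = z *: conv x w.
  by move=> cx _; exact: convZl.
have mA x y w : Cc x -> Cc y -> Cc w -> conv (conv x y) w = conv x (conv y w).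
  by move=> cx cy _; exact: convA.
have sK x : Cc x -> star (star x) = x by move=> _; exact: star_invol.
have [h1 h2 h3 h4 h5] := @gns_norm_cstar R _ (@Cc R G B) conv star S
  (@CcD _ _ _) (@CcZ _ _ _) cM cS c0 mDl mZl mA sK Ssym SDl SZl SZ Psi_pos Sadj Sbdd.
exists (gns_norm (@Cc R G B) conv S); split=> [|f /h5[]//|f e cf ce fe ef ee e1].
  by split.
have [p0 /(_ e ce)] := h5 f cf; rewrite fe /S ef ee => /le_trans; apply.
by rewrite ler_piMr.
Qed.

End PositiveFunctional.

(** * A lower bound for the injective norm *)

Section InjNormLowerBound.
Variables (R : realType) (G : groupType) (X : nat -> finType).
Variables (j : forall n, X n -> G) (k : forall n, X n -> X n -> R).
Hypothesis jinj : forall n, injective (@j n).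
Hypothesis ksym : forall n (x y : X n), k x y = k y x.
Hypothesis k1 : forall n (x y : X n), `|k x y| <= 1.
Hypothesis gram : forall r : seq G, exists N, forall n, (N <= n)%N -> forall z,
  exists (I : finType) (xi : I -> X n -> R), forall x y : X n,
    (z^-1 * j x)%g \in r -> (z^-1 * j y)%g \in r -> k x y = \sum_(i : I) xi i x * xi i y.

Lemma bounded_ind (P : pred G) : (fun g => (P g)%:R) \in @bounded_fct R G.
Proof.
apply/asboolP; exists 1 => x; rewrite normr_nat.
by case: (P x); rewrite /= ?lexx// lecR.
Qed.

Definition linf_ind (P : pred G) : linf R G := Linf (bounded_ind P).

Section Representation.
Variables (B : cstarAlgType R) (beta : G -> B -> B) (iota : linf R G -> B).
Hypotheses (betaP : is_cstar_action beta) (iotaP : is_star_hom iota).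
Hypotheses (iota_inj : injective iota).
Hypothesis iota_eq : equivariant (@ltrans R G) beta iota.

(** The image of the indicator of [1] is a projection [q] which compresses
    [iota h] to [h 1] times [q]; equivariance transports this to all of [G]. *)
Lemma equivariant_state : exists sigma : B -> R,
  [/\ real_linear sigma, forall b, sigma b^# = sigma b,
      forall b, `|sigma b| <= rnorm b, forall b, 0 <= sigma (b^# ** b) &
      forall g h, sigma (beta g (iota h)) = complex.Re (h g^-1%g)].
Proof.
pose dl := linf_ind (pred1 1%g); pose q := iota dl.
have dd h : cmul (cmul dl h) dl = (h 1%g) *: dl.
  apply: linfP => x; rewrite linfZ /=.
  by case: eqP => [->|_]; rewrite /= ?mulr1 ?mul1r// !mulr0.
have [|||s [s1 s2 s3 s4 s5]] := @corner_state R B q.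
- rewrite /q -(star_homS iotaP); congr iota; apply: linfP => x /=.
  by rewrite conjC_nat.
- rewrite /q -(star_homM iotaP); congr iota; apply: linfP => x /=.
  by rewrite -natrM mulnb andbb.
- apply/eqP => q0; have : dl = 0 by apply: iota_inj; rewrite (star_hom0 iotaP).
  move=> /(congr1 (fun f : linf R G => f 1%g)); rewrite linf0 /= eqxx => /eqP.
  by rewrite oner_eq0.
exists s; split=> // g h; rewrite -iota_eq.
rewrite (s5 _ (ltrans g h 1%g)) /= ?mulg1//.
by rewrite /q -!(star_homM iotaP) dd (star_homZ iotaP) /= mulg1.
Qed.

(** The ultralimit of the functionals [local_fct] is positive, since [k] is a Gram
    matrix on the translates of any finite set once [n] is large; its GNS
    seminorm is one of those whose supremum is the maximal norm. *)
Lemma max_norm_ge (a : G -> linf R G) (c : R) : Cc a ->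
  (exists N, forall n, (N <= n)%N -> c <= (#|X n|%:R)^-1 *
    \sum_(x : X n) \sum_(y : X n) k x y *
      complex.Re (a ((j x)^-1 * j y)%g (j x)^-1%g)) ->
  (c%:E <= max_norm beta (iota \o a))%E.
Proof.
move=> ca [N ac].
have [s [s1 s2 s3 s4 s5]] := equivariant_state.
have [L [LD LZ Lle]] := ultralimit R.
pose P n := local_fct beta s (@j n) (@k n).
pose Psi f := L (P^~ f).
have Pb f : Cc f -> rbounded (P^~ f).
  by move=> cf; exists (l1 f) => n; exact: local_fct_bound.
have Lge u d : rbounded u -> (exists N, forall n, (N <= n)%N -> d <= u n) -> d <= L u.
  move=> ub [M uM]; rewrite -lerN2 -mulN1r -LZ//; apply: Lle.
    by case: ub => K uK; exists K => n; rewrite mulN1r normrN.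
  by exists M => n /uM; rewrite mulN1r lerN2.
have PsiD f g : Cc f -> Cc g -> Psi (f + g) = Psi f + Psi g.
  move=> cf cg; transitivity (L ((P^~ f) \+ (P^~ g))); last by apply: LD; exact: Pb.
  congr L; apply/funext => n /=.
  exact: local_fctD.
have PsiZ (t : R) f : Cc f -> Psi (t .* f) = t * Psi f.
  move=> cf; rewrite /Psi -(LZ _ _ (Pb _ cf)); congr L; apply/funext => n /=.
  exact: local_fctZ.
have PsiS f : Cc f -> Psi (conv_star beta f) = Psi f.
  by move=> cf; congr L; apply/funext => n; apply: local_fct_star.
have PsiB f : Cc f -> `|Psi f| <= l1 f.
  move=> cf; have pb n : `|P n f| <= l1 f by exact: local_fct_bound.
  rewrite ler_norml; apply/andP; split; [apply: Lge|apply: Lle]; try exact: Pb.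
    by exists 0%N => n _; have := pb n; rewrite ler_norml => /andP[].
  by exists 0%N => n _; have := pb n; rewrite ler_norml => /andP[].
have PsiP f : Cc f -> 0 <= Psi (convolution beta (conv_star beta f) f).
  move=> cf; have /fsuppP[r ur fr] := cf.
  apply: Lge; first by apply: Pb; apply: Cc_conv => //; exact: Cc_star.
  have [M rM] := gram r; exists M => n /rM nM.
  apply: local_fct_pos => // z; have [I [xi xiP]] := nM z.
  by exists I, xi => x y /fr fx /fr fy; exact: xiP.
have [p [p1 p0 p2]] := gns_seminorm betaP PsiD PsiZ PsiS PsiB PsiP.
pose f := iota \o a.
have i0 : iota 0 = 0 by exact: star_hom0.
have cf : Cc f.
  have /fsuppP[r ur ar] := ca; apply: (@seq_fsupp _ _ r) => t tn; apply: ar.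
  by apply: contraNneq tn => at0; rewrite /f /= at0 i0.
(* The function [e] need not be a unit of [C_c(G, B)], but it is one on the image
   of [C_c(G, l^oo(G))]. *)
pose one := linf_ind predT.
pose e := fun s : G => if s == 1%g then iota one else 0.
have er s0 : e s0 != 0 -> s0 \in [:: 1%g].
  by rewrite /e inE; case: (s0 == 1%g); rewrite ?eqxx.
have ce : Cc e by exact: (seq_fsupp er).
have b1 g : beta g (iota one) = iota one.
  by rewrite -iota_eq; congr iota; apply: linfP.
have onel h : cmul one h = h by apply: linfP => x /=; rewrite mul1r.
have oner h : cmul h one = h by apply: linfP => x /=; rewrite mulr1.
have e_star : conv_star beta e = e.
  apply/funext => t; rewrite /conv_star /e invg_eq1; case: eqP => [->|_].
    rewrite -(star_homS iotaP) (_ : cstar one = one) ?b1//.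
    by apply: linfP => x /=; rewrite conjC1.
  by rewrite cstar0 (act0 betaP).
have fe b : Cc b -> convolution beta (iota \o b) e = iota \o b.
  move=> cb; have /fsuppP[r ur br] := cb; apply/funext => t /=.
  rewrite (@convE _ _ _ beta (iota \o b) e (undup (t :: r))) ?undup_uniq//; last first.
    move=> u un; rewrite mem_undup in_cons; apply/orP; right; apply: br.
    by apply: contraNneq un => b0; rewrite /= b0 i0.
  rewrite (bigD1_seq t) ?mem_undup ?mem_head ?undup_uniq//= big1 => [|u ut].
    by rewrite mulVg /e eqxx b1 -(star_homM iotaP) oner addr0.
  rewrite /e (_ : (_ == 1%g) = false) ?(act0 betaP) ?cmul0r//.
  by apply/eqP => h; move: ut; rewrite -(mulVKg u t) h mulg1 eqxx.
have ef b : convolution beta e (iota \o b) = iota \o b.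
  apply/funext => t; rewrite (@convE _ _ _ beta e _ [:: 1%g] isT er) big_seq1 /e eqxx invg1 mul1g.
  by rewrite (act1 betaP) -(star_homM iotaP) onel.
have eE : e = iota \o (fun s => if s == 1%g then one else 0).
  by apply/funext => t /=; rewrite /e; case: eqP; rewrite ?i0.
have e1 : Psi e <= 1.
  rewrite (le_trans (ler_norm _))// (le_trans (PsiB _ ce))//.
  rewrite (@l1_seq _ _ _ e [:: 1%g] isT er) big_seq1 /e eqxx.
  rewrite (le_trans (star_hom_contractive iotaP _))// -lecR rnormE.
  rewrite linf_normE lecR; apply: sup_norm_leC => // x.
  by rewrite /= normr1.
have := p2 f e cf ce (fe _ ca); rewrite e_star ef {2}eE ef -eE => /(_ erefl erefl e1) le.
apply: (@le_trans _ _ (p f)%:E); last by apply: ereal_sup_ubound; exists p.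
rewrite lee_fin; apply: le_trans le; apply: Lge; first exact: Pb.
exists N => n /ac; rewrite /P /local_fct => /le_trans; apply.
rewrite ler_wpM2l ?invr_ge0//; apply: ler_sum => x _; apply: ler_sum => y _.
by rewrite /f /= s5.
Qed.

End Representation.

Lemma inj_norm_ge (a : G -> linf R G) (c : R) : Cc a ->
  (exists N, forall n, (N <= n)%N -> c <= (#|X n|%:R)^-1 *
    \sum_(x : X n) \sum_(y : X n) k x y *
      complex.Re (a ((j x)^-1 * j y)%g (j x)^-1%g)) ->
  (c%:E <= inj_norm (@ltrans R G) a)%E.
Proof.
move=> ca ac; apply: le_ereal_inf_tmp => _ [B [beta [iota [h1 h2 h3 h4 ->]]]].
exact: max_norm_ge.
Qed.

End InjNormLowerBound.

(** * Graphs of large girth and trees *)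

Section GraphDistance.
Variables (T : finType) (e : rel T).
Hypothesis e_conn : forall x y, connect e x y.

Lemma walk_exists x y : exists n, `[< exists p, [/\ path e x p, last x p = y & size p = n] >].
Proof.
have /connectP[p ep ->] := e_conn x y.
by exists (size p); apply/asboolP; exists p.
Qed.

Definition dist x y : nat := ex_minn (walk_exists x y).

Lemma dist_path x y : exists p, [/\ path e x p, last x p = y & size p = dist x y].
Proof. by rewrite /dist; case: ex_minnP => n /asboolP. Qed.

Lemma dist_le x p : path e x p -> (dist x (last x p) <= size p)%N.
Proof.
move=> ep; rewrite /dist; case: ex_minnP => n _; apply.
by apply/asboolP; exists p.
Qed.

Lemma dist_triangle x y z : (dist x z <= dist x y + dist y z)%N.
Proof.
have [p [ep py <-]] := dist_path x y; have [q [eq qz <-]] := dist_path y z.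
have := @dist_le x (p ++ q); rewrite cat_path ep py eq last_cat py qz size_cat.
exact.
Qed.

Lemma dist_xx x : dist x x = 0%N.
Proof. by apply/eqP; rewrite -leqn0 (@dist_le x [::]). Qed.

Lemma dist_eq0 x y : dist x y = 0%N -> x = y.
Proof. by have [p [_ <- <-]] := dist_path x y => /size0nil ->. Qed.

Lemma dist_edge x y : e x y -> (dist x y <= 1)%N.
Proof. by move=> xy; have := @dist_le x [:: y]; rewrite /= xy; exact. Qed.

Lemma dist_sym x y : symmetric e -> dist x y = dist y x.
Proof.
move=> es; have le u v : (dist u v <= dist v u)%N.
  have [p [ep pu <-]] := dist_path v u.
  have ep' : path e (last v p) (rev (belast v p)).
    by rewrite rev_path (eq_path (e' := e)).
  have lv : last u (rev (belast v p)) = v.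
    by case: {ep ep'} p pu => [|a p] //= _; rewrite rev_cons last_rcons.
  by have := dist_le ep'; rewrite size_rev size_belast pu lv.
by apply/eqP; rewrite eqn_leq !le.
Qed.

Lemma graph_metricE (R : realType) x y : graph_metric R e x y = (dist x y)%:R.
Proof.
rewrite /graph_metric; apply/eqP; rewrite eq_le; apply/andP; split.
  apply: ge_inf; first by exists 0 => _ [p _ <-].
  by have [p [ep py <-]] := dist_path x y; exists p.
apply: lb_le_inf; first by have [p [ep py _]] := dist_path x y; exists (size p)%:R, p.
by move=> _ [p [ep py] <-]; rewrite ler_nat -py dist_le.
Qed.

End GraphDistance.

Section LargeGirth.
Variables (T : finType) (e : rel T) (L : nat).
Hypothesis e_sym : symmetric e.
Hypothesis e_irr : irreflexive e.
Hypothesis e_conn : forall x y, connect e x y.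
Hypothesis e_girth : forall c, is_graph_cycle e c -> (L < size c)%N.

Local Notation dist := (dist e_conn).

Fixpoint nonbacktracking (s : seq T) : bool :=
  if s is a :: s' then (if s' is b :: c :: _ then a != c else true) && nonbacktracking s'
  else true.

(** A first return closes a cycle, which has more than [L] edges. *)
Lemma nb_uniq x p : path e x p -> nonbacktracking (x :: p) -> (size p <= L)%N ->
  uniq (x :: p).
Proof.
elim: p x => [//|y p IH] x /= /andP[exy eyp] /andP[xp nb] sp.
have /= uyp := IH y eyp nb (ltnW sp).
rewrite uyp andbT in_cons negb_or; apply/andP; split.
  by apply: contraTneq exy => ->; rewrite e_irr.
apply/negP => xinp; move: eyp xp uyp sp nb; case/splitPr: xinp => p1 p2.
rewrite cat_path /= => /and3P[ep1 ex _] xp uyp sp _.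
have := @e_girth (x :: y :: p1); move: sp; rewrite size_cat /= => sp.
rewrite ltnNge (leq_trans _ sp) ?addnS ?ltnS ?leq_addr// => /(_ _) h.
suff : false by []; apply: h; rewrite /is_graph_cycle /=.
move: uyp; rewrite mem_cat negb_or cat_uniq /= => /andP[/andP[-> _] /and3P[-> /norP[nx _] _]].
rewrite in_cons negb_or nx exy rcons_path ep1 ex !andbT.
rewrite (_ : x != y) ?andbT; last by apply: contraTneq exy => ->; rewrite e_irr.
by case: p1 {ep1 ex sp nx} xp => //=; rewrite eqxx.
Qed.

Definition diverge (p q : seq T) : bool :=
  if p is a :: _ then (if q is b :: _ then a != b else true) else true.

(** Reversing [p] and continuing along [q] stays non-backtracking. *)
Lemma nb_join x p q : path e x p -> path e x q ->
  nonbacktracking (x :: p) -> nonbacktracking (x :: q) ->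
  diverge p q ->
  exists w, [/\ path e (last x p) w, last (last x p) w = last x q,
    nonbacktracking (last x p :: w) & size w = (size p + size q)%N].
Proof.
elim: p x q => [|a p IH] x q; first by move=> _ eq _ nbq _; exists q; split.
move=> /= /andP[exa eap] exq /andP[xp nbp] nbq aq.
have exq' : path e a (x :: q) by rewrite /= e_sym exa.
have nbq' : nonbacktracking [:: a, x & q].
  by move: nbq aq; case: (q) => //= b q' -> ->.
have hd : diverge p (x :: q).
  by move: xp; case: (p) => //= c p'; rewrite eq_sym.
have [w [ew wl nbw sw]] := IH a (x :: q) eap exq' nbp nbq' hd.
by exists w; split=> //; rewrite sw /= addnS addSn.
Qed.

(** After their common beginning, two different walks with the same ends would
    form a closed non-backtracking walk that is too short. *)
Lemma nb_unique x p q : path e x p -> path e x q ->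
  nonbacktracking (x :: p) -> nonbacktracking (x :: q) ->
  last x p = last x q -> (size p + size q <= L)%N -> p = q.
Proof.
have diff y s t : path e y s -> path e y t -> nonbacktracking (y :: s) ->
    nonbacktracking (y :: t) -> last y s = last y t -> (size s + size t <= L)%N -> 
    diverge s t -> s = t.
  move=> es et ns nt lst sz hd; have [w [ew wl nw sw]] := nb_join es et ns nt hd.
  have := nb_uniq ew nw; rewrite sw sz => /(_ isT) /= /andP[zw _].
  have : size w = 0%N.
    apply/eqP; rewrite size_eq0; apply: contraNT zw => w0.
    by rewrite -{1}[last y s]/(last y s) {1}lst -wl; case: (w) w0 => //= c w' _; exact: mem_last.
  by rewrite sw => /eqP; rewrite addn_eq0 => /andP[/eqP/size0nil -> /eqP/size0nil ->].
elim: p x q => [|a p IH] x [|b q] // exp exq nbp nbq lpq sz; try exact: (diff x).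
have [ab|ab] := eqVneq a b; last exact: (diff x).
move: exp exq nbp nbq lpq sz; rewrite -ab /= => /andP[_ ep] /andP[_ eq] /andP[_ np] /andP[_ nq] lpq.
rewrite addSn addnS => sz; congr (_ :: _); apply: (IH a) => //.
by move: sz; lia.
Qed.

Lemma nb_reduce x p : path e x p -> exists q, [/\ path e x q, last x q = last x p,
  nonbacktracking (x :: q) & (size q <= size p)%N].
Proof.
elim: p x => [|a p IH] x /=; first by exists [::].
move=> /andP[exa /IH[q [eq lq nq sq]]].
have [xq|xq] := boolP (if q is b :: _ then x == b else false).
  case: q xq eq lq nq sq => // b q /eqP <- /= /andP[_ exq] lq /andP[_ nq] sq.
  by exists q; split=> //; rewrite ltnW// ltnW.
exists (a :: q); split=> //=; first by rewrite exa.
by move: nq xq; case: (q) => //= b q' -> ->.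
Qed.

Lemma dist_nb x y : exists p, [/\ path e x p, last x p = y,
  nonbacktracking (x :: p) & size p = dist x y].
Proof.
have [p [ep py sp]] := dist_path e_conn x y.
have [q [eq qp nq sq]] := nb_reduce ep.
exists q; split=> //; first by rewrite qp.
apply/eqP; rewrite eqn_leq -{1}sp sq/= -py -qp; exact: dist_le.
Qed.

Lemma nb_dist x p : path e x p -> nonbacktracking (x :: p) ->
  (size p + dist x (last x p) <= L)%N -> size p = dist x (last x p).
Proof.
move=> ep np; have [q [eq ql nq <-]] := dist_nb x (last x p) => sz.
by congr size; apply: (nb_unique ep eq np nq) => //; rewrite ql.
Qed.

(** Locally the graph is a tree: a geodesic from [x] to a point no further away
    from [o] starts by stepping to the parent of [x]. *)
Lemma dist_parent (o x x' y : T) m : (4 * m.+1 <= L)%N ->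
  e x' x -> dist o x = m.+1 -> dist o x' = m -> (dist o y <= m.+1)%N -> y != x ->
  dist x y = (dist x' y).+1.
Proof.
move=> mL exx' ox ox' oy yx.
have x'y : (dist x' y <= m + m.+1)%N.
  rewrite (leq_trans (dist_triangle e_conn x' o y))//.
  by rewrite (dist_sym e_conn x' o e_sym) ox' leq_add2l.
have [q [eq ql nq sq]] := dist_nb x' y.
have [p [ep pl np sp]] := dist_nb x' o.
rewrite (dist_sym e_conn x' o e_sym) ox' in sp.
have [xq|xq] := boolP (if q is b :: _ then x == b else false); last first.
  have exq : path e x (x' :: q) by rewrite /= e_sym exx'.
  have nxq : nonbacktracking [:: x, x' & q].
    by move: xq nq; case: (q) => //= b q' -> ->.
  have := nb_dist exq nxq; rewrite /= ql sq => -> //.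
  have := dist_triangle e_conn x x' y.
  have : (dist x x' <= 1)%N by apply: dist_edge; rewrite e_sym.
  lia.
exfalso; case: q xq eq ql nq sq => // b q /eqP <- {b} exq ql nq sq.
have hd : diverge p (x :: q).
  case: p ep pl sp {np} => //= a p /andP[ex'a eap] pl sp.
  apply/eqP => ax; have := dist_le e_conn eap; rewrite pl ax.
  by rewrite (dist_sym e_conn x o e_sym) ox -ltnS sp ltnNge leqnSn.
have [w [ew wl nw sw]] := nb_join ep exq np nq hd.
rewrite pl in ew wl nw.
have := nb_dist ew nw; rewrite wl ql sw sp sq => h.
have qn : q != [::] by apply: contraNneq yx => q0; rewrite -ql q0.
have : (1 < dist x' y)%N by rewrite -sq /= ltnS; case: (q) qn.
have : (m + dist x' y = dist o y)%N by apply: h; lia.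
lia.
Qed.

(** The kernel [r ^ d (x, y)] of a tree is a Gram matrix: the feature vector of
    [x] is [r] times that of its parent plus [sqrt (1 - r ^ 2)] times a new
    basis vector. *)
Lemma tree_gram (R : realType) (r : R) (o : T) m : 0 <= r <= 1 -> (4 * m <= L)%N ->
  exists (I : finType) (xi : I -> T -> R), forall x y, (dist o x <= m)%N ->
    (dist o y <= m)%N -> r ^+ dist x y = \sum_(i : I) xi i x * xi i y.
Proof.
move=> /andP[r0 r1]; elim: m => [|m IH] mL.
  exists unit, (fun _ _ => 1) => x y; rewrite !leqn0 => /eqP/dist_eq0 <- /eqP/dist_eq0 <-.
  by rewrite dist_xx expr0 big_const card_unit /= mulr1 addr0.
have [|I [xi xiP]] := IH; first by lia.
have parent x : dist o x = m.+1 -> exists x', e x' x /\ dist o x' = m.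
  move=> ox; have [p [ep pl sp]] := dist_path e_conn o x.
  rewrite ox in sp; case/lastP: p ep pl sp => // p z.
  rewrite rcons_path last_rcons size_rcons => /andP[ep ez] zx [sp].
  exists (last o p); rewrite -zx; split=> //; apply/eqP.
  rewrite eqn_leq -{1}sp (dist_le e_conn ep)/= -ltnS -ox.
  have := dist_triangle e_conn o (last o p) x.
  have : (dist (last o p) x <= 1)%N by apply: dist_edge; rewrite -zx.
  lia.
have [par parP] : exists par : T -> T, forall x, dist o x = m.+1 ->
    e (par x) x /\ dist o (par x) = m.
  have /choice[par parP] : forall x, exists x', dist o x = m.+1 -> e x' x /\ dist o x' = m.
    move=> x; have [/parent[x' x'P]|xm] := eqVneq (dist o x) m.+1; first by exists x'.
    by exists x => /eqP; rewrite (negbTE xm).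
  by exists par.
pose c := Num.sqrt (1 - r ^+ 2).
have cc : c * c = 1 - r ^+ 2.
  by rewrite -expr2 sqr_sqrtr// subr_ge0 expr_le1.
pose out x := dist o x == m.+1.
(* Only the vertices on the sphere of radius [m + 1] get a basis vector of their
   own; the others keep their vector from the ball of radius [m]. *)
pose ze (i : I + T) x := match i with
  | inl i => if out x then r * xi i (par x) else xi i x
  | inr z => if out x && (x == z) then c else 0 end.
exists (I + T)%type, ze => x y ox oy.
rewrite big_sumType /=.
have outP z : (dist o z <= m.+1)%N -> ~~ out z -> (dist o z <= m)%N.
  by rewrite /out leq_eqVlt => /orP[->|].
have s2 : \sum_(z : T) (if out x && (x == z) then c else 0) * (if out y && (y == z) then c else 0) =
    (out x && (x == y))%:R * (1 - r ^+ 2).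
  rewrite (bigD1 x)//= big1 ?addr0 => [|z zx]; last first.
    by rewrite [x == z]eq_sym (negbTE zx) andbF mul0r.
  rewrite eqxx andbT (eq_sym y); case: eqVneq => [<-|_]; rewrite ?andbT ?andbF ?mulr0 ?mul0r//.
  by case: (out x); rewrite ?cc ?mul1r ?mul0r.
rewrite s2 {s2}.
have e1 u v : out u -> (dist o v <= m.+1)%N -> v != u -> dist u v = (dist (par u) v).+1.
  move=> /eqP ou ov vu; have [pe pd] := parP _ ou.
  exact: (@dist_parent o u (par u) v m).
have pm u : out u -> (dist o (par u) <= m)%N by move=> /eqP/parP[_ ->].
have [xo|xo] := boolP (out x); have [yo|yo] := boolP (out y);
  rewrite /= ?mul0r ?addr0.
- have -> : \sum_(i : I) r * xi i (par x) * (r * xi i (par y)) = r ^+ 2 * r ^+ dist (par x) (par y).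
    by rewrite xiP ?pm// mulr_sumr; apply: eq_bigr => i _; ring.
  have [<-|xy] := eqVneq x y; first by rewrite !dist_xx !expr0 mulr1 mul1r addrC subrK.
  rewrite mul0r addr0 (e1 x y)// 1?eq_sym// (dist_sym e_conn (par x) y e_sym).
  rewrite (e1 y (par x))// ?(leq_trans (pm _ xo))//; last first.
    by apply: contraTneq yo => <-; rewrite /out; have /eqP/parP[_ ->] := xo; rewrite ltn_eqF.
  by rewrite (dist_sym e_conn (par y)) // -exprD add2n.
- have xy : y != x by apply: contraNneq yo => ->.
  rewrite eq_sym (negbTE xy) mul0r addr0 (e1 x y)// exprS xiP ?pm ?outP//.
  by rewrite mulr_sumr; apply: eq_bigr => i _; ring.
- have xy : x != y by apply: contraNneq xo => ->.
  rewrite (dist_sym e_conn x y e_sym) (e1 y x)// exprS xiP ?pm ?outP//.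
  by rewrite mulr_sumr; apply: eq_bigr => i _; ring.
- by rewrite -xiP ?outP.
Qed.

End LargeGirth.

(** * Spectral gap and lazy random walk *)

Section Modulus.
Variable R : realType.
Implicit Type z : R[i].

Definition modulus z : R := complex.Re `|z|.

Lemma modulusE z : (modulus z)%:C%C = `|z|. Proof. exact: Re_normCE. Qed.
Lemma modulus_ge0 z : 0 <= modulus z. Proof. exact: Re_normC_ge0. Qed.
Lemma modulus_real (t : R) : modulus t%:C%C = `|t|. Proof. exact: Re_normC_real. Qed.
Lemma modulusM z z' : modulus (z * z') = modulus z * modulus z'.
Proof. by apply: (@complexI R); rewrite rmorphM !modulusE normrM. Qed.
Lemma normC2 z : z * z^* = (modulus z ^+ 2)%:C%C.
Proof. by rewrite -normCK -modulusE -rmorphXn. Qed.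

End Modulus.

Section LaplacianSpectrum.
Local Open Scope sesquilinear_scope.
Variables (R : realType) (T : finType) (e : rel T).
Hypothesis e_sym : symmetric e.
Hypothesis e_irr : irreflexive e.
Hypothesis e_conn : forall x y, connect e x y.
Variables (D : nat) (c : R).
Hypothesis degD : forall x, (degree e x <= D)%N.
Hypothesis c0 : 0 < c.
Hypothesis gap : forall z, eigenvalue (laplacian R e) z -> z = 0 \/ c%:C%C <= z.

Local Notation C := R[i].
Local Notation N := #|T|.
Local Notation "t %:K" := (t%:C%C : C) (at level 2, format "t %:K").

Lemma degree_sum (A : pzSemiRingType) (x : T) :
  (degree e x)%:R = \sum_(y : T) (e x y)%:R :> A.
Proof.
rewrite /degree -sum1_card natr_sum big_mkcond /=; apply: eq_bigr => y _.
by rewrite inE; case: (e x y).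
Qed.

Lemma sum_enum (V : nmodType) (F : T -> V) : \sum_(i < N) F (enum_val i) = \sum_(x : T) F x.
Proof. by rewrite -(big_enum_val F). Qed.

(** The spectral theorem, with the eigenvectors read as functions on the
    vertices. *)
Lemma laplacian_eigenbasis : exists (lam : 'I_N -> R) (v : 'I_N -> T -> C),
  [/\ forall x y, \sum_(i < N) v i x * (v i y)^* = (x == y)%:R,
      forall i j, \sum_(x : T) v i x * (v j x)^* = (i == j)%:R,
      forall i, lam i = 0 \/ c <= lam i &
      forall i x, \sum_(y : T) (e x y)%:R * v i y = ((degree e x)%:R - (lam i)%:K) * v i x].
Proof.
pose A := laplacian R e.
have AE : A ^t* = A.
  apply/matrixP => i j; rewrite !mxE (eq_sym j) e_sym.
  case: eqP => [->|_]; first by rewrite conjC_nat.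
  by rewrite rmorphN rmorph_nat.
have Anormal : A \is normalmx by apply/normalmxP; rewrite AE.
have /orthomx_spectralP AP := Anormal.
set P := spectralmx A in AP; set sp := spectral_diag A in AP.
have Pu : P \is unitarymx by exact: spectral_unitarymx.
have PP : P *m P ^t* = 1%:M by apply/unitarymxP.
have PP' : P ^t* *m P = 1%:M by rewrite -(invmx_unitary Pu) mulVmx// unitarymx_unit.
have PA : P *m A = diag_mx sp *m P.
  by rewrite {1}AP !mulmxA mulmxV ?mul1mx// unitarymx_unit.
have ev i : eigenvalue A (sp 0 i).
  apply/eigenvalueP; exists (row i P).
    by rewrite -row_mul PA mul_diag_mx; apply/rowP => k; rewrite !mxE.
  apply/negP => /eqP P0; have := congr1 (fun M : 'M[C]_(#|T|) => M i i) PP.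
  rewrite !mxE eqxx big1 => [/eqP|k _]; first by rewrite eq_sym oner_eq0.
  by have := congr1 (fun M : 'rV[C]_(#|T|) => M 0 k) P0; rewrite !mxE => ->; rewrite mul0r.
have lamP i : exists l : R, sp 0 i = l%:K /\ (l = 0 \/ c <= l).
  have [->|] := gap (ev i); first by exists 0; split=> //; left.
  case: (sp 0 i) => a b; rewrite lecE /= => /andP[/eqP -> ca].
  by exists a; split=> //; right.
have /choice[lam lamE] := lamP.
exists lam, (fun i x => P i (enum_rank x)); split.
- move=> x y; have := congr1 (fun M : 'M[C]_(#|T|) => M (enum_rank y) (enum_rank x)) PP'.
  rewrite !mxE (inj_eq enum_rank_inj) eq_sym => <-.
  by apply: eq_bigr => i _; rewrite !mxE mulrC.
- move=> i j; have := congr1 (fun M : 'M[C]_(#|T|) => M i j) PP.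
  rewrite !mxE => <-; rewrite -sum_enum; apply: eq_bigr => k _.
  by rewrite !mxE enum_valK.
- by move=> i; case: (lamE i).
- move=> i x; have [spE _] := lamE i.
  have := congr1 (fun M : 'M[C]_(#|T|) => M i (enum_rank x)) PA.
  rewrite mul_diag_mx !mxE spE mulrBl => <-.
  rewrite -(sum_enum (fun y => (e x y)%:R * P i (enum_rank y))).
  rewrite (bigD1 (enum_rank x))//= [in RHS](bigD1 (enum_rank x))//=.
  rewrite !mxE eqxx enum_rankK e_irr mul0r add0r mulrC opprD addrA subrr add0r.
  rewrite -sumrN; apply: eq_bigr => k kx.
  by rewrite !mxE (negbTE kx) enum_valK enum_rankK e_sym mulrN opprK mulrC.
Qed.

(** The maximum principle: the set where the maximum is attained is closed under
    passing to neighbours. *)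
Lemma harmonic_const (f : T -> R) :
  (forall x, \sum_(y : T) (e x y)%:R * f y = (degree e x)%:R * f x) ->
  forall x y, f x = f y.
Proof.
move=> fh.
suff [m mP] : exists m, forall y, f y = m by move=> x y; rewrite !mP.
have [T0|/card_gt0P[x0 _]] := posnP #|T|.
  by exists 0 => y; have := max_card (pred1 y); rewrite T0 card1.
have [m _ mmax] := @arg_maxP _ _ _ x0 xpredT f isT.
have step y z : e y z -> f y = f m -> f z = f m.
  move=> yz fy; have : \sum_(w : T) (e y w)%:R * (f y - f w) = 0.
    under eq_bigr do rewrite mulrBr.
    rewrite sumrB fh -mulr_suml.
    by rewrite -degree_sum subrr.
  move=> /psumr_eq0P => /(_ _ z isT); rewrite yz mul1r fy => h.
  apply/esym/subr0_eq/h => w _; rewrite mulr_ge0 ?ler0n// subr_ge0.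
  exact: mmax.
exists (f m) => y; have /connectP[p ep ->] := e_conn m y.
have walk u : f u = f m -> path e u p -> f (last u p) = f m.
  elim: p u {ep} => //= a p IH u fu /andP[ua ap].
  by apply: IH => //; exact: step ua fu.
exact: walk.
Qed.

(** The lazy walk operator [1 - Laplacian / K]. *)
Definition lazy_step (K : R) (x y : T) : R :=
  (x == y)%:R * (1 - (degree e x)%:R / K) + (e x y)%:R / K.

Fixpoint lazy_walk (K : R) (n : nat) (x y : T) : R :=
  if n is m.+1 then \sum_(z : T) lazy_step K x z * lazy_walk K m z y else (x == y)%:R.

Lemma lazy_step_far K x y : (1 < dist e_conn x y)%N -> lazy_step K x y = 0.
Proof.
move=> xy; rewrite /lazy_step; case: eqVneq xy => [->|_ xy]; first by rewrite dist_xx.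
rewrite mul0r add0r; case: (boolP (e x y)) => [exy|_]; last by rewrite mul0r.
by move: (dist_edge e_conn exy); rewrite leqNgt xy.
Qed.

Lemma lazy_walk_far K n x y : (n < dist e_conn x y)%N -> lazy_walk K n x y = 0.
Proof.
elim: n x => [|n IH] x xy /=.
  by case: eqVneq xy => // ->; rewrite dist_xx.
apply: big1 => z _; have [xz|xz] := ltnP 1 (dist e_conn x z).
  by rewrite lazy_step_far// mul0r.
rewrite IH ?mulr0//; have := dist_triangle e_conn x z y; clear degD c0 gap; lia.
Qed.

(** The spectrum of [M = 1 - Laplacian / K] consists of [1] and of numbers between
    [0] and [1 - c / K], and there [(K / c) t + 1 - t ^ n] takes values between
    [0] and [K / c]. Thus subtracting [M ^ n], which is almost the projection onto
    the constants, makes room for the summand [1]. *)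
Definition gap_kernel (K : R) (n : nat) (x y : T) : R :=
  K / c * lazy_step K x y + (x == y)%:R - lazy_walk K n x y.

Section Walk.
Variable K : R.
Hypotheses (KD : 2 * D%:R + 1 <= K) (cK : c <= K).

Let K0 : 0 < K. Proof. by apply: lt_le_trans KD; rewrite ltr_wpDl// mulr_ge0. Qed.

Lemma lazy_step_ge0 x y : 0 <= lazy_step K x y.
Proof.
rewrite addr_ge0 ?mulr_ge0 ?ler0n ?invr_ge0 ?(ltW K0)//.
have : (degree e x)%:R <= D%:R :> R by rewrite ler_nat.
have := ler0n R D; have := KD; rewrite subr_ge0 ler_pdivrMr// mul1r; lra.
Qed.

Lemma lazy_step_sum x : \sum_(y : T) lazy_step K x y = 1.
Proof.
rewrite big_split /= -!mulr_suml -degree_sum (bigD1 x)//= eqxx big1 => [|y yx].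
  by rewrite addr0 mul1r subrK.
by rewrite eq_sym (negbTE yx).
Qed.

Lemma lazy_walk_ge0 n x y : 0 <= lazy_walk K n x y.
Proof.
elim: n x => [|n IH] x /=; first exact: ler0n.
by apply: sumr_ge0 => z _; rewrite mulr_ge0 ?lazy_step_ge0.
Qed.

Lemma lazy_walk_sum n x : \sum_(y : T) lazy_walk K n x y = 1.
Proof.
elim: n x => [|n IH] x /=.
  by rewrite (bigD1 x)//= eqxx big1 ?addr0// => y yx; rewrite eq_sym (negbTE yx).
rewrite exchange_big /= -(lazy_step_sum x); apply: eq_bigr => z _.
by rewrite -mulr_sumr IH mulr1.
Qed.

Section Eigenbasis.
Variables (lam : 'I_N -> R) (v : 'I_N -> T -> C).
Hypothesis v_complete : forall x y, \sum_(i < N) v i x * (v i y)^* = (x == y)%:R.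
Hypothesis v_ortho : forall i j, \sum_(x : T) v i x * (v j x)^* = (i == j)%:R.
Hypothesis lamP : forall i, lam i = 0 \/ c <= lam i.
Hypothesis v_eigen : forall i x,
  \sum_(y : T) (e x y)%:R * v i y = ((degree e x)%:R - (lam i)%:K) * v i x.

Let mu i := 1 - lam i / K.

Definition acts_diagonally (A : T -> T -> R) (a : 'I_N -> R) :=
  forall i x, \sum_(y : T) (A x y)%:K * v i y = (a i)%:K * v i x.

Lemma diagonal_step : acts_diagonally (lazy_step K) mu.
Proof.
move=> i x; under eq_bigr => y _ do rewrite rmorphD mulrDl.
rewrite big_split /= (bigD1 x)//= eqxx mul1r big1 ?addr0; last first.
  by move=> y yx; rewrite eq_sym (negbTE yx) !mul0r.
under eq_bigr => y _ do rewrite rmorphM rmorph_nat /= mulrAC.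
rewrite -mulr_suml v_eigen /mu !rmorphB !rmorphM rmorph1 rmorph_nat !fmorphV.
by ring.
Qed.

Lemma diagonal_walk n : acts_diagonally (lazy_walk K n) (fun i => mu i ^+ n).
Proof.
elim: n => [|n IH] i x /=.
  rewrite expr0 mul1r (bigD1 x)//= eqxx mul1r big1 ?addr0// => y yx.
  by rewrite eq_sym (negbTE yx) mul0r.
under eq_bigr => y _ do rewrite rmorph_sum mulr_suml.
rewrite exchange_big /=.
under eq_bigr => z _ do under eq_bigr => y _ do rewrite rmorphM -mulrA.
under eq_bigr => z _ do rewrite -mulr_sumr IH mulrCA.
by rewrite -mulr_sumr diagonal_step mulrA -rmorphM exprSr.
Qed.

Lemma diagonal_entry A a x y : acts_diagonally A a ->
  (A x y)%:K = \sum_(i < N) (a i)%:K * v i x * (v i y)^*.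
Proof.
move=> Aa; transitivity (\sum_(z : T) (A x z)%:K * \sum_(i < N) v i z * (v i y)^*).
  rewrite (bigD1 y)//= v_complete eqxx mulr1 big1 ?addr0// => z zy.
  by rewrite v_complete (negbTE zy) mulr0.
under eq_bigr => z _ do rewrite mulr_sumr.
rewrite exchange_big /=; apply: eq_bigr => i _.
by rewrite -Aa mulr_suml; apply: eq_bigr => z _; rewrite mulrA.
Qed.

Lemma diagonal_norm A a (M : R) (f : T -> C) : acts_diagonally A a ->
  (forall i, `|a i| <= M) ->
  \sum_(x : T) modulus (\sum_(y : T) (A x y)%:K * f y) ^+ 2 <=
    M ^+ 2 * \sum_(x : T) modulus (f x) ^+ 2.
Proof.
move=> Aa aM; pose g i := \sum_(y : T) (v i y)^* * f y.
have AfE x : \sum_(y : T) (A x y)%:K * f y = \sum_(i < N) (a i)%:K * v i x * g i.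
  under [RHS]eq_bigr => i _ do rewrite mulr_sumr.
  rewrite exchange_big /=; apply: eq_bigr => y _.
  by rewrite (diagonal_entry x y Aa) mulr_suml; apply: eq_bigr => i _; rewrite mulrA.
have parseval (h : 'I_N -> C) : \sum_(x : T) modulus (\sum_(i < N) v i x * h i) ^+ 2 =
    \sum_(i < N) modulus (h i) ^+ 2.
  apply: (@complexI R); rewrite !rmorph_sum /=.
  under eq_bigr => x _ do rewrite -normC2 rmorph_sum /= big_distrlr.
  rewrite exchange_big /=; apply: eq_bigr => i _; rewrite exchange_big /=.
  rewrite -normC2 (bigD1 i)//= [X in _ + X]big1 ?addr0.
    transitivity (h i * (h i)^* * \sum_(x : T) v i x * (v i x)^*).
      by rewrite mulr_sumr; apply: eq_bigr => x _; rewrite rmorphM /=; ring.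
    by rewrite v_ortho eqxx mulr1.
  move=> j ji; transitivity (h i * (h j)^* * \sum_(x : T) v i x * (v j x)^*).
    by rewrite mulr_sumr; apply: eq_bigr => x _; rewrite rmorphM /=; ring.
  by rewrite v_ortho eq_sym (negbTE ji) mulr0.
have fE x : f x = \sum_(i < N) v i x * g i.
  under eq_bigr => i _ do rewrite mulr_sumr.
  rewrite exchange_big /= (bigD1 x)//= [X in _ + X]big1 ?addr0 => [|y yx].
    under eq_bigr => i _ do rewrite mulrA.
    by rewrite -mulr_suml v_complete eqxx mul1r.
  under eq_bigr => i _ do rewrite mulrA.
  by rewrite -mulr_suml v_complete eq_sym (negbTE yx) mul0r.
under eq_bigr => x _ do rewrite AfE.
under [in leRHS]eq_bigr => x _ do rewrite fE.
rewrite parseval.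
under eq_bigr => x _ do (under eq_bigr => i _ do rewrite mulrAC mulrC).
rewrite parseval mulr_sumr; apply: ler_sum => i _.
rewrite modulusM modulus_real.
by rewrite exprMn ler_wpM2r ?sqr_ge0// lerXn2r ?nnegrE// (le_trans _ (aM i)).
Qed.

(** Compare both sides of the eigenvalue equation where the eigenvector is
    largest. *)
Lemma lam_le i : lam i <= 2 * D%:R.
Proof.
have [x vx] : exists x, v i x != 0.
  apply/existsP; rewrite -negb_forall; apply/negP => /forallP v0.
  have := v_ortho i i; rewrite eqxx big1 => [/eqP|x _]; first by rewrite eq_sym oner_eq0.
  by rewrite (eqP (v0 x)) mul0r.
have [m _ mmax] := @arg_maxP _ _ _ x xpredT (fun y => modulus (v i y)) isT.
have vm : 0 < modulus (v i m).
  apply: lt_le_trans (mmax x isT); rewrite lt_def modulus_ge0 andbT.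
  by apply: contra vx => /eqP vx0; rewrite -normr_eq0 -modulusE vx0.
have := v_eigen i m => /(congr1 (fun z : C => `|z|)) E.
have : `|\sum_(y : T) (e m y)%:R * v i y| <= ((degree e m)%:R * modulus (v i m))%:K.
  rewrite (le_trans (ler_norm_sum _ _ _))//.
  rewrite degree_sum mulr_suml rmorph_sum; apply: ler_sum => y _.
  rewrite normrM normr_nat rmorphM rmorph_nat ler_wpM2l ?ler0n//.
  by rewrite -modulusE lecR; exact: mmax.
rewrite E normrM -(modulusE (v i m)).
have -> : (degree e m)%:R - (lam i)%:K = ((degree e m)%:R - lam i)%:K.
  by rewrite rmorphB rmorph_nat.
rewrite -(modulusE _%:K) modulus_real -rmorphM lecR ler_pM2r// ler_norml => /andP[+ _].
have : (degree e m)%:R <= D%:R :> R by rewrite ler_nat.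
lra.
Qed.

Lemma mu01 i : 0 <= mu i <= 1.
Proof.
rewrite /mu; have := lam_le i; have li : 0 <= lam i.
  by case: (lamP i) => [->//|]; apply: le_trans; exact: ltW.
move=> ll; apply/andP; split; last by rewrite gerBl divr_ge0// ltW.
by rewrite subr_ge0 ler_pdivrMr// mul1r; have := KD; lra.
Qed.

Lemma mu_gap i : lam i != 0 -> mu i <= 1 - c / K.
Proof.
by case: (lamP i) => [->|ci _]; rewrite ?eqxx// lerD2l lerN2 ler_pM2r ?invr_gt0.
Qed.

(** The kernel of the Laplacian is spanned by the constants, which contribute
    [1 / N] to each entry; on the other eigenvectors the walk decays at the rate
    [1 - c / K], and their total contribution is bounded by Cauchy-Schwarz. *)
Lemma walk_entry n x y : lazy_walk K n x y <= N%:R^-1 + (1 - c / K) ^+ n.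
Proof.
pose w i x := modulus (v i x).
have w0 i z : 0 <= w i z by exact: modulus_ge0.
have w1 z : \sum_(i < N) w i z ^+ 2 = 1.
  have E := v_complete z z; rewrite eqxx in E.
  apply: (@complexI R); rewrite rmorph_sum rmorph1 -[RHS]E.
  by apply: eq_bigr => i _; rewrite normC2.
have le1 : lazy_walk K n x y <= \sum_(i < N) mu i ^+ n * (w i x * w i y).
  rewrite (le_trans (ler_norm _))// -lecR -modulus_real modulusE.
  rewrite (diagonal_entry x y (diagonal_walk n)) (le_trans (ler_norm_sum _ _ _))//.
  rewrite rmorph_sum /=; apply: ler_sum => i _; rewrite !normrM norm_conjC.
  have -> : (mu i ^+ n * (w i x * w i y))%:K = (mu i ^+ n)%:K * (`|v i x| * `|v i y|).
    by rewrite -!modulusE -!rmorphM.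
  rewrite -mulrA ler_wpM2r ?mulr_ge0//.
  rewrite -(modulusE _%:K) modulus_real lecR ger0_norm// exprn_ge0//.
  by case/andP: (mu01 i).
apply: le_trans le1 _; rewrite (bigID (fun i => lam i == 0))/=.
have N0 : (0 < N)%N by apply/card_gt0P; exists x.
have cst i : lam i = 0 -> forall z z', v i z = v i z'.
  move=> li z z'; have hE u : \sum_(y : T) (e u y)%:R * v i y = (degree e u)%:R * v i u.
    by rewrite v_eigen li subr0.
  have pr (p : C -> R) : {morph p : a b / a + b} -> p 0 = 0 ->
      (forall k a, p (k%:R * a) = k%:R * p a) -> p (v i z) = p (v i z').
    move=> pD p0 pM; apply: (@harmonic_const (p \o v i)) => u /=.
    rewrite -pM -hE (big_morph p pD p0).
    by apply: eq_bigr => t _; rewrite pM.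
  have natK k (a : C) : k%:R * a = k%:R%:K * a by rewrite rmorph_nat.
  have re : complex.Re (v i z) = complex.Re (v i z').
    by apply: pr => [[? ?] [? ?]||k [a b]]//; rewrite natK /= mul0r subr0.
  have im : complex.Im (v i z) = complex.Im (v i z').
    by apply: pr => [[? ?] [? ?]||k [a b]]//; rewrite natK /= mul0r addr0.
  by apply/eqP; rewrite eq_complex re im !eqxx.
apply: lerD.
  have ww i : lam i = 0 -> w i x * w i y = N%:R^-1.
    move=> li; have := v_ortho i i; rewrite eqxx.
    under eq_bigr => z _ do rewrite normC2 (cst i li z x).
    rewrite sumr_const -rmorphMn /= => /(@complexI R _ 1).
    rewrite /w (cst i li y x) -expr2 -mulr_natr => h.
    by apply: (@mulIf _ N%:R); rewrite ?pnatr_eq0 -?lt0n// h mulVf// pnatr_eq0 -lt0n.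
  have uni i j : lam i = 0 -> lam j = 0 -> i = j.
    move=> li lj; apply/eqP/negPn/negP => ij.
    have := v_ortho i j; rewrite (negbTE ij).
    under eq_bigr => z _ do rewrite (cst i li z x) (cst j lj z x).
    rewrite sumr_const => /eqP; rewrite mulrn_eq0 mulf_eq0 conjC_eq0.
    have nz k : lam k = 0 -> v k x != 0.
      move=> lk; apply/eqP => vk; have := ww k lk.
      have -> : w k x = 0 by rewrite /w vk /modulus normr0.
      rewrite mul0r => /esym/eqP.
      by rewrite invr_eq0 pnatr_eq0 -leqn0 leqNgt N0.
    rewrite (negbTE (nz i li)) (negbTE (nz j lj)) !orbF => T0.
    by move: N0; rewrite lt0n => /negP; apply.
  have [/existsP[i /eqP li]|no] := boolP [exists i, lam i == 0].
    rewrite (bigD1 i) ?li//= big1 ?addr0 => [|j /andP[/eqP lj ji]].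
      by rewrite ww// /mu li mul0r subr0 expr1n mul1r.
    by move: ji; rewrite (uni j i lj li) eqxx.
  rewrite big1 ?invr_ge0// => i /eqP li.
  by move: no; rewrite negb_exists => /forallP/(_ i); rewrite li eqxx.
have rho0 : 0 <= 1 - c / K by rewrite subr_ge0 ler_pdivrMr// mul1r.
have : \sum_(i | lam i != 0) mu i ^+ n * (w i x * w i y) <=
    \sum_(i < N) (1 - c / K) ^+ n * (2^-1 * (w i x ^+ 2 + w i y ^+ 2)).
  rewrite big_mkcond; apply: ler_sum => i _.
  have am : 0 <= w i x * w i y <= 2^-1 * (w i x ^+ 2 + w i y ^+ 2).
    by rewrite mulr_ge0//=; have := sqr_ge0 (w i x - w i y); lra.
  case: ifPn => li; last by rewrite mulr_ge0 ?exprn_ge0//; case/andP: am; lra.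
  case/andP: am => am0 am1; rewrite ler_pM ?exprn_ge0//; first by case/andP: (mu01 i).
  rewrite lerXn2r ?nnegrE//; first by case/andP: (mu01 i).
  exact: mu_gap.
move=> /le_trans; apply.
rewrite -!mulr_sumr big_split /= !w1 (_ : 2^-1 * (1 + 1) = 1 :> R) ?mulr1//.
by field.
Qed.

Lemma diagonal_gap n :
  acts_diagonally (gap_kernel K n) (fun i => K / c * mu i + 1 - mu i ^+ n).
Proof.
move=> i x; under eq_bigr => y _.
  rewrite rmorphB rmorphD rmorphM /= !mulrBl mulrDl -mulrA; over.
rewrite sumrB big_split /= -mulr_sumr diagonal_step diagonal_walk.
rewrite (bigD1 x)//= eqxx mul1r big1 ?addr0 => [|y yx]; last first.
  by rewrite eq_sym (negbTE yx) mul0r.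
move: (K / c) (mu i ^+ n) (mu i) => k t u.
by rewrite rmorphB rmorphD rmorphM rmorph1; ring.
Qed.

Lemma gap_bound n i : `|K / c * mu i + 1 - mu i ^+ n| <= K / c.
Proof.
have /andP[m0 m1] := mu01 i.
have mn1 : mu i ^+ n <= 1 by rewrite exprn_ile1.
have mn0 : 0 <= mu i ^+ n by rewrite exprn_ge0.
have Kc : 0 <= K / c by rewrite divr_ge0// ltW.
have km : 0 <= K / c * mu i by rewrite mulr_ge0.
rewrite ger0_norm; last lra.
have [li|li] := eqVneq (lam i) 0.
  by rewrite /mu li mul0r subr0 expr1n mulr1 addrK.
have : K / c * mu i <= K / c * (1 - c / K) by rewrite ler_wpM2l// mu_gap.
have -> : K / c * (1 - c / K) = K / c - 1 by field; rewrite !gt_eqF.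
lra.
Qed.

End Eigenbasis.

Lemma lazy_walk_le n x y : lazy_walk K n x y <= N%:R^-1 + (1 - c / K) ^+ n.
Proof. by have [lam [v [h1 h2 h3 h4]]] := laplacian_eigenbasis; exact: walk_entry h1 h2 h3 h4 _ _ _. Qed.

Lemma gap_kernel_norm n (f : T -> C) :
  \sum_(x : T) modulus (\sum_(y : T) (gap_kernel K n x y)%:K * f y) ^+ 2 <=
    (K / c) ^+ 2 * \sum_(x : T) modulus (f x) ^+ 2.
Proof.
have [lam [v [h1 h2 h3 h4]]] := laplacian_eigenbasis.
apply: (diagonal_norm h1 h2 f (diagonal_gap h4 n)) => i.
exact: (gap_bound h2 h3 h4).
Qed.

End Walk.
End LaplacianSpectrum.

(** * Kernels as elements of the crossed product *)

Section KernelElement.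
Variables (R : realType) (G : groupType) (P : choiceType) (i : P -> G).
Hypothesis i_inj : injective i.
Variable Q : P -> P -> R.
Variable M : R.
Hypothesis QM : forall p q, `|Q p q| <= M.
Variable r : seq G.
Hypothesis Qr : forall p q, Q p q != 0 -> ((i p)^-1 * i q)%g \in r.

Definition locate (g : G) : option P :=
  if pselect (exists p, i p = g) is left pg then Some (projT1 (cid pg)) else None.

Lemma locateK p : locate (i p) = Some p.
Proof.
rewrite /locate; case: pselect => [pg|[]]; last by exists p.
by case: cid => q /= /i_inj ->.
Qed.

Lemma locate_some g p : locate g = Some p -> i p = g.
Proof. by rewrite /locate; case: pselect => // pg [<-]; case: cid. Qed.

Definition kernel_value (g h : G) : R :=
  if locate g is Some p then (if locate h is Some q then Q p q else 0) else 0.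

Lemma kernel_bounded (s : G) :
  (fun g => (kernel_value g^-1 (g^-1 * s))%:C%C) \in @bounded_fct R G.
Proof.
apply/asboolP; exists (Num.max 0 M) => g.
rewrite -(Re_normCE (_%:C%C)) Re_normC_real lecR le_max /kernel_value.
case: (locate g^-1) => [p|]; last by rewrite normr0 lexx.
by case: (locate (g^-1 * s)) => [q|]; rewrite ?QM ?normr0 ?lexx ?orbT.
Qed.

(** The element of the algebraic crossed product whose matrix has the entry
    [Q p q] in the row of [(i p)^-1] and the column of [(i q)^-1]. *)
Definition kernel_elt (s : G) : linf R G := Linf (kernel_bounded s).

Lemma kernel_eltE p q :
  kernel_elt ((i p)^-1 * i q)%g (i p)^-1%g = (Q p q)%:C%C.
Proof. by rewrite /= invgK mulVKg /kernel_value !locateK. Qed.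

Lemma kernel_elt_supp s : kernel_elt s != 0 -> s \in r.
Proof.
apply: contraNT => sr; apply/eqP/linfP => g /=.
rewrite /kernel_value; case pE : locate => [p|//]; case qE : locate => [q|//].
have [->//|/Qr] := eqVneq (Q p q) 0.
by rewrite (locate_some pE) (locate_some qE) invgK mulVKg (negbTE sr).
Qed.

Lemma kernel_elt_Cc : Cc kernel_elt.
Proof. exact: (seq_fsupp kernel_elt_supp). Qed.

Lemma linf_sum (I : Type) (s : seq I) (F : I -> linf R G) g :
  (\sum_(k <- s) F k) g = \sum_(k <- s) F k g.
Proof. exact: (big_morph (fun f : linf R G => f g)). Qed.

(** The norm of the [l^oo(G)]-valued inner product is the supremum over [g] of the
    square norms of the evaluations at [g]. *)
Lemma l2_norm_pointwise (f : G -> linf R G) (s : seq G) (C : R) : uniq s ->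
  (forall t, f t != 0 -> t \in s) -> 0 <= C ->
  (forall g, \sum_(t <- s) modulus (f t g) ^+ 2 <= C ^+ 2) <-> l2_norm f <= C.
Proof.
move=> us fs C0; rewrite /l2_norm (fsum_seq us); last first.
  by move=> t /cmul_neq0r /fs.
have E g : (\sum_(t <- s) (f t)^# ** f t) g = (\sum_(t <- s) modulus (f t g) ^+ 2)%:C%C.
  by rewrite linf_sum rmorph_sum; apply: eq_bigr => t _; rewrite /= mulrC normC2.
have s0 g : 0 <= \sum_(t <- s) modulus (f t g) ^+ 2.
  by apply: sumr_ge0 => t _; exact: sqr_ge0.
have CE : C = Num.sqrt (C ^+ 2) by rewrite sqrtr_sqr ger0_norm.
set F := \sum_(t <- s) _; rewrite [X in _ <-> _ <= X]CE ler_sqrt ?sqr_ge0//.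
split=> [h|h g].
  rewrite -lecR rnormE linf_normE lecR; apply: sup_norm_leC; first exact: sqr_ge0.
  by move=> g; rewrite /F E -(Re_normCE _%:C%C) Re_normC_real lecR ger0_norm.
have := norm_le_sup F g; rewrite -linf_normE -rnormE /F E.
by rewrite -(Re_normCE _%:C%C) Re_normC_real lecR ger0_norm// => /le_trans; apply.
Qed.

(** Evaluated at a point [x] of [G], the regular representation acts on [l^2(G)]
    by the matrix [Q] if the coordinate [g] is labelled by the [p] with
    [i p = (g x)^-1], and by zero on the coordinates without a label. *)
Lemma kernel_red_norm (C : R) : 0 <= C ->
  (forall (s t : seq P) (f : P -> R[i]), uniq s -> uniq t ->
    \sum_(p <- t) modulus (\sum_(q <- s) (Q p q)%:C%C * f q) ^+ 2 <=
      C ^+ 2 * \sum_(q <- s) modulus (f q) ^+ 2) ->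
  (red_norm (@ltrans R G) kernel_elt <= C%:E)%E.
Proof.
move=> C0 QC; apply: ge_ereal_sup => _ [xi [cxi xi1] <-]; rewrite lee_fin.
have /fsuppP[rx urx xr] := cxi.
set eta := regular_rep _ _ _.
pose ru := undup r.
have etaE g : eta g = \sum_(h <- ru) ltrans g^-1%g (kernel_elt h) ** xi (h^-1 * g)%g.
  rewrite /eta /regular_rep (fsum_seq (undup_uniq r))// => h /cmul_neq0l hn.
  rewrite mem_undup; apply: kernel_elt_supp; apply: contraNneq hn => ->.
  by rewrite (act0 (@ltrans_action R G)).
pose re := undup [seq (h * t)%g | h <- ru, t <- rx].
have etar g : eta g != 0 -> g \in re.
  rewrite etaE; apply: contraNT; rewrite mem_undup => gn.
  rewrite big1_seq// => h /andP[_ hr]; apply/eqP/negPn/negP => /cmul_neq0r/xr hg.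
  by move/allpairsP: gn; apply; exists (h, (h^-1 * g)%g); rewrite /= mulVKg.
apply/(l2_norm_pointwise (undup_uniq _) etar C0) => x.
pose f q := xi ((i q)^-1 * x^-1)%g x.
pose back q := ((i q)^-1 * x^-1)%g.
pose pt t := locate (t * x)^-1%g.
have ptK : ocancel pt back.
  move=> t; rewrite /pt /back; case pE : locate => [q|//] /=.
  by rewrite (locate_some pE) invgK mulgK.
pose s := pmap pt rx; pose t := pmap pt re.
have us : uniq s by exact: (pmap_uniq ptK).
have ut : uniq t by apply: (pmap_uniq ptK); exact: undup_uniq.
have etax g : eta g x = if pt g is Some p then \sum_(q <- s) (Q p q)%:C%C * f q else 0.
  pose F h := kernel_elt h (g * x)%g * xi (h^-1 * g)%g x.
  have -> : eta g x = \sum_(h \in [set: G]) F h.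
    rewrite etaE linf_sum (fsum_seq (undup_uniq r)).
      by apply: eq_bigr => h _; rewrite /F /= !invgK.
    move=> h; rewrite mulf_eq0 negb_or => /andP[hn _].
    by rewrite mem_undup; apply: kernel_elt_supp; apply: contraNneq hn => ->.
  rewrite (@reindex_fsbigT _ _ _ _ _ (fun u => (g * x) * u)%g); last first.
    by exists (fun u => (g * x)^-1 * u)%g => u; rewrite ?mulKg ?mulVKg.
  have FE u : F ((g * x) * u)%g = (kernel_value (g * x)^-1 u)%:C%C * xi (u^-1 * x^-1)%g x.
    have E' : ((g * x * u)^-1 * g)%g = (u^-1 * x^-1)%g by rewrite !invgM -!mulgA mulVg mulg1.
    by rewrite /F E' /= mulKg.
  rewrite (@fsum_seq _ _ _ (map i s)); last 2 first.
  - by rewrite map_inj_uniq.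
  - move=> u; rewrite FE mulf_eq0 negb_or => /andP[kn xn].
    have [q pq] : exists q, locate u = Some q.
      move: kn; rewrite /kernel_value; case: (locate (g * x)^-1) => [p|]; last by rewrite eqxx.
      by case: (locate u) => [q|]; [exists q|rewrite eqxx].
    rewrite -(locate_some pq); apply: map_f; rewrite mem_pmap; apply/mapP.
    exists (u^-1 * x^-1)%g; last by rewrite /pt mulgVK invgK pq.
    by apply: xr; apply: contraNneq xn => ->.
  rewrite big_map; under eq_bigr => q _ do rewrite FE /kernel_value locateK.
  rewrite /pt; case: (locate (g * x)^-1) => [p|]; first by [].
  by rewrite big1// => q _; rewrite mul0r.
have -> : \sum_(g <- re) modulus (eta g x) ^+ 2 =
    \sum_(p <- t) modulus (\sum_(q <- s) (Q p q)%:C%C * f q) ^+ 2.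
  rewrite [RHS](big_pmap pt); apply: eq_bigr => g _; rewrite etax.
  by case: (pt g) => [p|] //=; rewrite /modulus normr0 expr0n.
rewrite (le_trans (QC _ _ _ us ut))// -[leRHS]mulr1 ler_wpM2l ?sqr_ge0//.
have := (l2_norm_pointwise urx xr ler01).2 xi1 x; rewrite expr1n; apply: le_trans.
rewrite big_pmap; apply: ler_sum => u _; have := ptK u.
by case: (pt u) => [q|] /= bq; rewrite ?sqr_ge0// /f -/(back q) bq.
Qed.

End KernelElement.

(** * Words and averages over the graphs *)

Section Words.
Variables (R : realType) (G : groupType) (S : seq G).
Hypothesis S_gen : generates S.

Lemma word_metricM (z g h : G) : word_metric R S (z * g)%g (z * h)%g = word_metric R S g h.
Proof.
rewrite /word_metric; congr (inf (image _ _)); apply/seteqP.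
split=> w /= [Sw E]; split=> //; last by rewrite E mulgA.
by apply: (mulgI z); rewrite E mulgA.
Qed.

Fixpoint word_ball (m : nat) : seq G :=
  if m is n.+1 then
    word_ball n ++ [seq (s * g)%g | s <- S ++ map (fun s => s^-1)%g S, g <- word_ball n]
  else [:: 1%g].

Lemma mem_word_ball (w : seq G) m : is_word S w -> (size w <= m)%N ->
  (\big[*%g/1]_(s <- w) s)%g \in word_ball m.
Proof.
elim: m w => [|m IH] [|s w] Sw //=.
- by rewrite big_nil inE.
- by move=> _; rewrite mem_cat IH.
rewrite ltnS => wm; rewrite mem_cat big_cons; apply/orP; right.
apply/allpairsP; exists (s, (\big[*%g/1]_(s <- w) s)%g); split=> //=; last first.
  by apply: IH => // t tw; apply: Sw; rewrite in_cons tw orbT.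
rewrite mem_cat; have /orP[->//|sS] := Sw s (mem_head _ _).
by apply/orP; right; apply/mapP; exists s^-1%g; rewrite ?invgK.
Qed.

(** The infimum defining the metric is attained up to an error less than one,
    hence by a word of length at most [l]. *)
Lemma word_metric_ball (g h : G) (l m : nat) : word_metric R S g h = l%:R ->
  (l <= m)%N -> (g^-1 * h)%g \in word_ball m.
Proof.
move=> ghl lm; pose W := [set ((size w)%:R : R) | w in
   [set w | is_word S w /\ h = (g * \big[*%g/1]_(s <- w) s)%g]].
have W0 : W !=set0.
  have [w Sw wE] := S_gen (g^-1 * h)%g.
  by exists (size w)%:R, w => //; split=> //; rewrite -wE mulVKg.
have Winf : has_inf W by split=> //; exists 0 => _ [w _ <-].
have [_ [w [Sw hE] <-]] := inf_adherent (@ltr01 R) Winf.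
rewrite -[inf W]/(word_metric R S g h) ghl natr1 ltr_nat ltnS => wl.
by rewrite hE mulKg; apply: mem_word_ball => //; exact: leq_trans wl lm.
Qed.

End Words.

Section Averages.
Variables (R : realType) (T : finType) (e : rel T).
Hypothesis e_sym : symmetric e.
Hypothesis e_irr : irreflexive e.
Hypothesis e_conn : forall x y, connect e x y.
Variables (D : nat) (c K : R).
Hypothesis degD : forall x, (degree e x <= D)%N.
Hypothesis c0 : 0 < c.
Hypothesis gap : forall z, eigenvalue (laplacian R e) z -> z = 0 \/ c%:C%C <= z.
Hypotheses (KD : 2 * D%:R + 1 <= K) (cK : c <= K).
Local Notation N := #|T|.

Let K0 : 0 < K. Proof. exact: lt_le_trans cK. Qed.

Lemma ball_card x m : (\sum_(y : T) (dist e_conn x y <= m) <= D.+1 ^ m)%N.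
Proof.
elim: m => [|m IH].
  rewrite (bigD1 x)//= dist_xx big1// => y yx; rewrite leqn0.
  by apply/eqP; rewrite eqb0; apply: contraNN yx => /eqP/dist_eq0 ->.
rewrite expnSr (leq_trans _ (leq_mul IH (leqnn _)))// big_distrl /=.
have step y : ((dist e_conn x y <= m.+1) <=
    \sum_(z : T) (dist e_conn x z <= m) * ((z == y) + e z y))%N.
  have [dy|//] := boolP (dist e_conn x y <= m.+1)%N; have [p [ep pl sp]] := dist_path e_conn x y.
  have [z [dz zy]] : exists z, (dist e_conn x z <= m)%N /\ (z == y) || e z y.
    case/lastP: p ep pl sp => [_ /= xy _|p z].
      by exists x; rewrite dist_xx xy eqxx.
    rewrite rcons_path last_rcons size_rcons => /andP[ep ez] zy sz.
    exists (last x p); rewrite -zy ez orbT; split=> //.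
    by rewrite (leq_trans (dist_le e_conn ep))// -ltnS sz.
  rewrite (bigD1 z)//= dz mul1n (leq_trans _ (leq_addr _ _))//.
  by case/orP: zy => ->; rewrite // addn1.
apply: (@leq_trans (\sum_(y : T) \sum_(z : T) (dist e_conn x z <= m) * ((z == y) + e z y))%N).
  by apply: leq_sum => y _; exact: step.
rewrite exchange_big /=; apply: leq_sum => z _; rewrite -big_distrr leq_mul// big_split /=.
rewrite (bigD1 z)//= eqxx big1 ?addn0 ?add1n ?ltnS => [|y yz]; last first.
  by rewrite eq_sym (negbTE yz).
rewrite (leq_trans _ (degD z))// /degree -sum1_card [leqRHS]big_mkcond /=.
by apply: leq_sum => y _; rewrite inE; case: (e z y).
Qed.

Lemma gap_kernel_bound k x y : `|gap_kernel e c K k x y| <= K / c + 2.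
Proof.
have le1 (F : T -> R) : (forall z, 0 <= F z) -> \sum_(z : T) F z = 1 -> F y <= 1.
  by move=> F0 <-; rewrite (bigD1 y)//= lerDl sumr_ge0.
have s0 := lazy_step_ge0 degD KD x; have w0 := lazy_walk_ge0 degD KD k x.
have s1 := le1 _ s0 (lazy_step_sum e K x); have w1 := le1 _ w0 (lazy_walk_sum e K k x).
have Kc : 0 <= K / c by rewrite divr_ge0// ltW.
have ks0 : 0 <= K / c * lazy_step e K x y by rewrite mulr_ge0.
have ks1 : K / c * lazy_step e K x y <= K / c by rewrite -[leRHS]mulr1 ler_wpM2l.
have := w0 y; rewrite /gap_kernel ler_norml; case: (x == y) => /=; lra.
Qed.

Lemma gap_kernel_far k x y : (k.+1 < dist e_conn x y)%N -> gap_kernel e c K k x y = 0.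
Proof.
move=> xy; rewrite /gap_kernel (lazy_step_far K (leq_ltn_trans _ xy))//.
rewrite (lazy_walk_far K (ltnW xy)) mulr0 add0r subr0.
by case: eqVneq xy => // ->; rewrite dist_xx.
Qed.

(** A step of the walk moves by at most one, so it keeps a weight of at least
    [r]. Of the walk of [k] steps, the part outside the ball of radius [m] has
    weight at most [r ^ m], and the ball has at most [(D + 1) ^ m] points. *)
Lemma gap_kernel_average (r : R) (m k : nat) : 0 <= r <= 1 -> (0 < N)%N ->
  K / c * r + 1 - (r ^+ m + (D.+1 ^ m)%:R * (N%:R^-1 + (1 - c / K) ^+ k)) <=
  N%:R^-1 * \sum_(x : T) \sum_(y : T) r ^+ dist e_conn x y * gap_kernel e c K k x y.
Proof.
move=> /andP[r0 r1] N0; rewrite ler_pdivlMl ?ltr0n//; set v := _ + 1 - _.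
have -> : N%:R * v = \sum_(x : T) v by rewrite sumr_const mulr_natl.
apply: ler_sum => x _; rewrite {}/v; pose d y := dist e_conn x y.
have -> : \sum_(y : T) r ^+ d y * gap_kernel e c K k x y =
    K / c * (\sum_(y : T) r ^+ d y * lazy_step e K x y) + 1 -
    \sum_(y : T) r ^+ d y * lazy_walk e K k x y.
  have -> : 1 = \sum_(y : T) r ^+ d y * (x == y)%:R.
    rewrite (bigD1 x)//= /d dist_xx eqxx expr0 mulr1 big1 ?addr0// => y yx.
    by rewrite eq_sym (negbTE yx) mulr0.
  rewrite mulr_sumr -big_split -sumrB; apply: eq_bigr => y _ /=.
  by rewrite /gap_kernel; ring.
have s1 : r <= \sum_(y : T) r ^+ d y * lazy_step e K x y.
  rewrite -[leLHS]mulr1 -(lazy_step_sum e K x) mulr_sumr; apply: ler_sum => y _.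
  have [dy|dy] := leqP (d y) 1; last by rewrite (lazy_step_far K dy) !mulr0.
  rewrite ler_wpM2r ?(lazy_step_ge0 degD KD)//.
  by case: (d y) dy => [|[|//]] _; rewrite ?expr0 ?expr1.
set b := N%:R^-1 + _.
have w1 : \sum_(y : T) r ^+ d y * lazy_walk e K k x y <= r ^+ m + (D.+1 ^ m)%:R * b.
  have b0 : 0 <= b.
    rewrite addr_ge0 ?invr_ge0// exprn_ge0// subr_ge0 ler_pdivrMr// mul1r//.
  have wb y : lazy_walk e K k x y <= b by exact: (lazy_walk_le e_sym e_irr e_conn degD c0 gap KD cK).
  have w0 y := lazy_walk_ge0 degD KD k x y.
  apply: le_trans (_ : \sum_(y : T) (r ^+ m * lazy_walk e K k x y + (d y <= m)%N%:R * b) <= _).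
    apply: ler_sum => y _; have [dy|dy] := leqP.
      rewrite mul1r ler_wpDl ?mulr_ge0 ?exprn_ge0// (le_trans _ (wb y))//.
      by rewrite ler_piMl// exprn_ile1.
    by rewrite mul0r addr0 ler_wpM2r// ler_wiXn2l// ltnW.
  rewrite big_split -mulr_sumr (lazy_walk_sum e K) mulr1 lerD2l -mulr_suml.
  by rewrite ler_wpM2r// -natr_sum ler_nat ball_card.
have : K / c * r <= K / c * \sum_(y : T) r ^+ d y * lazy_step e K x y.
  by rewrite ler_wpM2l// divr_ge0 ?ltW.
lra.
Qed.

End Averages.

(** * Separation of the two norms *)

Section Blocks.
Variables (R : realType) (X : nat -> finType) (q : forall n, X n -> X n -> R).

Definition block_kernel (p r : {n & X n}) : R :=
  if tag p == tag r then q (tagged p) (tagged_as p r) else 0.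

Lemma blockE n (x y : X n) : block_kernel (Tagged X x) (Tagged X y) = q x y.
Proof. by rewrite /block_kernel eqxx tagged_asE. Qed.

Lemma block_neq m n (x : X m) (y : X n) : m != n -> block_kernel (Tagged X x) (Tagged X y) = 0.
Proof. by rewrite /block_kernel /= => /negbTE ->. Qed.

(** A block diagonal operator is bounded by the norm of its blocks; finitely many
    whole blocks contain the finite sets [s] and [t]. *)
Lemma block_norm (C : R) :
  (forall n (f : X n -> R[i]),
    \sum_(x : X n) modulus (\sum_(y : X n) (q x y)%:C%C * f y) ^+ 2 <=
      C ^+ 2 * \sum_(x : X n) modulus (f x) ^+ 2) ->
  forall (s t : seq {n & X n}) (f : {n & X n} -> R[i]), uniq s -> uniq t ->
    \sum_(p <- t) modulus (\sum_(r <- s) (block_kernel p r)%:C%C * f r) ^+ 2 <=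
      C ^+ 2 * \sum_(r <- s) modulus (f r) ^+ 2.
Proof.
move=> qC s t f us ut.
pose M := (\max_(p <- s ++ t) tag p).+1.
pose u := [seq Tagged X x | n <- iota 0 M, x <- enum (X n)].
have uE (V : nmodType) (F : {n & X n} -> V) :
    \sum_(p <- u) F p = \sum_(n <- iota 0 M) \sum_(x : X n) F (Tagged X x).
  rewrite /u big_allpairs_dep; apply: eq_bigr => n _.
  by rewrite big_enum.
have uu : uniq u.
  apply: allpairs_uniq_dep; [exact: iota_uniq|by move=> n _; exact: enum_uniq|].
  by move=> [m x] [n y] _ _ /=; exact.
have su p : p \in s ++ t -> p \in u.
  case: p => n x nx; apply/allpairsPdep; exists n, x; split=> //; last by rewrite mem_enum.
  by rewrite mem_iota /= add0n ltnS (@leq_bigmax_seq _ (s ++ t) xpredT (fun p => tag p) (Tagged X x)).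
pose f' r := if r \in s then f r else 0.
have ext (V : nmodType) (F : {n & X n} -> V) :
    \sum_(r <- s) F r = \sum_(r <- u) (if r \in s then F r else 0).
  rewrite -big_mkcond -[RHS]big_filter; apply: perm_big.
  apply: uniq_perm; rewrite ?filter_uniq// => r; rewrite mem_filter.
  by case: (boolP (r \in s)) => //= rs; rewrite su// mem_cat rs.
have inner p : \sum_(r <- s) (block_kernel p r)%:C%C * f r = \sum_(r <- u) (block_kernel p r)%:C%C * f' r.
  by rewrite ext; apply: eq_bigr => r _; rewrite /f'; case: ifP => _; rewrite ?mulr0.
under eq_bigr => p _ do rewrite inner.
have le1 (F : {n & X n} -> R) : (forall p, 0 <= F p) -> \sum_(p <- t) F p <= \sum_(p <- u) F p.
  move=> F0; rewrite [leRHS](bigID (fun p => p \in t))/= ler_wpDr ?sumr_ge0//.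
  rewrite -[leRHS]big_filter; rewrite (perm_big [seq p <- u | p \in t])//.
  apply: uniq_perm; rewrite ?filter_uniq// => r; rewrite mem_filter.
  by case: (boolP (r \in t)) => //= rt; rewrite su// mem_cat rt orbT.
apply: le_trans (le1 _ _) _; first by move=> p; exact: sqr_ge0.
have -> : \sum_(r <- s) modulus (f r) ^+ 2 = \sum_(r <- u) modulus (f' r) ^+ 2.
  rewrite ext; apply: eq_bigr => r _; rewrite /f'; case: ifP => // _.
  by rewrite /modulus normr0 expr0n.
rewrite !uE mulr_sumr; rewrite big_seq [leRHS]big_seq; apply: ler_sum => n nM.
rewrite (le_trans _ (qC n (fun x => f' (Tagged X x))))//.
apply: ler_sum => x _; rewrite uE (bigD1_seq n) ?iota_uniq//= [X in _ + X]big1 ?addr0.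
  by under eq_bigr => y _ do rewrite blockE.
by move=> m mn; apply: big1 => y _; rewrite block_neq ?mul0r// eq_sym.
Qed.

End Blocks.

Lemma expr_small (R : realType) (z eps : R) : 0 <= z < 1 -> 0 < eps ->
  exists k, z ^+ k <= eps.
Proof.
move=> /andP[z0 z1] e0; have zn : `|z| < 1 by rewrite ger0_norm.
have /cvgrPdist_le/(_ _ e0)[k _ kP] := cvg_expr zn.
exists k; have := kP k (leqnn k).
by rewrite sub0r normrN ger0_norm// exprn_ge0.
Qed.

Theorem lemma4p7 (R : realType) (G : groupType) (S : seq G)
    (X : nat -> finType) (e : forall n, rel (X n))
    (d : {n & X n} -> {n & X n} -> R) (i : {n & X n} -> G) :
  ~ exact_group R G ->
  generates S ->
  (forall n, symmetric (e n)) ->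
  (forall n, irreflexive (e n)) ->
  (forall n (x y : X n), connect (e n) x y) ->
  bounded_degree e ->
  girth R (e n) @[n --> \oo] --> +oo%E ->
  is_expander R e ->
  is_coarse_union e d ->
  (forall x y, word_metric R S (i x) (i y) = d x y) ->
  exists2 a : G -> linf R G, Cc a &
    inj_norm (@ltrans R G) a <> red_norm (@ltrans R G) a.
Proof.
move=> _ Sgen es ei ec [D degD] girth_oo [card_oo _ [c c0 gap]].
move=> [[_ d0 _ _] dX _] wmd.
have i_inj : injective i.
  by move=> p q ipq; apply/d0; rewrite -wmd ipq wmd; apply/d0.
pose j n (x : X n) := i (Tagged X x).
have j_inj n : injective (@j n).
  by move=> x y /i_inj; exact: eq_from_Tagged.
have wmj n (x y : X n) : word_metric R S (j n x) (j n y) = (dist (ec n) x y)%:R.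
  by rewrite wmd dX (graph_metricE (ec n)).
(* The Laplacians are bounded by [2 D]. *)
pose K : R := 2 * D%:R + 1 + c.
have KD : 2 * D%:R + 1 <= K by rewrite lerDl ltW.
have D0 : 0 <= D%:R :> R by [].
have cK : c <= K by rewrite /K; lra.
have K0 : 0 < K by rewrite /K; lra.
(* Replacing [M] by [r M] costs [1 / 4], and each of the following costs at most
   [1 / 4] of the gain [1] in the average: the far part [r ^ m] of the walk, and
   its near part, namely [1 / 8] for the powers of [1 - c / K], by the choice of
   [k], and [1 / 8] for the constants, when [X n] is large. *)
pose r := 1 - c / (4 * K).
have dr : 0 < c / (4 * K) <= 4^-1.
  by rewrite divr_gt0 ?mulr_gt0//= ler_pdivrMr ?mulr_gt0// mulKf.
have r01 : 0 <= r <= 1 by rewrite /r; lra.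
have r1 : 0 <= r < 1 by rewrite /r; lra.
have Kr : K / c * r = K / c - 4^-1 by rewrite /r; field; rewrite !gt_eqF.
have q4 : 0 < 4^-1 :> R by rewrite invr_gt0.
have [m rm] := expr_small r1 q4.
pose b : R := (D.+1 ^ m)%:R.
have b0 : 0 < b by rewrite ltr0n expn_gt0.
have z01 : 0 <= 1 - c / K < 1.
  by rewrite subr_ge0 ler_pdivrMr// mul1r cK/= ltrBlDr ltrDl divr_gt0.
have b8 : 0 < (8 * b)^-1 by rewrite invr_gt0 mulr_gt0.
have [k zk] := expr_small z01 b8.
pose Q := block_kernel (fun n => gap_kernel (e n) c K k).
have QM p q : `|Q p q| <= K / c + 2.
  case: p q => n x [n' y]; have [E|nE] := eqVneq n n'.
    by case: n' / E y => y; rewrite /Q blockE; exact: (gap_kernel_bound (degD n) c0 KD).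
  by rewrite /Q block_neq// normr0 addr_ge0// divr_ge0// ltW.
have Qr p q : Q p q != 0 -> ((i p)^-1 * i q)%g \in word_ball S k.+1.
  case: p q => n x [n' y]; have [E|nE] := eqVneq n n'; last by rewrite /Q block_neq ?eqxx.
  case: n' / E y => y; rewrite /Q blockE => Qn.
  apply: (word_metric_ball Sgen (wmj n x y)); rewrite leqNgt.
  by apply: contra Qn => /gap_kernel_far ->.
have ca := kernel_elt_Cc QM Qr; exists (kernel_elt i QM) => //.
have red : (red_norm (@ltrans R G) (kernel_elt i QM) <= (K / c)%:E)%E.
  apply: (kernel_red_norm i_inj QM Qr); first by rewrite divr_ge0// ltW.
  apply: block_norm => n f.
  exact: (gap_kernel_norm (es n) (ei n) (degD n) c0 (gap n) KD k f).
suff inj : ((K / c + 4^-1)%:E <= inj_norm (@ltrans R G) (kernel_elt i QM))%E.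
  by move=> E; have := le_trans inj; rewrite E => /(_ _ red); rewrite lee_fin; lra.
apply: (@inj_norm_ge R G X j (fun n x y => r ^+ dist (ec n) x y)) => //.
- by move=> n x y; rewrite dist_sym.
- move=> n x y; have /andP[r0 r1'] := r01.
  by rewrite ger0_norm ?exprn_ge0// exprn_ile1.
(* By left invariance, the diameter [mm] of [rr] bounds that of all its
   translates. *)
- move=> rr; pose mm := \max_(g <- rr) \max_(h <- rr) Num.bound (word_metric R S g h).
  have mmP g h l : g \in rr -> h \in rr -> word_metric R S g h = l%:R -> (l <= mm)%N.
    move=> grr hrr ghl; apply: (@leq_trans (\max_(h <- rr) Num.bound (word_metric R S g h))).
      apply: leq_trans (@leq_bigmax_seq _ rr xpredT
        (fun h => Num.bound (word_metric R S g h)) h hrr isT).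
      by rewrite ghl ltnW// -(ltr_nat R) archi_boundP.
    exact: (@leq_bigmax_seq _ rr xpredT (fun g => \max_(h <- rr) Num.bound (word_metric R S g h))).
  have /cvgeyPgt/(_ (4 * mm)%:R)[N _ gN] := girth_oo.
  exists N => n /gN/= gn z.
  have cyc c' : is_graph_cycle (e n) c' -> (4 * mm < size c')%N.
    move=> cc; rewrite -(ltr_nat R) -lte_fin (lt_le_trans gn)//.
    by apply: ereal_inf_lbound; exists c'.
  have [[p pz]|no] := pselect (exists p, (z^-1 * j n p)%g \in rr); last first.
    by exists unit, (fun _ _ => 0) => x y xz; case: no; exists x.
  have [I [xi xiP]] := tree_gram (es n) (ei n) (ec n) cyc p r01 (leqnn _).
  exists I, xi => x y xz yz; apply: xiP; [apply: (mmP _ _ _ pz xz)|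
    apply: (mmP _ _ _ pz yz)]; by rewrite word_metricM wmj.
- have [N _ cardN] := card_oo _ (nbhs_infty_ge (Num.bound (8 * b))).
  exists N => n /cardN/= cn.
  have bn : 8 * b < #|X n|%:R.
    apply: lt_le_trans (archi_boundP _) _; last by rewrite ler_nat.
    by rewrite mulr_ge0// ltW.
  have n0 : (0 < #|X n|)%N.
    by rewrite -(ltr_nat R) (lt_trans _ bn)// mulr_gt0.
  have := gap_kernel_average (es n) (ei n) (ec n) (degD n) c0 (gap n) KD cK m k r01 n0.
  have -> : \sum_(x : X n) \sum_(y : X n) r ^+ dist (ec n) x y *
      complex.Re (kernel_elt i QM ((j n x)^-1 * j n y)%g (j n x)^-1%g) =
    \sum_(x : X n) \sum_(y : X n) r ^+ dist (ec n) x y * gap_kernel (e n) c K k x y.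
    apply: eq_bigr => x _; apply: eq_bigr => y _.
    by rewrite /j kernel_eltE// /Q blockE.
  apply: le_trans; rewrite Kr.
  have x1 : b * #|X n|%:R^-1 <= 8^-1.
    by rewrite ler_pdivrMr ?ltr0n// ler_pdivlMl//; exact: ltW.
  have x2 : b * (1 - c / K) ^+ k <= 8^-1.
    rewrite -ler_pdivlMl//; apply: le_trans zk _.
    by rewrite invfM mulrC.
  rewrite -/b mulrDr; lra.
Qed.
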